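(* Let $n\ge 3$, $m\ge 1$, and let $g:\overline{\mathbb{B}^n}\to\mathbb{R}^m$ be continuous with $$\|g\|_\infty<\frac{nA_n}{1+2^{-n/2}},\qquad A_n=\frac{n!\left[1+n-(n-2)F\left(\tfrac12,1;\tfrac{n+3}{2};-1\right)\right]}{2^{3n/2}\,\Gamma\left(\tfrac{n+1}{2}\right)\Gamma\left(\tfrac{n+3}{2}\right)}.$$ Let $f:\overline{\mathbb{B}^n}\to\mathbb{R}^m$ be continuous on $\overline{\mathbb{B}^n}$, of class $\mathcal{C}^2$ in $\mathbb{B}^n$, with $f(\mathbb{B}^n)\subset\mathbb{B}^m$ and $\Delta f=g$ in $\mathbb{B}^n$. If $f(0)=0$ and $\lim_{r\to1^-}|f(r\zeta)|=1$ for some $\zeta\in\mathbb{S}^{n-1}$, then $$\liminf_{r\to1^-}\frac{|f(\zeta)-f(r\zeta)|}{1-r}\ge A_n-\frac{\|g\|_\infty}{n}\left(1+\frac{1}{2^{n/2}}\right).$$ In particular, if $\|g\|_\infty=0$, then the estimate is sharp, i.e. in the case $g=0$ the constant $A_n$ on the right-hand side cannot be replaced by any larger constant.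
   Context: $\mathbb{B}^k$ is the open unit ball of $\mathbb{R}^k$ (so $\mathbb{B}^1=(-1,1)$), $\mathbb{S}^{n-1}$ is the unit sphere of $\mathbb{R}^n$, and $|\cdot|$ is the Euclidean norm. The Laplacian $\Delta f=\sum_{k=1}^n\partial^2f/\partial x_k^2$ is taken componentwise, and $\|g\|_\infty=\sup_{x\in\mathbb{B}^n}|g(x)|$. $\Gamma$ is the Gamma function and $F(a,b;c;x)=\sum_{k=0}^\infty\frac{(a)_k(b)_k}{(c)_k}\frac{x^k}{k!}$ is the Gauss hypergeometric function, with $(a)_0=1$ and $(a)_k=a(a+1)\cdots(a+k-1)$ for $k\ge1$ (at the parameters used above the series converges at $x=-1$). *)

(* Defs.v *)
From HB Require Import structures.
From mathcomp Require Import all_boot all_order all_algebra.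
From mathcomp Require Import all_classical all_reals all_analysis.

Set Implicit Arguments.
Unset Strict Implicit.
Unset Printing Implicit Defensive.

Import Order.TTheory GRing.Theory Num.Theory.
Import numFieldNormedType.Exports.

Local Open Scope classical_set_scope.
Local Open Scope ring_scope.

(* The library's norm on ['rV[R]_n] is the sup norm; it induces the usual
   topology, so only the metric notions have to be restated for |.|. *)
Definition enorm (R : realType) (n : nat) (x : 'rV[R]_n) : R :=
  Num.sqrt (\sum_(i < n) x 0 i ^+ 2).

Definition eball (R : realType) (n : nat) : set 'rV[R]_n :=
  [set x | enorm x < 1].

Definition eclosed_ball (R : realType) (n : nat) : set 'rV[R]_n :=
  [set x | enorm x <= 1].

Definition esphere (R : realType) (n : nat) : set 'rV[R]_n :=
  [set x | enorm x = 1].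

Arguments eball R n : clear implicits.
Arguments eclosed_ball R n : clear implicits.
Arguments esphere R n : clear implicits.

(* The supremum is over the open ball; it is finite for the functions of
   interest, which are continuous on the closed ball. *)
Definition supnorm (R : realType) (n m : nat) (g : 'rV[R]_n -> 'rV[R]_m) : R :=
  sup [set enorm (g x) | x in eball R n].

Definition partial (R : realType) (n : nat) (k : 'I_n) (u : 'rV[R]_n -> R) :
  'rV[R]_n -> R := fun x => 'D_(delta_mx 0 k) u x.

Definition component (R : realType) (n m : nat) (f : 'rV[R]_n -> 'rV[R]_m)
  (i : 'I_m) : 'rV[R]_n -> R := fun x => f x 0 i.

(* Meaningful for an open [U]: each derivative at a point of [U] then depends
   only on the values of [u] on [U]. *)
Definition C1_on (R : realType) (n : nat) (U : set 'rV[R]_n)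
    (u : 'rV[R]_n -> R) : Prop :=
  forall x, U x -> {for x, continuous u} /\
    forall k : 'I_n, derivable u x (delta_mx 0 k) /\
                     {for x, continuous (partial k u)}.

Definition C2_on (R : realType) (n m : nat) (U : set 'rV[R]_n)
    (f : 'rV[R]_n -> 'rV[R]_m) : Prop :=
  forall i : 'I_m, C1_on U (component f i) /\
    forall k : 'I_n, C1_on U (partial k (component f i)).

Definition laplacian (R : realType) (n m : nat) (f : 'rV[R]_n -> 'rV[R]_m)
    (x : 'rV[R]_n) : 'rV[R]_m :=
  \row_(i < m) \sum_(k < n) partial k (partial k (component f i)) x.

Definition Gamma (R : realType) (a : R) : R :=
  \int[@lebesgue_measure R]_(t in `]0, +oo[) (t `^ (a - 1) * expR (- t)).

Definition pochhammer (R : realType) (a : R) (k : nat) : R :=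
  \prod_(0 <= j < k) (a + j%:R).

(* The limit is a junk value where the series diverges. *)
Definition hyp2F1 (R : realType) (a b c x : R) : R :=
  limn (series (fun k => pochhammer a k * pochhammer b k / pochhammer c k
                         * (x ^+ k / k`!%:R))).

Definition A_ (R : realType) (n : nat) : R :=
  n`!%:R
  * (1 + n%:R - (n%:R - 2) * hyp2F1 (1 / 2) 1 ((n%:R + 3) / 2) (- 1))
  / (2 `^ (3 * n%:R / 2) * Gamma ((n%:R + 1) / 2) * Gamma ((n%:R + 3) / 2)).

Definition lower_radial_slope (R : realType) (n m : nat)
    (f : 'rV[R]_n -> 'rV[R]_m) (zeta : 'rV[R]_n) : \bar R :=
  limf_einf (fun r : R => (enorm (f zeta - f (r *: zeta)) / (1 - r))%:E)
            (1 : R)^'-.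

Arguments A_ R n : clear implicits.

(* Main.v *)
Require Import Defs.
From mathcomp Require Import all_boot all_order all_algebra.
From mathcomp Require Import all_classical all_reals all_analysis.
From mathcomp Require Import ring lra.
Import Order.TTheory GRing.Theory Num.Theory.
Import numFieldNormedType.Exports.
Local Open Scope classical_set_scope.
Local Open Scope ring_scope.
Set Implicit Arguments.
Unset Strict Implicit.
Unset Printing Implicit Defensive.

(** The vector [w = f zeta] has norm 1, and [|f zeta - f (r zeta)|] is at least
    [1 - u (r zeta)] for the real function [u x = <f x, w>], which satisfies
    [|u| <= 1], [u 0 = 0] and [|Laplacian u| <= G], with [G] the sup norm of
    [g]. Let [h] be the Poisson integral of [u] restricted to the sphere. Adding
    multiples of [|x|^2 - 1] to [u - h], the maximum principle gives
    [|u - h| <= G / (2 n) (1 - |x|^2)] (lemma [comparison], used for both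
    signs); in particular the mean of [u] over the sphere, which is [h 0], is at
    most [G / (2 n)].

    Only a linear problem for [h] is left. At [r zeta] the Poisson kernel is
    [(1 - r^2) k_r(t)], where [t = <e, zeta>] and [k_r] is increasing. As the
    mean of the kernel is 1, [1 - h (r zeta)] is [1 - r^2] times the sum of the
    mean of [(k_r(t) - k_r(0)) (1 - u)] and of [k_r(0) (1 - mean of u)]
    ([gap_mean]). Since [0 <= 1 - u <= 2], the first integrand is at least
    [2 min (k_r(t) - k_r(0), 0)] ([gain_lower]): the worst boundary function is
    1 on the upper and -1 on the lower hemisphere. Dividing by [1 - r] and
    letting [r] tend to 1 gives [2 (2 M - K (1 + G / (2 n)) - G / (2 n))], where
    [K = 2^(-n/2)] and [M] is the mean of [(2 - 2 min (t, 0))^(-n/2)]. The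
    identity [4 M = A_n + 2 K] ([axial_integral]) turns this into the claim.

    For that identity, polar coordinates express [M] by integrals of
    [cos(t/2)^a / sin(t/2)^b] over the lower hemisphere, divided by a Wallis
    integral. Integration by parts raises [a] and [b] by 2; iterating it
    produces the hypergeometric series at -1 with a remainder tending to 0
    ([hyp2F1E]), and the Wallis integral is a quotient of Gamma values
    ([wallis_Gamma]).

    The constant is sharp because the bounds above are equalities for the sign
    of [t], apart from its discontinuity at the equator. The Poisson integral of
    the odd continuous function [clamp d t], equal to the sign of [t] when
    [|t| >= d], has a slope whose bound tends to [A_n] when [r] tends to 1 and
    then [d] to 0 ([gap_upper], [sharp_constant]).

    The mean over the sphere is a positive normalised linear functional on
    continuous functions, defined by induction on the dimension with polar
    coordinates ([suspended_mean]). Full rotation invariance is replaced by a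
    divergence theorem for fields with a zonal potential ([divergence_free]),
    which passes through the induction and suffices to show that the Poisson
    kernel has mean 1 ([mean_kernel]). This yields the boundary values of
    Poisson integrals, and hence the solution of the Dirichlet problem in the
    ball ([continuous_poisson_ext]). *)

(** * Rules for directional derivatives and pointwise continuity *)

(** A synonym of [is_derive] that is not a class: a tactic that applies the
    rules below then controls the shape of the derivative it computes. *)
Definition has_der (R : realType) (V : normedModType R) (x v : V) (f : V -> R)
  (l : R) : Prop := is_derive x v f l.

Section Rules.
Variables (R : realType) (V : normedModType R).
Implicit Types (f g : V -> R) (x v : V).

Lemma derE f x v l l' : is_derive x v f l -> l = l' -> is_derive x v f l'.
Proof. by move=> h <-. Qed.

Lemma has_derP f x v l l' : has_der x v f l -> l = l' -> is_derive x v f l'.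
Proof. exact: derE. Qed.

Lemma is_derive_line f x v l :
  is_derive x v f l <-> is_derive (0 : R) 1 (fun h : R => f (h *: v + x)) l.
Proof.
have E : 'D_1 (fun h : R => f (h *: v + x)) 0 = 'D_v f x.
  rewrite /derive; set g1 := fun h => h^-1 *: _; set g2 := fun h => h^-1 *: _.
  suff -> : g1 = g2 by []; apply/funext => h; rewrite /g1 /g2 /=.
  by rewrite addr0 scale0r add0r [_%:A]mulr1.
split=> -[d e]; apply: DeriveDef.
- exact: (iffLR (derivable1P _ _ _) d).
- by rewrite E.
- exact: (iffRL (derivable1P _ _ _) d).
- by rewrite -E.
Qed.

Lemma has_der_cst x v (c : R) : has_der x v (fun=> c) 0.
Proof. exact: is_derive_cst. Qed.

Lemma has_der_id (t : R) : has_der t (1 : R) id (1 : R).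
Proof. exact: is_derive_id. Qed.

Lemma has_derD f g x v a b : has_der x v f a -> has_der x v g b ->
  has_der x v (fun y => f y + g y) (a + b).
Proof. exact: is_deriveD. Qed.

Lemma has_derN f x v a : has_der x v f a -> has_der x v (fun y => - f y) (- a).
Proof. exact: is_deriveN. Qed.

Lemma has_derM f g x v a b : has_der x v f a -> has_der x v g b ->
  has_der x v (fun y => f y * g y) (f x * b + g x * a).
Proof. exact: is_deriveM. Qed.

Lemma has_derX f n x v a : has_der x v f a ->
  has_der x v (fun y => f y ^+ n) (n%:R * f x ^+ n.-1 * a).
Proof.
move=> df; have := is_deriveX n df.
by rewrite (_ : (f ^+ n) = fun y => f y ^+ n)// funeqE => y; rewrite fctE.
Qed.

Lemma has_derV f x v a : f x != 0 -> has_der x v f a ->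
  has_der x v (fun y => (f y)^-1) (- (f x) ^- 2 * a).
Proof.
move=> fx [df <-]; apply: DeriveDef; first exact: derivableV.
by rewrite deriveV.
Qed.

(** The chain rule along the line through [x] of direction [v]. *)
Lemma has_der_comp (F : R -> R) f x v a b : is_derive (f x) (1 : R) F b ->
  has_der x v f a -> has_der x v (fun y => F (f y)) (b * a).
Proof.
move=> dF /is_derive_line df; apply/is_derive_line.
set h := fun t : R => f (t *: v + x) in df *.
have h0 : h 0 = f x by rewrite /h scale0r add0r.
have [dh eh] := df; have [dF1 eF] := dF.
have dFh : derivable F (h 0) 1 by rewrite h0.
apply: DeriveDef.
  apply/derivable1_diffP; apply: differentiable_comp; exact/derivable1_diffP.
by rewrite -derive1E (derive1_comp dh dFh) !derive1E h0 eh eF.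
Qed.

Lemma has_der_powR f c x v a : 0 < f x -> has_der x v f a ->
  has_der x v (fun y => f y `^ c) (c * f x `^ (c - 1) * a).
Proof.
by move=> fx; apply: (@has_der_comp (fun y => y `^ c) f); exact: is_derive1_powR.
Qed.

Lemma der_sum m (f : 'I_m -> V -> R) x v (a : 'I_m -> R) :
  (forall i, is_derive x v (f i) (a i)) ->
  is_derive x v (fun y => \sum_i f i y) (\sum_i a i).
Proof.
move=> df; have := is_derive_sum df.
by congr (is_derive _ _ _ _); apply/funext => y; rewrite fct_sumE.
Qed.

Lemma der_near f g x v a : (\forall y \near x, f y = g y) ->
  is_derive x v f a -> is_derive x v g a.
Proof.
move=> fg [df <-]; apply: DeriveDef; first exact: near_eq_derivable fg df.
by apply: near_eq_derive; apply: filterS fg => y ->.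
Qed.

Lemma continuous_is_derive (F : R -> R) t l :
  is_derive t (1 : R) F l -> {for t, continuous F}.
Proof. by case=> /derivable1_diffP h _; exact: differentiable_continuous. Qed.

End Rules.

(** [der] reduces a goal [is_derive x v f l] to an equation between [l] and the
    derivative found by the rules, preceded by the side conditions of the
    inverse and of the real power; derivatives of other functions are looked up
    in the context. *)
Ltac der_rec := lazymatch goal with
  | |- has_der _ _ (fun _ => ?c) _ => eapply has_der_cst
  | |- has_der _ _ (fun x => x) _ => eapply has_der_id
  | |- has_der _ _ id _ => eapply has_der_id
  | |- has_der _ _ (@GRing.opp _) _ =>
      refine (@has_derN _ _ id _ _ _ _); der_rec
  | |- has_der _ _ (GRing.mul ?c) _ =>
      refine (@has_derM _ _ (fun=> c) id _ _ _ _ _ _); der_rec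
  | |- has_der _ _ (GRing.add ?c) _ =>
      refine (@has_derD _ _ (fun=> c) id _ _ _ _ _ _); der_rec
  | |- has_der _ _ (fun x => _ + _) _ => eapply has_derD; der_rec
  | |- has_der _ _ (fun x => - _) _ => eapply has_derN; der_rec
  | |- has_der _ _ (fun x => _ ^+ _) _ => eapply has_derX; der_rec
  | |- has_der _ _ (fun x => _^-1) _ => eapply has_derV; [|der_rec]
  | |- has_der _ _ (fun x => _ `^ _) _ => eapply has_der_powR; [|der_rec]
  | |- has_der _ _ (fun x => _ * _) _ => eapply has_derM; der_rec
  | |- has_der _ _ sin _ => eapply is_derive_sin
  | |- has_der _ _ cos _ => eapply is_derive_cos
  | |- has_der _ _ expR _ => eapply is_derive_expR
  | |- has_der _ _ (fun x => sin _) _ => eapply (has_der_comp (is_derive_sin _)); der_rec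
  | |- has_der _ _ (fun x => cos _) _ => eapply (has_der_comp (is_derive_cos _)); der_rec
  | |- has_der _ _ (fun x => expR _) _ => eapply (has_der_comp (is_derive_expR _)); der_rec
  | _ => try eassumption end.

Ltac der := eapply has_derP; [der_rec|].

Section ContinuityRules.
Variables (R : realType) (T : topologicalType) (z : T).
Implicit Types f g : T -> R.

Lemma contD f g : {for z, continuous f} -> {for z, continuous g} ->
  {for z, continuous (fun y => f y + g y)}.
Proof. exact: continuousD. Qed.

Lemma contN f : {for z, continuous f} -> {for z, continuous (fun y => - f y)}.
Proof. exact: continuousN. Qed.

Lemma contM f g : {for z, continuous f} -> {for z, continuous g} ->
  {for z, continuous (fun y => f y * g y)}.
Proof. exact: continuousM. Qed.

Lemma contX f n : {for z, continuous f} ->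
  {for z, continuous (fun y => f y ^+ n)}.
Proof.
move=> cf; apply: (@continuous_comp _ _ _ f (fun x => x ^+ n)) => //.
exact: exprn_continuous.
Qed.

Lemma contV f : f z != 0 -> {for z, continuous f} ->
  {for z, continuous (fun y => (f y)^-1)}.
Proof. by move=> fz cf; apply: continuousV. Qed.

Lemma cont_comp (F : R -> R) f : {for f z, continuous F} ->
  {for z, continuous f} -> {for z, continuous (fun y => F (f y))}.
Proof. by move=> cF cf; exact: (@continuous_comp _ _ _ f F). Qed.

Lemma cont_powR f c : 0 < f z -> {for z, continuous f} ->
  {for z, continuous (fun y => f y `^ c)}.
Proof.
move=> fz; apply: (@cont_comp (fun y => y `^ c) f).
by apply: (@continuous_is_derive _ _ _ (c * f z `^ (c - 1))); exact: is_derive1_powR.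
Qed.

Lemma cont_sum m (f : 'I_m -> T -> R) : (forall i, {for z, continuous (f i)}) ->
  {for z, continuous (fun y => \sum_i f i y)}.
Proof.
move=> cf; apply: (@cvg_big _ _ _ _ _ _ _ (nbhs z)) => [|i _].
  exact: add_continuous.
exact: cf.
Qed.

End ContinuityRules.

Lemma cont_id (R : realType) (z : R) : {for z, continuous (fun y : R => y)}.
Proof. exact: cvg_id. Qed.

Ltac cont := lazymatch goal with
  | |- {for _, continuous (fun _ => ?c)} => exact: cst_continuous
  | |- {for _, continuous (fun x => x)} => exact: cont_id
  | |- {for _, continuous id} => exact: cont_id
  | |- {for _, continuous (@GRing.opp _)} =>
      refine (@contN _ _ _ id _); cont
  | |- {for _, continuous (GRing.mul ?c)} =>
      refine (@contM _ _ _ (fun=> c) id _ _); cont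
  | |- {for _, continuous (GRing.add ?c)} =>
      refine (@contD _ _ _ (fun=> c) id _ _); cont
  | |- {for _, continuous (fun x => _ + _)} => apply: contD; cont
  | |- {for _, continuous (fun x => - _)} => apply: contN; cont
  | |- {for _, continuous (fun x => _ ^+ _)} => apply: contX; cont
  | |- {for _, continuous (fun x => _^-1)} => apply: contV; [|cont]
  | |- {for _, continuous (fun x => _ `^ _)} => apply: cont_powR; [|cont]
  | |- {for _, continuous (fun x => _ * _)} => apply: contM; cont
  | |- {for _, continuous (fun x => sin _)} =>
      apply: (cont_comp (@continuous_sin _ _)); cont
  | |- {for _, continuous (fun x => cos _)} =>
      apply: (cont_comp (@continuous_cos _ _)); cont
  | |- {for _, continuous sin} => exact: continuous_sin
  | |- {for _, continuous cos} => exact: continuous_cos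
  | _ => try assumption end.

(** * Euclidean geometry of row vectors *)

Definition dot (R : realType) (n : nat) (x y : 'rV[R]_n) : R :=
  \sum_(i < n) x 0 i * y 0 i.

Section Dot.
Variables (R : realType) (n : nat).
Implicit Types (x y z : 'rV[R]_n) (a : R).

Lemma dotC x y : dot x y = dot y x.
Proof. by apply: eq_bigr => i _; rewrite mulrC. Qed.

Lemma dotDl x y z : dot (x + y) z = dot x z + dot y z.
Proof. by rewrite /dot -big_split; apply: eq_bigr => i _; rewrite mxE mulrDl. Qed.

Lemma dotZl a x y : dot (a *: x) y = a * dot x y.
Proof. by rewrite /dot mulr_sumr; apply: eq_bigr => i _; rewrite mxE mulrA. Qed.

Lemma dotNl x y : dot (- x) y = - dot x y.
Proof. by rewrite -scaleN1r dotZl mulN1r. Qed.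

Lemma dotBl x y z : dot (x - y) z = dot x z - dot y z.
Proof. by rewrite dotDl dotNl. Qed.

Lemma dotDr x y z : dot z (x + y) = dot z x + dot z y.
Proof. by rewrite dotC dotDl !(dotC z). Qed.

Lemma dotZr a x y : dot y (a *: x) = a * dot y x.
Proof. by rewrite dotC dotZl dotC. Qed.

Lemma dotBr x y z : dot z (x - y) = dot z x - dot z y.
Proof. by rewrite dotC dotBl !(dotC z). Qed.

Lemma dot0l x : dot 0 x = 0.
Proof. by rewrite -(scale0r x) dotZl mul0r. Qed.

Lemma dotxx_ge0 x : 0 <= dot x x.
Proof. by apply: sumr_ge0 => i _; rewrite -expr2 sqr_ge0. Qed.

Lemma dotxx_eq0 x : (dot x x == 0) = (x == 0).
Proof.
apply/idP/eqP => [|->]; last by rewrite dot0l.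
rewrite psumr_eq0 => [/allP h|i _]; last by rewrite -expr2 sqr_ge0.
apply/rowP => i; rewrite mxE; apply/eqP.
by have := h i (mem_index_enum i); rewrite /= mulf_eq0 orbb.
Qed.

Lemma dot_sqr_le x y : dot x y ^+ 2 <= dot x x * dot y y.
Proof.
have [->|y0] := eqVneq y 0; first by rewrite dotC !dot0l mulr0 expr0n.
have yy : 0 < dot y y by rewrite lt_def dotxx_eq0 y0 dotxx_ge0.
have := dotxx_ge0 (dot y y *: x - dot x y *: y).
rewrite !(dotBl, dotBr, dotZl, dotZr) (dotC y x) => h.
rewrite -subr_ge0 -(pmulr_rge0 _ yy).
by apply: le_trans h _; rewrite le_eqVlt; apply/orP; left; apply/eqP; ring.
Qed.

Lemma enormE x : enorm x = Num.sqrt (dot x x).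
Proof. by congr Num.sqrt; apply: eq_bigr => i _; rewrite expr2. Qed.

Lemma enorm_ge0 x : 0 <= enorm x.
Proof. exact: sqrtr_ge0. Qed.

Lemma enorm_sqr x : enorm x ^+ 2 = dot x x.
Proof. by rewrite enormE sqr_sqrtr// dotxx_ge0. Qed.

Lemma dot_le x y : `|dot x y| <= enorm x * enorm y.
Proof.
rewrite -(@ler_pXn2r _ 2)// ?nnegrE ?mulr_ge0 ?enorm_ge0//.
by rewrite exprMn !enorm_sqr real_normK ?num_real// dot_sqr_le.
Qed.

Lemma enormD x y : enorm (x + y) <= enorm x + enorm y.
Proof.
rewrite -(@ler_pXn2r _ 2)// ?nnegrE ?addr_ge0 ?enorm_ge0//.
rewrite sqrrD !enorm_sqr dotDl !dotDr (dotC y x).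
by have := dot_le x y; rewrite ler_norml => /andP[_]; lra.
Qed.

Lemma enormZ a x : enorm (a *: x) = `|a| * enorm x.
Proof. by rewrite !enormE dotZl dotZr mulrA -expr2 sqrtrM ?sqr_ge0// sqrtr_sqr. Qed.

Lemma enormN x : enorm (- x) = enorm x.
Proof. by rewrite -scaleN1r enormZ normrN1 mul1r. Qed.

Lemma enormB x y : enorm x - enorm y <= enorm (x - y).
Proof. by rewrite lerBlDr; apply: le_trans (enormD _ _); rewrite subrK. Qed.

Lemma enorm0 : enorm (0 : 'rV[R]_n) = 0.
Proof. by rewrite -(scale0r 0) enormZ normr0 mul0r. Qed.

Lemma coord_le_enorm x i : `|x 0 i| <= enorm x.
Proof.
rewrite -(@ler_pXn2r _ 2)// ?nnegrE ?enorm_ge0// enorm_sqr real_normK ?num_real//.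
by rewrite /dot (bigD1 i)//= expr2 lerDl sumr_ge0// => j _; rewrite -expr2 sqr_ge0.
Qed.

Lemma esphereE x : esphere R n x <-> dot x x = 1.
Proof.
rewrite /esphere /= enormE; split => [h|->]; last by rewrite sqrtr1.
by rewrite -[LHS]sqr_sqrtr ?dotxx_ge0// h expr1n.
Qed.

Lemma dot_delta i x : dot (delta_mx 0 i) x = x 0 i.
Proof.
rewrite /dot (bigD1 i)//= mxE !eqxx mul1r big1 ?addr0// => j ji.
by rewrite mxE (negbTE ji) andbF mul0r.
Qed.

Lemma esphere_delta i : esphere R n (delta_mx 0 i).
Proof. by apply/esphereE; rewrite dot_delta mxE !eqxx. Qed.

Lemma cvg_row (T : Type) (F : set_system T) (FF : Filter F)
    (f : T -> 'rV[R]_n) y :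
  (forall j, f t 0 j @[t --> F] --> y 0 j) -> f @ F --> y.
Proof.
move=> h; apply/cvgrPdist_lt => d d0.
have hj j : \forall t \near F, `|y 0 j - f t 0 j| < d.
  exact: (@cvgr_dist_lt _ _ _ _ _ _ _ (h j)).
have : \forall t \near F, forall j, `|y 0 j - f t 0 j| < d.
  exact: filter_forall.
apply: filterS => t ht; rewrite [ltLHS]/Num.Def.normr /= mx_normrE.
apply/bigmax_ltP; split => // -[i j] _ /=.
by rewrite (ord1 i) !mxE; exact: ht.
Qed.

Lemma cvg_dot (T : Type) (F : set_system T) (FF : Filter F)
    (f g : T -> 'rV[R]_n) x y :
  f @ F --> x -> g @ F --> y -> dot (f t) (g t) @[t --> F] --> dot x y.
Proof.
move=> fx gy; apply: cvg_big => [|i _]; first exact: add_continuous.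
by apply: cvgM; apply: (@continuous_cvg _ _ _ _ _ _ (fun v : 'rV[R]_n => v 0 i));
  [exact: coord_continuous| |exact: coord_continuous|].
Qed.

Lemma cvg_enorm (T : Type) (F : set_system T) (FF : Filter F)
    (f : T -> 'rV[R]_n) x :
  f @ F --> x -> enorm (f t) @[t --> F] --> enorm x.
Proof.
move=> fx; rewrite enormE; under eq_fun do rewrite enormE.
by apply: continuous_cvg; [exact: sqrt_continuous|exact: cvg_dot].
Qed.

Lemma enorm_continuous : continuous (@enorm R n).
Proof. by move=> x; apply: (@cvg_enorm _ (nbhs x) _ idfun x); exact: cvg_id. Qed.

Lemma norm_le_enorm x : `|x| <= enorm x.
Proof.
rewrite [leLHS]/Num.Def.normr /= mx_normrE; apply/bigmax_leP; split => [|i _].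
  exact: enorm_ge0.
by rewrite (ord1 i.1) coord_le_enorm.
Qed.

Lemma open_eball : open (eball R n).
Proof.
apply: (@open_comp _ _ (@enorm R n) [set r | r < 1]); last exact: open_lt.
by move=> x _; exact: enorm_continuous.
Qed.

Lemma near_eball x : eball R n x -> \forall y \near x, eball R n y.
Proof. by move=> x1; apply: (open_nbhs_nbhs (conj open_eball x1)). Qed.

Lemma compact_eclosed_ball (r : R) : compact [set x : 'rV[R]_n | enorm x <= r].
Proof.
apply: bounded_closed_compact.
  exists r; split; first exact: num_real.
  by move=> M rM x /= xr; apply: le_trans (norm_le_enorm x) (le_trans xr (ltW rM)).
apply: (@closed_comp _ _ (@enorm R n) [set s | s <= r]); last exact: closed_le.
by move=> x _; exact: enorm_continuous.
Qed.

Lemma compact_esphere : compact (esphere R n).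
Proof.
apply: bounded_closed_compact.
  exists 1; split; first exact: num_real.
  by move=> M rM x /= xr; apply: le_trans (norm_le_enorm x) _; rewrite xr ltW.
apply: (@closed_comp _ _ (@enorm R n) [set s | s = 1]); last exact: closed_eq.
by move=> x _; exact: enorm_continuous.
Qed.

End Dot.

(** * Positive normalised functionals on continuous functions of the sphere *)

Lemma cvg_section (T U : topologicalType) (x : T) (y : U) :
  (x, y') @[y' --> y] --> (x, y).
Proof.
move=> P [[A B] /= [nA nB] AB]; apply: filterS nB => y' By'.
by apply: AB; split => //=; exact: nbhs_singleton.
Qed.

Section SphericalMean.
Variables (R : realType) (n : nat).

(** Continuity in the ambient space at each point of the sphere, which can be
    checked by the pointwise rules without the subspace topology. *)
Definition csphere (f : 'rV[R]_n -> R) : Prop :=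
  forall e, esphere R n e -> {for e, continuous f}.

Record spherical_mean (L : ('rV[R]_n -> R) -> R) : Prop := {
  mean_linear : forall a f g, csphere f -> csphere g ->
    L (fun e => a * f e + g e) = a * L f + L g ;
  mean_le : forall f g, csphere f -> csphere g ->
    (forall e, esphere R n e -> f e <= g e) -> L f <= L g ;
  mean1 : L (fun=> 1) = 1 }.

Lemma csphere_cst c : csphere (fun=> c).
Proof. by move=> e _; exact: cst_continuous. Qed.

Arguments csphere_cst c : clear implicits.

Lemma csphereD f g : csphere f -> csphere g -> csphere (fun e => f e + g e).
Proof. by move=> cf cg e He; apply: (cvgD (cf e He) (cg e He)). Qed.

Lemma csphereM f g : csphere f -> csphere g -> csphere (fun e => f e * g e).
Proof. by move=> cf cg e He; apply: (cvgM (cf e He) (cg e He)). Qed.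

Lemma csphereZ c f : csphere f -> csphere (fun e => c * f e).
Proof. by move=> cf; apply: csphereM => //; exact: csphere_cst. Qed.

Lemma csphereB f g : csphere f -> csphere g -> csphere (fun e => f e - g e).
Proof. by move=> cf cg e He; apply: (cvgB (cf e He) (cg e He)). Qed.

Lemma csphere_dot xi : csphere (fun e => dot e xi).
Proof.
move=> e _; have FF : Filter (nbhs e) by exact: nbhs_filter.
by apply: (@cvg_dot _ _ _ (nbhs e) _ idfun (cst xi)); [exact: cvg_id|exact: cvg_cst].
Qed.

Variable L : ('rV[R]_n -> R) -> R.
Hypothesis LP : spherical_mean L.

Lemma mean_eq f g : csphere f -> csphere g ->
  (forall e, esphere R n e -> f e = g e) -> L f = L g.
Proof.
move=> cf cg fg; apply/eqP; rewrite eq_le; apply/andP.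
by split; apply: (mean_le LP) => // e He; rewrite fg.
Qed.

Lemma meanZ c f : csphere f -> L (fun e => c * f e) = c * L f.
Proof.
move=> cf; have L0 : L (fun=> 0) = 0.
  have := mean_linear LP (- 1) (csphere_cst 0) (csphere_cst 0).
  by under eq_fun do rewrite mulr0 addr0; lra.
rewrite -[RHS]addr0 -L0 -(mean_linear LP)//; last exact: csphere_cst.
by under [in RHS]eq_fun do rewrite addr0.
Qed.

Lemma meanD f g : csphere f -> csphere g -> L (fun e => f e + g e) = L f + L g.
Proof.
move=> cf cg; have := mean_linear LP 1 cf cg.
by under eq_fun do rewrite mul1r; rewrite mul1r.
Qed.

Lemma meanB f g : csphere f -> csphere g -> L (fun e => f e - g e) = L f - L g.
Proof.
move=> cf cg; have := mean_linear LP (- 1) cg cf.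
by under eq_fun do rewrite mulN1r addrC; move=> ->; lra.
Qed.

Lemma mean_cst c : L (fun=> c) = c.
Proof.
have := meanZ c (csphere_cst 1).
by under eq_fun do rewrite mulr1; rewrite (mean1 LP) mulr1.
Qed.

Lemma mean_sum m (f : 'I_m -> 'rV[R]_n -> R) : (forall i, csphere (f i)) ->
  L (fun e => \sum_i f i e) = \sum_i L (f i).
Proof.
elim: m f => [|m IH] f cf.
  by under eq_fun do rewrite big_ord0; rewrite big_ord0 mean_cst.
under eq_fun do rewrite big_ord_recl.
rewrite big_ord_recl meanD; [by rewrite IH|exact: cf|].
move=> e He; have FF : Filter (nbhs e) by exact: nbhs_filter.
apply: (@cvg_big _ _ _ _ _ _ _ (nbhs e)) => [|i _]; first exact: add_continuous.
exact: (cf _ e He).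
Qed.

Lemma mean_dist f g d : csphere f -> csphere g ->
  (forall e, esphere R n e -> `|f e - g e| <= d) -> `|L f - L g| <= d.
Proof.
move=> cf cg fg; rewrite -meanB// ler_norml.
have cfg := csphereB cf cg; have cd := csphere_cst.
have {}fg e : esphere R n e -> - d <= f e - g e <= d.
  by move=> /fg; rewrite ler_norml.
rewrite -{1}(mean_cst (- d)) -[X in _ && (_ <= X)](mean_cst d).
by apply/andP; split; apply: (mean_le LP) => // e /fg /andP[].
Qed.

(** Joint continuity at all points above [x] and compactness of the sphere. *)
Lemma sphere_uniform (T : topologicalType) (x : T) (K : T -> 'rV[R]_n -> R) :
  (forall e, esphere R n e -> {for (x, e), continuous (fun p => K p.1 p.2)}) ->
  forall d, 0 < d -> \forall y \near x, forall e, esphere R n e ->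
    `|K y e - K x e| < d.
Proof.
move=> cK d d0.
have /compact_near_coveringP := @compact_esphere R n.
move=> /(_ T (nbhs x) (fun y e => `|K y e - K x e| < d) _); apply => e He.
have d2 : 0 < d / 2 by rewrite divr_gt0.
have h1 : \forall p \near (x, e), `|K x e - K p.1 p.2| < d / 2.
  exact: (@cvgr_dist_lt _ _ _ _ _ _ _ (cK e He)).
have h2 : \forall e' \near e, `|K x e - K x e'| < d / 2.
  have c2 : (x, e') @[e' --> e] --> (x, e).
    exact: cvg_section.
  exact: c2 h1.
have [[A B] /= [nA nB] AB] := h1.
exists (B `&` [set e' | `|K x e - K x e'| < d / 2], A) => /=.
  by split => //; apply: filterI.
move=> [e' y] /= [[Be' h2e'] Ay]; have := AB (y, e') (conj Ay Be') => /= h1y.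
have -> : K y e' - K x e' = (K x e - K x e') - (K x e - K y e') by ring.
by apply: le_lt_trans (ler_normB _ _) _; rewrite (splitr d) ltrD.
Qed.

Lemma csphere_joint (T : topologicalType) (x : T) (K : T -> 'rV[R]_n -> R) :
  (forall e, esphere R n e -> {for (x, e), continuous (fun p => K p.1 p.2)}) ->
  csphere (K x).
Proof.
move=> cK e He.
have c2 : (x, e') @[e' --> e] --> (x, e).
  exact: cvg_section.
exact: (cvg_comp _ _ c2 (cK e He)).
Qed.

Lemma mean_cvg (T : topologicalType) (x : T) (K : T -> 'rV[R]_n -> R) :
  (forall e, esphere R n e -> {for (x, e), continuous (fun p => K p.1 p.2)}) ->
  (\forall y \near x, csphere (K y)) ->
  {for x, continuous (fun y => L (K y))}.
Proof.
move=> cK cs; apply/cvgrPdist_le => d d0.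
have := sphere_uniform cK d0.
apply: filter_app2 cs; near=> y => csy h; rewrite distrC.
apply: mean_dist => // [|e He]; first exact: csphere_joint.
exact/ltW/h.
Unshelve. all: by end_near. Qed.

(** Differentiation under the mean: the mean value theorem and the uniform
    continuity of the derivative in the parameter make the difference
    quotients converge uniformly on the sphere. *)
Lemma mean_derive (K K' : R -> 'rV[R]_n -> R) (t : R) :
  (\forall s \near t, forall e, esphere R n e ->
     is_derive s (1 : R) (K^~ e) (K' s e)) ->
  (forall e, esphere R n e -> {for (t, e), continuous (fun p => K' p.1 p.2)}) ->
  (\forall s \near t, csphere (K s)) ->
  is_derive t (1 : R) (fun s => L (K s)) (L (K' t)).
Proof.
move=> dK cK' cK.
have cK't := csphere_joint cK'.
have cKt : csphere (K t) := nbhs_singleton cK.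
suff h : h^-1 *: (L (K (h + t)) - L (K t)) @[h --> 0^'] --> L (K' t).
  have h' : h^-1 *: (((fun s => L (K s)) \o shift t) (h *: 1) - L (K t))
      @[h --> 0^'] --> L (K' t).
    by under eq_fun do rewrite /= [X in X + t]mulr1.
  by apply: DeriveDef; [apply/cvg_ex; exists (L (K' t))|exact/cvg_lim].
apply/cvgrPdist_le => d d0.
have u := sphere_uniform cK' d0.
have [r /= r0 hr] : \forall s \near t, [/\ (forall e, esphere R n e ->
     is_derive s (1 : R) (K^~ e) (K' s e)), csphere (K s) &
     forall e, esphere R n e -> `|K' s e - K' t e| < d].
  by near=> s; split; near: s.
near=> h.
have hn0 : h != 0 by near: h; exact: nbhs_dnbhs_neq.
have hlt : `|h| < r.
  near: h; apply: nbhs_dnbhs; apply/nbhs_ballP; exists r => //= z.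
  by rewrite /ball /= sub0r normrN.
have hb s : `|t - s| <= `|h| -> ball t r s.
  by move=> ts; rewrite /ball /=; apply: le_lt_trans hlt.
have [_ cKh _] : [/\ (forall e, esphere R n e ->
     is_derive (h + t) (1 : R) (K^~ e) (K' (h + t) e)), csphere (K (h + t)) &
     forall e, esphere R n e -> `|K' (h + t) e - K' t e| < d].
  by apply: hr; apply: hb; rewrite opprD addrCA subrr addr0 normrN.
have -> : h^-1 *: (L (K (h + t)) - L (K t)) =
    L (fun e => h^-1 * (K (h + t) e - K t e)).
  by rewrite meanZ ?meanB//; exact: csphereB.
apply: mean_dist => // [|e He].
  by apply: csphereZ; exact: csphereB.
have der s : `|t - s| <= `|h| -> is_derive s (1 : R) (K^~ e) (K' s e).
  by move=> /hb /hr [+ _ _]; apply.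
have cont a b : (forall s, s \in `[a, b] -> `|t - s| <= `|h|) ->
    {within `[a, b], continuous (K^~ e)}.
  move=> H; apply: derivable_within_continuous => s /H /der ds.
  by have [] := ds.
have [h0|h0] : h < 0 \/ 0 < h by case: (ltgtP h 0) hn0 => //; [left|right].
- have H s : s \in `[h + t, t] -> `|t - s| <= `|h|.
    rewrite in_itv/= => /andP[s1 s2]; rewrite (ltr0_norm h0) ger0_norm; lra.
  have [|s||c] := @MVT _ (K^~ e) (K'^~ e) (h + t) t.
  + by rewrite gtrDr.
  + by move=> sI; apply: der; apply: H; exact: subset_itv_oo_cc.
  + exact: cont.
  rewrite (_ : t - (h + t) = - h); last by ring.
  move=> /subset_itv_oo_cc /H /hb /hr [_ _ /(_ e He) lt] E.
  rewrite (_ : K (h + t) e - K t e = h * K' c e) ?mulKf//; last lra.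
  by rewrite distrC ltW.
- have H s : s \in `[t, h + t] -> `|t - s| <= `|h|.
    rewrite in_itv/= => /andP[s1 s2]; rewrite (gtr0_norm h0) ler0_norm; lra.
  have [|s||c] := @MVT _ (K^~ e) (K'^~ e) t (h + t).
  + by rewrite ltrDr.
  + by move=> sI; apply: der; apply: H; exact: subset_itv_oo_cc.
  + exact: cont.
  rewrite (_ : h + t - t = h); last by ring.
  move=> /subset_itv_oo_cc /H /hb /hr [_ _ /(_ e He) lt] E.
  rewrite E mulrC mulfK//.
  by rewrite distrC ltW.
Unshelve. all: by end_near. Qed.

End SphericalMean.

(** * One-dimensional integrals of continuous functions *)

Notation intg a b f := (\int[lebesgue_measure]_(t in `[a, b]) f t).

Section Integral.
Variable R : realType.
Implicit Types (f g : R -> R) (a b c : R).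
Let mu := @lebesgue_measure R.

Lemma within_continuous a b f : (forall t, t \in `[a, b] -> {for t, continuous f}) ->
  {within `[a, b], continuous f}.
Proof.
by move=> cf; apply: continuous_in_subspaceT => t; rewrite inE; exact: cf.
Qed.

Lemma integrable_continuous a b f : {within `[a, b], continuous f} ->
  mu.-integrable `[a, b] (EFin \o f).
Proof. by move=> cf; apply: continuous_compact_integrable => //; exact: segment_compact. Qed.

Lemma intgD a b f g : {within `[a, b], continuous f} ->
  {within `[a, b], continuous g} ->
  intg a b (fun t => f t + g t) = intg a b f + intg a b g.
Proof. by move=> cf cg; rewrite RintegralD//; exact: integrable_continuous. Qed.

Lemma intgZ a b c f : {within `[a, b], continuous f} ->
  intg a b (fun t => c * f t) = c * intg a b f.
Proof. by move=> cf; rewrite RintegralZl//; exact: integrable_continuous. Qed.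

Lemma intg_le a b f g : {within `[a, b], continuous f} ->
  {within `[a, b], continuous g} -> (forall t, a <= t <= b -> f t <= g t) ->
  intg a b f <= intg a b g.
Proof.
move=> cf cg fg; apply: le_Rintegral => //; exact: integrable_continuous.
Qed.

Lemma eq_intg a b f g : (forall t, a <= t <= b -> f t = g t) ->
  intg a b f = intg a b g.
Proof. by move=> fg; apply: eq_Rintegral => t; rewrite inE/= in_itv/=; exact: fg. Qed.

Lemma intg_FTC a b f F : a < b ->
  (forall t, a <= t <= b -> has_der t (1 : R) F (f t)) ->
  {within `[a, b], continuous f} ->
  intg a b f = F b - F a.
Proof.
move=> ab dF cf.
have cF t : t \in `[a, b] -> {for t, continuous F}.
  rewrite in_itv/= => /dF [/derivable1_diffP dFt _].
  exact: differentiable_continuous.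
rewrite /Rintegral (@continuous_FTC2 R f F)//.
- split.
  + by move=> t /subset_itv_oo_cc; rewrite in_itv/= => /dF[].
  + by apply: cvg_at_right_filter; apply: cF; rewrite in_itv/= lexx ltW.
  + by apply: cvg_at_left_filter; apply: cF; rewrite in_itv/= lexx ltW.
- move=> t /subset_itv_oo_cc; rewrite in_itv/= => /dF dFt.
  have {}dFt : is_derive t (1 : R) F (f t) by [].
  by rewrite derive1E derive_val.
Qed.

Lemma intg_split a b c f : a <= c -> c <= b -> {within `[a, b], continuous f} ->
  intg a b f = intg a c f + intg c b f.
Proof.
move=> ac cb cf; have int := integrable_continuous cf.
have /= E := @Rintegral_itvB R f (BLeft a) (BRight b) c int.
rewrite -(subrKC (intg a c f) (intg a b f)) E//= ?bnd_simp//.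
congr (_ + _); apply: Rintegral_itv_obnd_cbnd.
apply: integrableS int => //; apply: subset_itv; rewrite bnd_simp//.
Qed.

Lemma intg_reflect a b c f : a < b -> continuous f ->
  intg (c - b) (c - a) f = intg a b (fun t => f (c - t)).
Proof.
move=> ab cf; have D (x : R) : is_derive x (1 : R) (fun t => c - t) (- 1).
  by der; rewrite /=; ring.
have D1 : derive1 (fun t : R => c - t) = cst (- 1).
  by apply/funext => z; rewrite derive1E; have := D z; move=> /@derive_val ->.
rewrite /Rintegral (@integration_by_substitution_decreasing R (fun t => c - t) f)//.
- congr fine; apply: eq_integral => /= x _; congr (EFin _).
  rewrite D1; change (f (c - x) * - (- 1) = f (c - x)); by rewrite opprK mulr1.
- exact: ltW.
- by move=> x y _ _ xy; rewrite ltrD2l ltrN2.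
- by rewrite D1 => ? _; apply: cvg_cst.
- by rewrite D1; exact: is_cvg_cst.
- by rewrite D1; exact: is_cvg_cst.
- split => [x _||].
  + by have := D x; move=> /@ex_derive.
  + by apply: cvg_at_right_filter; apply: contD; cont.
  + by apply: cvg_at_left_filter; apply: contD; cont.
- exact: continuous_subspaceT.
Qed.

End Integral.

(** * Wallis integrals *)

Section Wallis.
Variable R : realType.

Definition wallis (k : nat) : R := intg 0 pi (fun t => sin t ^+ k).

Lemma continuous_sinX k : continuous (fun t : R => sin t ^+ k).
Proof.
move=> t; apply: (@continuous_comp _ _ _ sin (fun x => x ^+ k)).
  exact: continuous_sin.
exact: exprn_continuous.
Qed.

Lemma wallis0 : wallis 0 = pi.
Proof.
rewrite /wallis (intg_FTC (F := id)) ?pi_gt0 ?subr0//.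
- by move=> t ?; rewrite expr0; exact: has_der_id.
- by apply: within_continuous => t _; exact: continuous_sinX.
Qed.

Lemma wallis1 : wallis 1 = 2.
Proof.
rewrite /wallis (intg_FTC (F := fun t => - cos t)) ?pi_gt0//.
- by rewrite cospi cos0; lra.
- by move=> t ?; der; rewrite opprK expr1.
- by apply: within_continuous => t _; exact: continuous_sinX.
Qed.

Lemma wallisSS k : k.+2%:R * wallis k.+2 = k.+1%:R * wallis k.
Proof.
have cX j : {within `[0, pi], continuous (fun t : R => sin t ^+ j)}.
  by apply: within_continuous => t _; exact: continuous_sinX.
have cW c j : {within `[0, pi], continuous (fun t : R => c * sin t ^+ j)}.
  apply: within_continuous => t _; apply: continuousM; first exact: cst_continuous.
  exact: continuous_sinX.
apply/eqP; rewrite -subr_eq0 -mulNr -!intgZ// -intgD//; apply/eqP.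
rewrite (intg_FTC (F := fun t => - cos t * sin t ^+ k.+1)) ?pi_gt0//.
- by rewrite sinpi sin0 !expr0n/= !mulr0 subrr.
- move=> t ?; der; rewrite /= opprK !exprS.
  have h : cos t * cos t = 1 - sin t * sin t by rewrite -!expr2 cos2sin2.
  have -> : - cos t * (k.+1%:R * sin t ^+ k * cos t) = - k.+1%:R * sin t ^+ k * (cos t * cos t) by ring.
  have -> : k.+2%:R = k.+1%:R + 1 :> R by rewrite natr1.
  by rewrite h; ring.
- by apply: within_continuous => t _; apply: continuousD; apply: continuousM;
   solve [exact: cst_continuous|exact: continuous_sinX].
Qed.

Lemma wallis_gt0 k : 0 < wallis k.
Proof.
elim/ltn_ind: k => -[|[|k]] IH; first by rewrite wallis0 pi_gt0.
  by rewrite wallis1.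
by rewrite -(pmulr_rgt0 _ (ltr0Sn R k.+1)) wallisSS mulr_gt0// IH// ltnW.
Qed.

End Wallis.

(** * Existence of the mean over the sphere *)

Section Recursion.
Variables (R : realType) (k : nat).

(** Polar coordinates: the pole is the first basis vector. *)
Definition polar (t : R) (e : 'rV[R]_k.+1) : 'rV[R]_k.+2 :=
  \row_i oapp (fun j => sin t * e 0 j) (cos t) (unlift ord0 i).

Definition tail (x : 'rV[R]_k.+2) : 'rV[R]_k.+1 := \row_j x 0 (lift ord0 j).

Lemma dot_tail (x y : 'rV[R]_k.+2) :
  dot x y = x 0 ord0 * y 0 ord0 + dot (tail x) (tail y).
Proof.
by rewrite /dot big_ord_recl; congr (_ + _); apply: eq_bigr => j _; rewrite !mxE.
Qed.

Lemma polar0 t e : polar t e 0 ord0 = cos t.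
Proof. by rewrite mxE unlift_none. Qed.

Lemma tail_polar t e : tail (polar t e) = sin t *: e.
Proof. by apply/rowP => j; rewrite !mxE liftK. Qed.

Lemma dot_polar t e x :
  dot (polar t e) x = x 0 ord0 * cos t + sin t * dot e (tail x).
Proof. by rewrite dot_tail polar0 tail_polar dotZl mulrC. Qed.

Lemma esphere_polar t e : esphere R _ e -> esphere R _ (polar t e).
Proof.
move=> /esphereE ee; apply/esphereE.
by rewrite dot_tail polar0 tail_polar dotZl dotZr ee mulr1 -!expr2 cos2Dsin2.
Qed.

Lemma polar_continuous : continuous (fun p : R * 'rV[R]_k.+1 => polar p.1 p.2).
Proof.
move=> [t e]; have FF : Filter (nbhs (t, e)) by exact: nbhs_filter.
apply: (@cvg_row _ _ _ (nbhs (t, e))) => i; rewrite mxE.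
under eq_fun do rewrite mxE.
have c1 : p.1 @[p --> (t, e)] --> t by exact: cvg_fst.
have c2 : p.2 @[p --> (t, e)] --> e by exact: cvg_snd.
case: (unliftP ord0 i) => [j|] _ /=.
  apply: (@cvgM _ _ (nbhs (t, e))).
    by apply: (@continuous_cvg _ _ _ (nbhs (t, e))) c1; exact: continuous_sin.
  apply: (@continuous_cvg _ _ _ (nbhs (t, e)) _ _ (fun v : 'rV[R]_k.+1 => v 0 j)) c2.
  exact: coord_continuous.
by apply: (@continuous_cvg _ _ _ (nbhs (t, e))) c1; exact: continuous_cos.
Qed.

Lemma polar_cvg (f : 'rV[R]_k.+2 -> R) t e : csphere f -> esphere R _ e ->
  {for (t, e), continuous (fun p => f (polar p.1 p.2))}.
Proof.
move=> cf He; apply: (@continuous_cvg _ _ _ (nbhs (t, e)) _ _ f).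
  by apply: cf; exact: esphere_polar.
exact: polar_continuous.
Qed.

Variable L : ('rV[R]_k.+1 -> R) -> R.
Hypothesis LP : spherical_mean L.

(** Fubini in polar coordinates: the slice at the angle [t] is a sphere of
    dimension [k] and radius [sin t]. *)
Definition suspended_mean (f : 'rV[R]_k.+2 -> R) : R :=
  (wallis R k)^-1 * intg 0 pi (fun t => sin t ^+ k * L (fun e => f (polar t e))).

Lemma continuous_slice f : csphere f -> continuous (fun t => L (fun e => f (polar t e))).
Proof.
move=> cf t.
apply: (@mean_cvg _ _ _ LP _ t (fun t e => f (polar t e))) => [e He|].
  exact: polar_cvg.
by near=> s; move=> e He; apply: (@csphere_joint _ _ _ s (fun s e => f (polar s e))) =>
  // {}e {}He; exact: polar_cvg.
Unshelve. all: by end_near. Qed.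

Lemma suspended_meanP : spherical_mean suspended_mean.
Proof.
have cS f : csphere f -> {within `[0, pi], continuous (fun t => sin t ^+ k * L (fun e => f (polar t e)))}.
  move=> cf; apply: within_continuous => t _; apply: continuousM.
    exact: continuous_sinX.
  exact: continuous_slice.
have csl f t : csphere f -> csphere (fun e => f (polar t e)).
  move=> cf e He.
  by apply: (@csphere_joint _ _ _ t (fun t e => f (polar t e))) => // {}e {}He; exact: polar_cvg.
split=> [a f g cf cg|f g cf cg fg|].
- rewrite /suspended_mean mulrCA -mulrDr; congr (_ * _).
  rewrite -(intgZ a (cS f cf)) -(intgD _ (cS g cg)); last first.
    apply: within_continuous => t _; apply: continuousM; first exact: cst_continuous.
    apply: continuousM; first exact: continuous_sinX.
    exact: continuous_slice.
  by apply: eq_intg => t _; rewrite (mean_linear LP a (csl f t cf) (csl g t cg)); ring.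
- apply: ler_wpM2l; first by rewrite invr_ge0 ltW// wallis_gt0.
  apply: intg_le; [exact: cS|exact: cS|] => t /andP[t0 tpi].
  apply: ler_wpM2l; first by rewrite exprn_ge0// sin_ge0_pi// t0.
  apply: (mean_le LP (csl f t cf) (csl g t cg)) => e He.
  by apply: fg; exact: esphere_polar.
- rewrite /suspended_mean (mean1 LP); under eq_Rintegral do rewrite mulr1.
  by rewrite mulVf// gt_eqF// wallis_gt0.
Qed.

End Recursion.

Section Divergence.
Variable R : realType.

(** The divergence theorem on the sphere for the fields [p(x) grad x], where
    [x] is the restriction of a linear form: [|grad x|^2] is [|xi|^2 - x^2]
    and [x] is an eigenfunction of the spherical Laplacian. *)
Record divergence_free n (L : ('rV[R]_n.+1 -> R) -> R) : Prop := {
  mean_dot : forall xi, L (fun e => dot e xi) = 0 ;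
  mean_div : forall (p p' : R -> R) xi,
    (forall t, `|t| <= enorm xi -> is_derive t (1 : R) p (p' t)) ->
    (forall t, `|t| <= enorm xi -> {for t, continuous p'}) ->
    n%:R * L (fun e => dot e xi * p (dot e xi)) =
    L (fun e => (dot xi xi - dot e xi ^+ 2) * p' (dot e xi)) }.

Lemma dot_sphere_le n (e xi : 'rV[R]_n) : esphere R n e -> `|dot e xi| <= enorm xi.
Proof. by move=> He; apply: le_trans (dot_le _ _) _; rewrite He mul1r. Qed.

Variables (k : nat) (L : ('rV[R]_k.+1 -> R) -> R).
Hypotheses (LP : spherical_mean L) (LD : divergence_free L).
Variables (p p' : R -> R) (xi : 'rV[R]_k.+2).
Hypothesis dp : forall t, `|t| <= enorm xi -> is_derive t (1 : R) p (p' t).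
Hypothesis cp' : forall t, `|t| <= enorm xi -> {for t, continuous p'}.

Let a := xi 0 ord0.
Let y (e : 'rV[R]_k.+1) := dot e (tail xi).
Let x t e := a * cos t + sin t * y e.
Let dx t e := cos t * y e - a * sin t.
Let b2 := dot (tail xi) (tail xi).

Let x_polar t e : x t e = dot (polar t e) xi.
Proof. by rewrite dot_polar. Qed.

Let x_le t e : esphere R _ e -> `|x t e| <= enorm xi.
Proof. by move=> He; rewrite x_polar; apply: dot_sphere_le; exact: esphere_polar. Qed.

Let cont_fst (t : R) (e : 'rV[R]_k.+1) : {for (t, e), continuous (fun q => q.1)}.
Proof. exact: cvg_fst. Qed.

Let cont_y (t : R) (e : 'rV[R]_k.+1) : {for (t, e), continuous (fun q => y q.2)}.
Proof.
have FF : Filter (nbhs (t, e)) by exact: nbhs_filter.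
apply: (@cvg_dot _ _ _ (nbhs (t, e)) _ snd (cst (tail xi))); last exact: cvg_cst.
exact: cvg_snd.
Qed.

Let cont_x (t : R) (e : 'rV[R]_k.+1) : {for (t, e), continuous (fun q => x q.1 q.2)}.
Proof. by have := @cont_fst t e; have := @cont_y t e; rewrite /x => *; cont. Qed.

Let cont_dx (t : R) (e : 'rV[R]_k.+1) : {for (t, e), continuous (fun q => dx q.1 q.2)}.
Proof. by have := @cont_fst t e; have := @cont_y t e; rewrite /dx => *; cont. Qed.

Let cont_p t e : esphere R _ e -> {for (t, e), continuous (fun q => p (x q.1 q.2))}.
Proof.
move=> He; apply: (@cont_comp _ _ _ p (fun q => x q.1 q.2)); last exact: cont_x.
exact/continuous_is_derive/dp/x_le.
Qed.

Let cont_p' t e : esphere R _ e -> {for (t, e), continuous (fun q => p' (x q.1 q.2))}.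
Proof.
move=> He; apply: (@cont_comp _ _ _ p' (fun q => x q.1 q.2)); last exact: cont_x.
exact/cp'/x_le.
Qed.

(** The divergence theorem on the slice [t], for the restriction of the linear
    form. When [k = 0] the slice consists of two points and both sides vanish. *)
Lemma inner_divergence t : 0 <= sin t ->
  sin t ^+ k.-1 * (k%:R * L (fun e => y e * p (x t e))) =
  sin t ^+ k * L (fun e => (b2 - y e ^+ 2) * p' (x t e)).
Proof.
move=> s0.
have cq : csphere (fun e => (b2 - y e ^+ 2) * p' (x t e)).
  apply: (@csphere_joint _ _ _ t (fun t e => (b2 - y e ^+ 2) * p' (x t e))) => e He.
  by have := @cont_y t e; have := @cont_p' t e He => *; cont.
have [k0|k0] := posnP k.
  have one (e xi0 : 'rV[R]_k.+1) : esphere R _ e -> dot e xi0 ^+ 2 = dot xi0 xi0.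
    move=> /esphereE; move: e xi0; rewrite k0 => e xi0.
    by rewrite /dot !big_ord1 exprMn => ee; rewrite !expr2 ee mul1r.
  rewrite (_ : k%:R = 0) ?k0// mul0r mulr0 (mean_eq LP (g := fun=> 0))//.
  - by rewrite (mean_cst LP) mulr0.
  - exact: csphere_cst.
  - by move=> e He; rewrite /y one// subrr mul0r.
have -> : sin t ^+ k = sin t ^+ k.-1 * sin t by rewrite -exprSr prednK.
rewrite -mulrA; congr (_ * _).
rewrite -(meanZ LP (sin t) cq).
pose q u := p (a * cos t + sin t * u); pose q' u := sin t * p' (a * cos t + sin t * u).
have le_q u : `|u| <= enorm (tail xi) -> `|a * cos t + sin t * u| <= enorm xi.
  move=> ub.
  rewrite -(@ler_pXn2r _ 2)// ?nnegrE ?enorm_ge0// enorm_sqr real_normK ?num_real//.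
  rewrite dot_tail -/a.
  have u2 : u ^+ 2 <= dot (tail xi) (tail xi).
    by rewrite -enorm_sqr -(real_normK (num_real u)) ler_pXn2r// ?nnegrE ?enorm_ge0.
  have c2 := cos2Dsin2 t.
  have := sqr_ge0 (a * sin t - cos t * u).
  rewrite -subr_ge0 => h; rewrite -subr_ge0.
  have -> : a * a + dot (tail xi) (tail xi) - (a * cos t + sin t * u) ^+ 2 =
    (dot (tail xi) (tail xi) - u ^+ 2) + (a * sin t - cos t * u) ^+ 2
     + (1 - (cos t ^+ 2 + sin t ^+ 2)) * (a ^+ 2 + u ^+ 2) by ring.
  by rewrite c2; lra.
have -> : (fun e => sin t * ((b2 - y e ^+ 2) * p' (x t e))) =
    (fun e => (dot (tail xi) (tail xi) - dot e (tail xi) ^+ 2) * q' (dot e (tail xi))).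
  by apply/funext => e; rewrite /q' /y /x /b2; ring.
apply: (mean_div LD (p := q)).
- move=> u ub; have h := dp (le_q _ ub); rewrite /q.
  apply: (@derE _ _ _ _ _ (p' (a * cos t + sin t * u) * sin t)); last by rewrite mulrC.
  have hu : is_derive u (1 : R) (fun u => a * cos t + sin t * u) (sin t).
    by der; rewrite /=; ring.
  exact: (has_der_comp (F := p) (f := fun u => a * cos t + sin t * u) h hu).
- move=> u ub; have h := cp' (le_q _ ub); rewrite /q'.
  have h2 : {for u, continuous (fun u => p' (a * cos t + sin t * u))}.
    by apply: (@cont_comp _ _ _ p' (fun u => a * cos t + sin t * u)) => //; cont.
  by cont.
Qed.

Let csphere_slice (F : R -> 'rV[R]_k.+1 -> R) t :
  (forall e, esphere R _ e -> {for (t, e), continuous (fun q => F q.1 q.2)}) ->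
  csphere (F t).
Proof. by move=> cF; apply: (@csphere_joint _ _ _ t F). Qed.

(** [G] is the polar component of the field [p(x) grad x] times the area factor
    of the slice; [G'] is its derivative in [t]. *)
Let G t e := sin t ^+ k * (p (x t e) * dx t e).
Let G' t e := k%:R * sin t ^+ k.-1 * cos t * (p (x t e) * dx t e) +
  sin t ^+ k * (p' (x t e) * dx t e ^+ 2 - p (x t e) * x t e).

(** The derivative of the flux through the slice [t] is the integral of the
    divergence, since the tangential part has been integrated over the slice. *)
Lemma mean_flux t : 0 <= sin t ->
  L (G' t) = sin t ^+ k * L (fun e => (dot xi xi - x t e ^+ 2) * p' (x t e))
             - k.+1%:R * (sin t ^+ k * L (fun e => x t e * p (x t e))).
Proof.
move=> s0.
have jc e He := @cont_p t e He.
have jc' e He := @cont_p' t e He.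
have c1 : csphere (fun e => y e * p (x t e)).
  apply: (@csphere_slice (fun t e => y e * p (x t e)) t) => e He.
  by have := @cont_y t e; have := jc e He => *; cont.
have c2 : csphere (fun e => x t e * p (x t e)).
  apply: (@csphere_slice (fun t e => x t e * p (x t e)) t) => e He.
  by have := @cont_x t e; have := jc e He => *; cont.
have c3 : csphere (fun e => (b2 - y e ^+ 2) * p' (x t e)).
  apply: (@csphere_slice (fun t e => (b2 - y e ^+ 2) * p' (x t e)) t) => e He.
  by have := @cont_y t e; have := jc' e He => *; cont.
have c4 : csphere (fun e => dx t e ^+ 2 * p' (x t e)).
  apply: (@csphere_slice (fun t e => dx t e ^+ 2 * p' (x t e)) t) => e He.
  by have := @cont_dx t e; have := jc' e He => *; cont.
have E1 e : G' t e = (k%:R * sin t ^+ k.-1) * (y e * p (x t e)) +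
    (- (k.+1%:R * sin t ^+ k) * (x t e * p (x t e)) +
     sin t ^+ k * (dx t e ^+ 2 * p' (x t e))).
  have sk : k%:R * sin t ^+ k = k%:R * (sin t ^+ k.-1 * sin t) :> R.
    by case: (k) => [|k']; rewrite ?mul0r//= exprSr.
  have cdx : cos t * dx t e = y e - sin t * x t e.
    have -> : cos t * dx t e = cos t ^+ 2 * y e - a * sin t * cos t by rewrite /dx; ring.
    by rewrite cos2sin2 /x; ring.
  rewrite /G'.
  have -> : k%:R * sin t ^+ k.-1 * cos t * (p (x t e) * dx t e) =
    k%:R * sin t ^+ k.-1 * p (x t e) * (cos t * dx t e) by ring.
  have -> : k.+1%:R = k%:R + 1 :> R by rewrite natr1.
  have -> : k%:R * sin t ^+ k.-1 * p (x t e) * (cos t * dx t e) =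
    k%:R * sin t ^+ k.-1 * (y e * p (x t e)) -
    k%:R * (sin t ^+ k.-1 * sin t) * (p (x t e) * x t e) by rewrite cdx; ring.
  by rewrite -sk; ring.
have E2 : (fun e => (dot xi xi - x t e ^+ 2) * p' (x t e)) =
    fun e => (b2 - y e ^+ 2) * p' (x t e) + dx t e ^+ 2 * p' (x t e).
  apply/funext => e; rewrite -mulrDl; congr (_ * _).
  rewrite dot_tail -/a -/b2 /x /dx.
  have -> : a * a + b2 - (a * cos t + sin t * y e) ^+ 2 =
    b2 - y e ^+ 2 + (cos t * y e - a * sin t) ^+ 2 +
    (1 - (cos t ^+ 2 + sin t ^+ 2)) * (a ^+ 2 + y e ^+ 2) by ring.
  by rewrite cos2Dsin2 subrr mul0r addr0.
rewrite E2 (funext E1) (meanD LP c3 c4).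
rewrite (meanD LP (csphereZ c1) (csphereD (csphereZ c2) (csphereZ c4))).
rewrite (meanD LP (csphereZ c2) (csphereZ c4)) !(meanZ LP)//.
by have := inner_divergence s0; rewrite mulrCA mulrA => ->; ring.
Qed.

Let der_G t e : esphere R _ e -> is_derive t (1 : R) (G^~ e) (G' t e).
Proof.
move=> He; have hp := dp (x_le t He).
have hx : is_derive t (1 : R) (x^~ e) (dx t e).
  by rewrite /x; der; rewrite /= /dx; ring.
have hpx : has_der t (1 : R) (fun t => p (x t e)) (p' (x t e) * dx t e).
  exact: (has_der_comp (f := x^~ e) hp hx).
have hdx : has_der t (1 : R) (dx^~ e) (- x t e).
  by rewrite /dx; der; rewrite /= /x; ring.
by rewrite /G; der; rewrite /= /G'; ring.
Qed.

(** The flux vanishes at both poles, where it is a multiple of the mean of a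
    linear form; so its derivative integrates to 0. *)
Lemma suspended_div :
  k.+1%:R * suspended_mean L (fun e => dot e xi * p (dot e xi)) =
  suspended_mean L (fun e => (dot xi xi - dot e xi ^+ 2) * p' (dot e xi)).
Proof.
have cJ (t : R) (F : R -> 'rV[R]_k.+1 -> R) :
    (forall t e, esphere R _ e -> {for (t, e), continuous (fun q => F q.1 q.2)}) ->
    {for t, continuous (fun t => L (F t))}.
  move=> cF; apply: (mean_cvg LP) => [e He|]; first exact: cF.
  by near=> s; apply: (@csphere_slice F s) => e He; exact: cF.
have cF1 (t : R) e : esphere R _ e ->
    {for (t, e), continuous (fun q => x q.1 q.2 * p (x q.1 q.2))}.
  by move=> He; have := @cont_x t e; have := @cont_p t e He => *; cont.
have cF2 (t : R) e : esphere R _ e -> {for (t, e), continuous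
    (fun q => (dot xi xi - x q.1 q.2 ^+ 2) * p' (x q.1 q.2))}.
  by move=> He; have := @cont_x t e; have := @cont_p' t e He => *; cont.
have cG (t : R) e : esphere R _ e -> {for (t, e), continuous (fun q => G q.1 q.2)}.
  move=> He; have := @cont_fst t e; have := @cont_dx t e; have := @cont_p t e He.
  by rewrite /G => *; cont.
have cG' (t : R) e : esphere R _ e -> {for (t, e), continuous (fun q => G' q.1 q.2)}.
  move=> He; have := @cont_fst t e; have := @cont_dx t e; have := @cont_p t e He.
  by have := @cont_p' t e He; have := @cont_x t e; rewrite /G' => *; cont.
have cS (F : R -> 'rV[R]_k.+1 -> R) :
    (forall t e, esphere R _ e -> {for (t, e), continuous (fun q => F q.1 q.2)}) ->
    {within `[0, pi], continuous (fun t => sin t ^+ k * L (F t))}.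
  move=> cF; apply: within_continuous => t _; have := cJ t F cF => *.
  by apply: contM => //; exact: continuous_sinX.
have flux : intg 0 pi (fun t => L (G' t)) = 0.
  rewrite (intg_FTC (F := fun t => L (G t))) ?pi_gt0//.
  - have -> : L (G pi) = 0.
      rewrite (_ : G pi = fun e => (- (sin pi ^+ k * p (- a))) * y e).
        by rewrite (meanZ LP) ?(mean_dot LD) ?mulr0//; exact: csphere_dot.
      by apply/funext => e; rewrite /G /x /dx sinpi cospi !mul0r addr0 mulr0 subr0 mulrN1; ring.
    have -> : L (G 0) = 0.
      rewrite (_ : G 0 = fun e => (sin 0 ^+ k * p a) * y e).
        by rewrite (meanZ LP) ?(mean_dot LD) ?mulr0//; exact: csphere_dot.
      by apply/funext => e; rewrite /G /x /dx sin0 cos0 !mul0r addr0 mulr0 subr0 mulr1; ring.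
    by rewrite subrr.
  - move=> t _; apply: (mean_derive LP) => [|e He|]; last 2 first.
    + exact: cG'.
    + by near=> s; apply: (@csphere_slice G s) => e He; exact: cG.
    + by near=> s; move=> e He; exact: der_G.
  - by apply: within_continuous => t _; exact: cJ.
rewrite /suspended_mean mulrCA; congr (_ * _).
apply/eqP; rewrite eq_sym -subr_eq0; apply/eqP; rewrite -[RHS]flux.
under [X in X - _]eq_Rintegral do under eq_fun do rewrite -x_polar.
under [X in _ - _ * X]eq_Rintegral do under eq_fun do rewrite -x_polar.
have c1 := cS (fun t e => x t e * p (x t e)) cF1.
have c2 := cS (fun t e => (dot xi xi - x t e ^+ 2) * p' (x t e)) cF2.
rewrite -mulNr -(intgZ _ c1) -(intgD c2); last first.
  apply: within_continuous => t _; have := cJ t (fun t e => x t e * p (x t e)) cF1 => *.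
  apply: contM; first exact: cst_continuous.
  by apply: contM => //; exact: continuous_sinX.
apply: eq_intg => t /andP[t0 tpi].
by rewrite mean_flux ?sin_ge0_pi ?t0//; ring.
Unshelve. all: by end_near. Qed.

End Divergence.

Lemma suspended_divergence (R : realType) k (L : ('rV[R]_k.+1 -> R) -> R) :
  spherical_mean L -> divergence_free L -> divergence_free (suspended_mean L).
Proof.
move=> LP LD; have D p p' xi dp cp' := @suspended_div R k L LP LD p p' xi dp cp'.
split => // xi; have SP := suspended_meanP LP.
have := D (fun=> 1) (fun=> 0) xi (fun t _ => @has_der_cst _ _ t 1 1) (fun t _ => @cst_continuous _ _ 0 t).
under [in X in _ = X -> _]eq_fun do rewrite mulr0.
under [in X in X = _ -> _]eq_fun do rewrite mulr1.
by rewrite (mean_cst SP) => /eqP; rewrite mulf_eq0 pnatr_eq0 => /eqP.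
Qed.

(** On the 0-sphere the mean is the average over the two points. *)
Lemma mean_S0 (R : realType) : exists L : ('rV[R]_1 -> R) -> R,
  spherical_mean L /\ divergence_free L.
Proof.
have one c : c ^+ 2 = 1 -> esphere R 1 (const_mx c).
  by move=> c1; apply/esphereE; rewrite /dot big_ord1 mxE -expr2.
have S1 : esphere R 1 (const_mx 1) by apply: one; rewrite expr1n.
have S2 : esphere R 1 (const_mx (- 1)) by apply: one; rewrite sqrrN expr1n.
exists (fun f => (f (const_mx 1) + f (const_mx (- 1))) / 2); split; split.
- by move=> a f g _ _; field.
- by move=> f g _ _ fg; rewrite ler_pM2r ?invr_gt0// lerD// fg.
- by field.
- by move=> xi; rewrite /dot !big_ord1 !mxE; field.
- move=> p p' xi _ _; by rewrite mul0r /dot !big_ord1 !mxE; field.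
Qed.

Lemma exists_spherical_mean (R : realType) k :
  exists L : ('rV[R]_k.+1 -> R) -> R, spherical_mean L /\ divergence_free L.
Proof.
elim: k => [|k [L [LP LD]]]; first exact: mean_S0.
exists (suspended_mean L).
by split; [exact: suspended_meanP|exact: suspended_divergence].
Qed.

(** * Rotating the pole *)

Section Householder.
Variables (R : realType) (n : nat) (v : 'rV[R]_n).
Implicit Types x y : 'rV[R]_n.

Definition reflect x : 'rV[R]_n := x - (2 * dot x v / dot v v) *: v.

Lemma dot_reflect x y : dot (reflect x) y = dot x (reflect y).
Proof. by rewrite dotBl dotBr dotZl dotZr (dotC v y); ring. Qed.

Lemma reflectK : involutive reflect.
Proof.
move=> x; rewrite /reflect dotBl dotZl.
have [->|v0] := eqVneq v 0; first by rewrite !scaler0 !subr0.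
have vv : dot v v != 0 by rewrite dotxx_eq0.
rewrite -addrA -opprD -scalerDl.
have -> : 2 * dot x v / dot v v +
   2 * (dot x v - 2 * dot x v / dot v v * dot v v) / dot v v = 0 by field.
by rewrite scale0r subr0.
Qed.

Lemma dot_reflect2 x : dot (reflect x) (reflect x) = dot x x.
Proof. by rewrite dot_reflect reflectK. Qed.

Lemma enorm_reflect x : enorm (reflect x) = enorm x.
Proof. by rewrite !enormE dot_reflect2. Qed.

Lemma continuous_reflect : continuous reflect.
Proof.
move=> x; have FF : Filter (nbhs x) by exact: nbhs_filter.
apply: (@cvg_row _ _ _ (nbhs x)) => j.
have cd : {for x, continuous (fun y => dot y v)}.
  by apply: (@cvg_dot _ _ _ (nbhs x) _ idfun (cst v)); [exact: cvg_id|exact: cvg_cst].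
have cj : {for x, continuous (fun y : 'rV[R]_n => y 0 j)} by exact: coord_continuous.
have : {for x, continuous (fun y => y 0 j - 2 * dot y v / dot v v * v 0 j)} by cont.
rewrite /prop_for /continuous_at /reflect !mxE; apply: cvg_trans.
by apply: near_eq_cvg; near=> y; rewrite !mxE.
Unshelve. all: by end_near. Qed.

End Householder.

Lemma reflect_swap (R : realType) n (x y : 'rV[R]_n) : dot x x = dot y y ->
  reflect (x - y) y = x.
Proof.
move=> xy; rewrite /reflect.
have [xy0|d0] := eqVneq (x - y) 0.
  by rewrite xy0 scaler0 subr0; apply/esym/eqP; rewrite -subr_eq0 xy0.
rewrite -dotxx_eq0 in d0.
have -> : 2 * dot y (x - y) / dot (x - y) (x - y) = - 1.
  apply: (canLR (mulfK d0)).
  by rewrite dotBl !dotBr xy (dotC x y); ring.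
by rewrite scaleN1r opprK addrC subrK.
Qed.

Section AxialMean.
Variables (R : realType) (n : nat) (v : 'rV[R]_n.+1).
Variable L : ('rV[R]_n.+1 -> R) -> R.
Hypotheses (LP : spherical_mean L) (LD : divergence_free L).

(** Conjugation by the reflection that exchanges two unit vectors makes any
    point of the sphere the pole. *)
Definition reflected_mean (f : 'rV[R]_n.+1 -> R) : R := L (fun e => f (reflect v e)).

Let Sr e : esphere R _ e -> esphere R _ (reflect v e).
Proof. by rewrite /esphere /= enorm_reflect. Qed.

Let cr f : csphere f -> csphere (fun e => f (reflect v e)).
Proof.
move=> cf e He; apply: (@continuous_comp _ _ _ (reflect v) f).
  exact: continuous_reflect.
exact/cf/Sr.
Qed.

Lemma reflected_meanP : spherical_mean reflected_mean.
Proof.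
split=> [a f g cf cg|f g cf cg fg|]; rewrite /reflected_mean.
- by rewrite (mean_linear LP a (cr cf) (cr cg)).
- by apply: (mean_le LP (cr cf) (cr cg)) => e He; apply: fg; exact: Sr.
- exact: (mean1 LP).
Qed.

Lemma reflected_mean_dot (F : R -> R) xi :
  reflected_mean (fun e => F (dot e xi)) = L (fun e => F (dot e (reflect v xi))).
Proof. by rewrite /reflected_mean; under eq_fun do rewrite dot_reflect. Qed.

Lemma reflected_divergence : divergence_free reflected_mean.
Proof.
split=> [xi|p p' xi dp cp'].
  by rewrite (reflected_mean_dot id) (mean_dot LD).
rewrite (reflected_mean_dot (fun t => t * p t)).
rewrite (reflected_mean_dot (fun t => (dot xi xi - t ^+ 2) * p' t)).
rewrite -(dot_reflect2 v xi).
by apply: (mean_div LD (p := p)) => t; rewrite enorm_reflect; [exact: dp|exact: cp'].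
Qed.

End AxialMean.

(** A generalisation of the hat-box theorem of Archimedes: the law of [dot e zeta] has density
    proportional to the power [k] of the sine of the polar angle. *)
Lemma exists_axial_mean (R : realType) k (zeta : 'rV[R]_k.+2) :
  esphere R _ zeta -> exists L : ('rV[R]_k.+2 -> R) -> R,
  [/\ spherical_mean L, divergence_free L & forall F : R -> R,
    L (fun e => F (dot e zeta)) =
    (wallis R k)^-1 * intg 0 pi (fun t => sin t ^+ k * F (cos t))].
Proof.
move=> /esphereE zz; have [L [LP LD]] := @exists_spherical_mean R k.
pose pole : 'rV[R]_k.+2 := delta_mx 0 ord0.
have pole_dot e : dot e pole = e 0 ord0 by rewrite dotC dot_delta.
pose S := suspended_mean L.
have SP : spherical_mean S := suspended_meanP LP.
have SD : divergence_free S := suspended_divergence LP LD.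
exists (reflected_mean (pole - zeta) S); split.
- exact: reflected_meanP.
- exact: reflected_divergence.
- move=> F; rewrite reflected_mean_dot reflect_swap; last first.
    by rewrite zz pole_dot mxE !eqxx.
  rewrite /S /suspended_mean; congr (_ * _); apply: eq_intg => t _; congr (_ * _).
  under eq_fun do rewrite pole_dot polar0.
  by rewrite (mean_cst LP).
Qed.

(** * The Poisson kernel *)

Section RadialKernel.
Variables (R : realType) (k : nat).
Implicit Types r t : R.

Definition half_dim : R := k.+3%:R / 2.
Local Notation s := half_dim.

(** The square of the distance between points at distances [r] and 1 of the
    origin whose directions have inner product [t]. *)
Definition sqdist r t : R := 1 + r ^+ 2 - 2 * r * t.

Definition kernel r t : R := (1 - r ^+ 2) * sqdist r t `^ (- s).
Definition kernel_r r t : R := - 2 * r * sqdist r t `^ (- s)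
  - s * (1 - r ^+ 2) * (2 * r - 2 * t) * sqdist r t `^ (- s - 1).
Definition kernel_t r t : R := 2 * r * s * (1 - r ^+ 2) * sqdist r t `^ (- s - 1).
Definition kernel_tt r t : R :=
  4 * r ^+ 2 * s * (s + 1) * (1 - r ^+ 2) * sqdist r t `^ (- s - 2).

Lemma sqdist_gt0 r t : `|r| < 1 -> `|t| <= 1 -> 0 < sqdist r t.
Proof.
rewrite ltr_norml ler_norml => /andP[r1 r2] /andP[t1 t2]; rewrite /sqdist.
have B0 : 0 < (1 - r) ^+ 2 by rewrite exprn_gt0// subr_gt0.
have A0 : 0 < (1 + r) ^+ 2 by rewrite exprn_gt0//; lra.
have -> : 1 + r ^+ 2 - 2 * r * t =
  2^-1 * ((1 - t) * (1 + r) ^+ 2 + (1 + t) * (1 - r) ^+ 2) by field.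
rewrite mulr_gt0 ?invr_gt0//; have [t0|t0] := leP t 0.
  by rewrite ltr_pwDl// ?mulr_gt0 ?mulr_ge0//; lra.
by rewrite ltr_pwDr// ?mulr_gt0 ?mulr_ge0//; lra.
Qed.

Lemma powRB1 (q a : R) : 0 < q -> q `^ a = q * q `^ (a - 1).
Proof.
move=> q0; rewrite -{2}(powRr1 (ltW q0)) -powRD; last by rewrite (gt_eqF q0) implybT.
by congr (_ `^ _); ring.
Qed.

Lemma der_kernel r t : `|r| < 1 -> `|t| <= 1 ->
  is_derive r (1 : R) (kernel^~ t) (kernel_r r t).
Proof.
move=> r1 t1; have q0 := sqdist_gt0 r1 t1.
by rewrite /kernel /sqdist; der; [exact: q0|rewrite /= /kernel_r /sqdist; ring].
Qed.

Lemma der_kernel_t r t : `|r| < 1 -> `|t| <= 1 ->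
  is_derive t (1 : R) (kernel_t r) (kernel_tt r t).
Proof.
move=> r1 t1; have q0 := sqdist_gt0 r1 t1.
rewrite /kernel_t /sqdist; der; [exact: q0|rewrite /= /kernel_tt /sqdist].
by rewrite (_ : - s - 1 - 1 = - s - 2); ring.
Qed.

(** The radial part of the Laplace equation for the Poisson kernel, in
    divergence form. *)
Lemma der_flux r t : `|r| < 1 -> `|t| <= 1 ->
  is_derive r (1 : R) (fun r => r ^+ k.+2 * kernel_r r t)
   (- r ^+ k * ((1 - t ^+ 2) * kernel_tt r t - k.+2%:R * (t * kernel_t r t))).
Proof.
move=> r1 t1; have q0 := sqdist_gt0 r1 t1.
rewrite /kernel_r /sqdist; der; [exact: q0|exact: q0|].
rewrite /= /kernel_tt /kernel_t -/(sqdist r t).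
rewrite (_ : - s - 1 - 1 = - s - 2); last by ring.
rewrite (powRB1 (- s) q0) (powRB1 (- s - 1) q0) (_ : - s - 1 - 1 = - s - 2); last by ring.
set w := _ `^ (- s - 2); rewrite /sqdist !exprS /s.
have -> : k.+3%:R = k%:R + 3 :> R by rewrite -natrD addn3.
have -> : k.+2%:R = k%:R + 2 :> R by rewrite -natrD addn2.
by field.
Qed.

End RadialKernel.

Lemma constant_of_derive (R : realType) (f f' : R -> R) :
  (forall r, `|r| < 1 -> is_derive r (1 : R) f (f' r)) ->
  (forall r, 0 < r < 1 -> f' r = 0) ->
  forall r, 0 <= r < 1 -> f r = f 0.
Proof.
move=> df f'0 r /andP[r0 r1].
have df' x : x \in `[0, r] -> is_derive x (1 : R) f (f' x).
  by rewrite in_itv/= => /andP[x0 xr]; apply: df; rewrite ger0_norm//; lra.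
have [<-//|rn0] := eqVneq 0 r.
have rp : 0 < r by rewrite lt_def eq_sym rn0.
have cf : {within `[0, r], continuous f}.
  by apply: derivable_within_continuous => x /df' [].
have df'' x : x \in `]0, r[ -> is_derive x (1 : R) f (f' x).
  by move=> /subset_itv_oo_cc; exact: df'.
have [c] := @MVT R f f' 0 r rp df'' cf.
rewrite in_itv/= => /andP[c0 cr].
by rewrite f'0 ?c0 ?(lt_trans cr)// mul0r => /eqP; rewrite subr_eq0 => /eqP.
Qed.

Section KernelMean.
Variables (R : realType) (k : nat) (L : ('rV[R]_k.+3 -> R) -> R).
Hypotheses (LP : spherical_mean L) (LD : divergence_free L).
Variable xi : 'rV[R]_k.+3.
Hypothesis xi1 : esphere R _ xi.
Local Notation s := (half_dim R k).

Let le1 e : esphere R _ e -> `|dot e xi| <= 1.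
Proof. by move=> He; rewrite -xi1; exact: dot_sphere_le. Qed.

Let ct (r : R) e : {for (r, e), continuous (fun q => dot q.2 xi)}.
Proof.
have FF : Filter (nbhs (r, e)) by exact: nbhs_filter.
by apply: (@cvg_dot _ _ _ (nbhs (r, e)) _ snd (cst xi)); [exact: cvg_snd|exact: cvg_cst].
Qed.

Let cr (r : R) (e : 'rV[R]_k.+3) : {for (r, e), continuous (fun q => q.1)}.
Proof. exact: cvg_fst. Qed.

Lemma zonal_mean_derive (f f' : R -> R -> R) r : `|r| < 1 ->
  (forall r t, `|r| < 1 -> `|t| <= 1 -> is_derive r (1 : R) (f^~ t) (f' r t)) ->
  (forall r e, `|r| < 1 -> esphere R _ e ->
    {for (r, e), continuous (fun q => f q.1 (dot q.2 xi))}) ->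
  (forall r e, `|r| < 1 -> esphere R _ e ->
    {for (r, e), continuous (fun q => f' q.1 (dot q.2 xi))}) ->
  is_derive r (1 : R) (fun r => L (fun e => f r (dot e xi)))
    (L (fun e => f' r (dot e xi))).
Proof.
move=> r1 df cf cf'.
have nr : \forall r' \near r, `|r'| < 1.
  have cn : {for r, continuous (fun r : R => `|r|)} by exact: norm_continuous.
  exact: (@cvgr_lt _ _ _ _ _ _ cn).
apply: (mean_derive LP (K := fun r e => f r (dot e xi)) (K' := fun r e => f' r (dot e xi))).
- by apply: filterS nr => r' r'1 e He; apply: df => //; exact: le1.
- by move=> e He; exact: cf'.
- apply: filterS nr => r' r'1.
  by apply: (@csphere_joint _ _ _ r' (fun r e => f r (dot e xi))) => e He; exact: cf.
Qed.

Lemma csphere_kernel_t r : `|r| < 1 -> csphere (fun e => dot e xi * kernel_t k r (dot e xi)).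
Proof.
move=> r1.
apply: (@csphere_joint _ _ _ r (fun r e => dot e xi * kernel_t k r (dot e xi))) => e He.
have q0 := sqdist_gt0 r1 (le1 He); have := @ct r e; have := @cr r e.
by rewrite /kernel_t /sqdist => *; cont; exact: q0.
Qed.

Lemma csphere_kernel_tt r : `|r| < 1 ->
  csphere (fun e => (1 - dot e xi ^+ 2) * kernel_tt k r (dot e xi)).
Proof.
move=> r1.
apply: (@csphere_joint _ _ _ r (fun r e => (1 - dot e xi ^+ 2) * kernel_tt k r (dot e xi))) => e He.
have q0 := sqdist_gt0 r1 (le1 He); have := @ct r e; have := @cr r e.
by rewrite /kernel_tt /sqdist => *; cont; exact: q0.
Qed.

(** The flux of the mean of the kernel through the sphere of radius [r] does
    not depend on [r], so it vanishes. *)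
Lemma mean_kernel_r r : 0 < r < 1 -> L (fun e => kernel_r k r (dot e xi)) = 0.
Proof.
move=> /andP[r0 r1]; have rn : `|r| < 1 by rewrite gtr0_norm.
pose f r := L (fun e => r ^+ k.+2 * kernel_r k r (dot e xi)).
have : f r = f 0.
  apply: (@constant_of_derive _ f (fun=> 0)) => //; last by rewrite ltW.
  move=> {r r0 r1 rn} r rn.
  apply: derE.
    apply: (zonal_mean_derive (f := fun r t => r ^+ k.+2 * kernel_r k r t)
      (f' := fun r t => - r ^+ k * ((1 - t ^+ 2) * kernel_tt k r t - k.+2%:R * (t * kernel_t k r t)))) => //.
    + by move=> r' t r1' t1; exact: der_flux.
    + move=> r' e r1' He; have q0 := sqdist_gt0 r1' (le1 He); have := @ct r' e; have := @cr r' e.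
      by rewrite /kernel_r /sqdist => *; cont; exact: q0.
    + move=> r' e r1' He; have q0 := sqdist_gt0 r1' (le1 He); have := @ct r' e; have := @cr r' e.
      by rewrite /kernel_t /kernel_tt /sqdist => *; cont; exact: q0.
  have c1 := csphere_kernel_t rn; have c2 := csphere_kernel_tt rn.
  have c3 := csphereZ (c := k.+2%:R) c1.
  rewrite (meanZ LP (- r ^+ k) (csphereB c2 c3)) (meanB LP c2 c3) (meanZ LP _ c1).
  have /esphereE xx := xi1.
  have : k.+2%:R * L (fun e => dot e xi * kernel_t k r (dot e xi)) =
      L (fun e => (dot xi xi - dot e xi ^+ 2) * kernel_tt k r (dot e xi)).
    apply: (@mean_div _ _ _ LD (kernel_t k r) (kernel_tt k r) xi) => t; rewrite xi1 => t1.
      exact: der_kernel_t.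
    have q0 := sqdist_gt0 rn t1.
    by rewrite /kernel_tt /sqdist; cont; exact: q0.
  by rewrite xx => ->; rewrite subrr mulr0.
rewrite /f (meanZ LP); last first.
  apply: (@csphere_joint _ _ _ r (fun r e => kernel_r k r (dot e xi))) => e He.
  have q0 := sqdist_gt0 rn (le1 He); have := @ct r e; have := @cr r e.
  by rewrite /kernel_r /sqdist => *; cont; exact: q0.
rewrite [in RHS]expr0n/=; under [in RHS]eq_fun do rewrite mul0r.
by rewrite (mean_cst LP) => /eqP; rewrite mulf_eq0 expf_eq0/= (gt_eqF r0) => /eqP.
Qed.

(** The derivative in [r] vanishes, and the kernel at [r = 0] is the constant 1. *)
Lemma mean_kernel r : 0 <= r < 1 -> L (fun e => kernel k r (dot e xi)) = 1.
Proof.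
pose f r := L (fun e => kernel k r (dot e xi)).
have df r' : `|r'| < 1 -> is_derive r' (1 : R) f (L (fun e => kernel_r k r' (dot e xi))).
  move=> rn; apply: (zonal_mean_derive (f := @kernel R k) (f' := @kernel_r R k)) => //.
  - by move=> *; exact: der_kernel.
  - move=> {}r e r1 He; have q0 := sqdist_gt0 r1 (le1 He); have := @ct r e; have := @cr r e.
    by rewrite /kernel /sqdist => *; cont; exact: q0.
  - move=> {}r e r1 He; have q0 := sqdist_gt0 r1 (le1 He); have := @ct r e; have := @cr r e.
    by rewrite /kernel_r /sqdist => *; cont; exact: q0.
have f0 : f 0 = 1.
  rewrite /f /kernel /sqdist.
  under eq_fun do rewrite expr0n/= mulr0 mul0r addr0 !subr0 powR1 mul1r.
  exact: (mean1 LP).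
move=> r01; rewrite -f0 -/(f r).
apply: (constant_of_derive df) r01 => x x01; exact: mean_kernel_r.
Qed.

End KernelMean.

(** * The Poisson integral *)

Section LineDerivative.
Variables (R : realType) (n : nat).
Implicit Types (x v e : 'rV[R]_n).

Lemma has_der_line (f : 'rV[R]_n -> R) x v h l :
  is_derive (h *: v + x) v f l ->
  is_derive h (1 : R) (fun t : R => f (t *: v + x)) l.
Proof.
move=> /is_derive_line df; apply/is_derive_line.
by under eq_fun do rewrite [_ *: 1]mulr1 scalerDl -addrA.
Qed.

Lemma has_der_dot x v e : has_der x v (fun y => dot y e) (dot v e).
Proof.
apply/is_derive_line; under eq_fun do rewrite dotDl dotZl.
by der; rewrite /=; ring.
Qed.

Lemma has_der_dotr x v e : has_der x v (fun y => dot e y) (dot e v).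
Proof.
rewrite dotC; have := has_der_dot x v e.
by congr (has_der _ _ _ _); apply/funext => y; rewrite dotC.
Qed.

Lemma has_der_coord x i : has_der x (delta_mx 0 i) (fun y => y 0 i) 1.
Proof.
have := has_der_dotr x (delta_mx 0 i) (delta_mx 0 i); rewrite dot_delta mxE !eqxx.
by congr (has_der _ _ _ _); apply/funext => y; rewrite dot_delta.
Qed.

Lemma has_der_dotxx x v : has_der x v (fun y => dot y y) (2 * dot v x).
Proof.
apply/is_derive_line; under eq_fun do rewrite dotDl !dotDr !dotZl !dotZr (dotC x v).
by der; rewrite /=; ring.
Qed.

Lemma cvg_line x v : h *: v + x @[h --> (0 : R)] --> x.
Proof.
apply: (@cvg_row _ _ _ (nbhs (0 : R))) => j; under eq_fun do rewrite !mxE.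
have : {for 0, continuous (fun h : R => h * v 0 j + x 0 j)} by cont.
by rewrite /prop_for /continuous_at mul0r add0r.
Qed.

Lemma near_line x v (P : 'rV[R]_n -> Prop) : (\forall y \near x, P y) ->
  \forall h \near (0 : R), P (h *: v + x).
Proof. exact: cvg_line. Qed.

Variables (L : ('rV[R]_n -> R) -> R) (LP : spherical_mean L).

Lemma mean_derive_line (K K1 : 'rV[R]_n -> 'rV[R]_n -> R) x v :
  (\forall y \near x, forall e, esphere R n e -> is_derive y v (K^~ e) (K1 y e)) ->
  (forall e, esphere R n e -> {for (x, e), continuous (fun q => K1 q.1 q.2)}) ->
  (\forall y \near x, csphere (K y)) ->
  is_derive x v (fun y => L (K y)) (L (K1 x)).
Proof.
move=> dK cK1 cK; apply/is_derive_line.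
have E : (0 : R) *: v + x = x by rewrite scale0r add0r.
apply: derE.
  apply: (mean_derive LP (K := fun h e => K (h *: v + x) e)
    (K' := fun h e => K1 (h *: v + x) e)).
  - apply: (filterS _ (near_line v dK)) => h dKh e He.
    by apply: (has_der_line (f := K^~ e)); exact: dKh.
  - move=> e He.
    have cq : (q.1 *: v + x, q.2) @[q --> ((0 : R), e)] --> (x, e).
      have FF : Filter (nbhs ((0 : R), e)) by exact: nbhs_filter.
      have FG : Filter (nbhs e) by exact: nbhs_filter.
      have FH : Filter (nbhs x) by exact: nbhs_filter.
      apply: (@cvg_pair _ _ _ (nbhs ((0 : R), e)) (nbhs x) (nbhs e) _ _ _
        (fun q => q.1 *: v + x) snd); last exact: cvg_snd.
      apply: (@cvg_comp _ _ _ fst (fun h : R => h *: v + x) _ (nbhs (0 : R))).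
        exact: cvg_fst.
      exact: cvg_line.
    rewrite /prop_for /continuous_at /= E.
    exact: (cvg_comp _ _ cq (cK1 e He)).
  - exact: (near_line v cK).
by rewrite /= E.
Qed.

End LineDerivative.

Section Poisson.
Variables (R : realType) (k : nat).
Local Notation N := k.+3.
Local Notation V := 'rV[R]_N.
Local Notation s := (half_dim R k).
Implicit Types (x v w e : V).

(** For [e] on the sphere this is [|x - e|^2]. *)
Definition sqd x e : R := 1 + dot x x - 2 * dot x e.
Definition poisson x e : R := (1 - dot x x) * sqd x e `^ (- s).
Definition poisson1 v x e : R := - 2 * dot v x * sqd x e `^ (- s)
  - 2 * s * (1 - dot x x) * (dot v x - dot v e) * sqd x e `^ (- s - 1).
Definition poisson2 w v x e : R :=
  - 2 * dot v w * sqd x e `^ (- s)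
  + 4 * s * (dot v x * (dot w x - dot w e) + dot w x * (dot v x - dot v e))
    * sqd x e `^ (- s - 1)
  - 2 * s * (1 - dot x x) * dot v w * sqd x e `^ (- s - 1)
  + 4 * s * (s + 1) * (1 - dot x x) * (dot v x - dot v e) * (dot w x - dot w e)
    * sqd x e `^ (- s - 2).

Lemma sqdE x e : esphere R N e -> sqd x e = enorm (x - e) ^+ 2.
Proof.
move=> /esphereE ee; rewrite enorm_sqr dotBl !dotBr ee (dotC e x) /sqd; ring.
Qed.

Lemma sqd_gt0 x e : eball R N x -> esphere R N e -> 0 < sqd x e.
Proof.
move=> x1 He; rewrite sqdE// exprn_gt0//.
have := enormB e x; rewrite He -[e - x]opprB enormN => h; apply: lt_le_trans h.
by rewrite subr_gt0.
Qed.

Lemma dot_lt1 x : eball R N x -> dot x x < 1.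
Proof.
by move=> x1; rewrite -enorm_sqr expr_lt1// enorm_ge0.
Qed.

Lemma poisson_gt0 x e : eball R N x -> esphere R N e -> 0 < poisson x e.
Proof.
by move=> x1 He; rewrite mulr_gt0 ?subr_gt0 ?dot_lt1// powR_gt0// sqd_gt0.
Qed.

Lemma der_poisson v x e : eball R N x -> esphere R N e ->
  is_derive x v (poisson^~ e) (poisson1 v x e).
Proof.
move=> x1 He; have q0 := sqd_gt0 x1 He.
have h1 := has_der_dot x v e; have h2 := has_der_dotxx x v.
rewrite /poisson /sqd; der; [exact: q0|rewrite /= /poisson1 -/(sqd x e)].
ring.
Qed.

Lemma der_poisson1 w v x e : eball R N x -> esphere R N e ->
  is_derive x w (poisson1 v ^~ e) (poisson2 w v x e).
Proof.
move=> x1 He; have q0 := sqd_gt0 x1 He.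
have h1 := has_der_dot x w e; have h2 := has_der_dotxx x w.
have h3 := has_der_dotr x w v.
rewrite /poisson1 /sqd; der; [exact: q0|exact: q0|].
rewrite /= /poisson2 -/(sqd x e) (_ : - s - 1 - 1 = - s - 2); last by ring.
ring.
Qed.

(** Harmonicity of the Poisson kernel. Reducing the three powers of [sqd x e] to
    the lowest one leaves a polynomial identity, which holds because the
    exponent is half the dimension. *)
Lemma sum_poisson2 x e : eball R N x -> esphere R N e ->
  \sum_(i < N) poisson2 (delta_mx 0 i) (delta_mx 0 i) x e = 0.
Proof.
move=> x1 He; have q0 := sqd_gt0 x1 He; have /esphereE ee := He.
pose a := sqd x e `^ (- s); pose b := sqd x e `^ (- s - 1).
pose c := sqd x e `^ (- s - 2).
have [A AE] : exists A, A = - 2 * a - 2 * s * (1 - dot x x) * b by eexists.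
pose D := 4 * s * (s + 1) * (1 - dot x x) * c.
have -> : \sum_(i < N) poisson2 (delta_mx 0 i) (delta_mx 0 i) x e =
  \sum_(i < N) (A + ((8 * s * b + D) * (x 0 i * x 0 i) +
    ((- 8 * s * b - 2 * D) * (x 0 i * e 0 i) + D * (e 0 i * e 0 i)))).
  apply: eq_bigr => i _; rewrite /poisson2 !dot_delta mxE !eqxx /= -/a -/b -/c AE /D; ring.
rewrite !big_split /= -!mulr_sumr sumr_const card_ord -/(dot x x) -/(dot x e) -/(dot e e) ee.
rewrite -(mulr_natl A) AE /D /a /b (powRB1 (- s) q0) (powRB1 (- s - 1) q0).
rewrite (_ : - s - 1 - 1 = - s - 2); last by ring.
rewrite /c; set w := sqd x e `^ (- s - 2); rewrite /sqd /half_dim.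
have -> : N%:R = k%:R + 3 :> R by rewrite -natrD addn3.
by field.
Qed.

Section JointContinuity.
Variables (x e : V).
Hypotheses (x1 : eball R N x) (He : esphere R N e).

Let FF : Filter (nbhs (x, e)). Proof. exact: nbhs_filter. Qed.
Let c11 : {for (x, e), continuous (fun q => dot q.1 q.1)}.
Proof. by apply: (@cvg_dot _ _ _ (nbhs (x, e)) _ fst fst); exact: cvg_fst. Qed.
Let c12 : {for (x, e), continuous (fun q => dot q.1 q.2)}.
Proof. by apply: (@cvg_dot _ _ _ (nbhs (x, e)) _ fst snd); [exact: cvg_fst|exact: cvg_snd]. Qed.
Let cv1 v : {for (x, e), continuous (fun q => dot v q.1)}.
Proof. by apply: (@cvg_dot _ _ _ (nbhs (x, e)) _ (cst v) fst); [exact: cvg_cst|exact: cvg_fst]. Qed.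
Let cv2 v : {for (x, e), continuous (fun q => dot v q.2)}.
Proof. by apply: (@cvg_dot _ _ _ (nbhs (x, e)) _ (cst v) snd); [exact: cvg_cst|exact: cvg_snd]. Qed.

Lemma cont_poisson : {for (x, e), continuous (fun q => poisson q.1 q.2)}.
Proof. by have q0 := sqd_gt0 x1 He; rewrite /poisson /sqd; cont; exact: q0. Qed.

Lemma cont_poisson1 v : {for (x, e), continuous (fun q => poisson1 v q.1 q.2)}.
Proof.
have q0 := sqd_gt0 x1 He; have := @cv1 v; have := @cv2 v.
by rewrite /poisson1 /sqd => *; cont; exact: q0.
Qed.

Lemma cont_poisson2 w v : {for (x, e), continuous (fun q => poisson2 w v q.1 q.2)}.
Proof.
have q0 := sqd_gt0 x1 He; have := @cv1 v; have := @cv2 v; have := @cv1 w; have := @cv2 w.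
by rewrite /poisson2 /sqd => *; cont; exact: q0.
Qed.

End JointContinuity.

Variables (L : (V -> R) -> R) (LP : spherical_mean L) (LD : divergence_free L).
Variables (phi : V -> R) (cphi : csphere phi).

(** The Poisson integral and its derivatives all have this form. *)
Definition mean_with (K : V -> V -> R) x : R := L (fun e => K x e * phi e).
Definition poisson_integral := mean_with poisson.

Let cont_phi (K : V -> V -> R) x e : esphere R N e ->
  {for (x, e), continuous (fun q => K q.1 q.2)} ->
  {for (x, e), continuous (fun q => K q.1 q.2 * phi q.2)}.
Proof.
move=> He cK; apply: contM => //.
have FF : Filter (nbhs (x, e)) by exact: nbhs_filter.
by apply: (@continuous_cvg _ _ _ (nbhs (x, e)) _ snd phi); [exact: cphi|exact: cvg_snd].
Qed.

Section Differentiation.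
Variables K K1 : V -> V -> R.
Hypothesis cK : forall x e, eball R N x -> esphere R N e ->
  {for (x, e), continuous (fun q => K q.1 q.2)}.

Lemma csphere_mean_with x : eball R N x -> csphere (fun e => K x e * phi e).
Proof.
move=> x1; apply: (@csphere_joint _ _ _ x (fun x e => K x e * phi e)) => e He.
by apply: cont_phi => //; exact: cK.
Qed.

Lemma continuous_mean_with x : eball R N x -> {for x, continuous (mean_with K)}.
Proof.
move=> x1; apply: (@mean_cvg _ _ _ LP _ x (fun x e => K x e * phi e)) => [e He|].
  by apply: cont_phi => //; exact: cK.
by apply: filterS (near_eball x1) => y y1; exact: csphere_mean_with.
Qed.

Lemma der_mean_with v x : eball R N x ->
  (forall x e, eball R N x -> esphere R N e -> is_derive x v (K^~ e) (K1 x e)) ->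
  (forall x e, eball R N x -> esphere R N e ->
    {for (x, e), continuous (fun q => K1 q.1 q.2)}) ->
  is_derive x v (mean_with K) (mean_with K1 x).
Proof.
move=> x1 dK cK1.
apply: (mean_derive_line LP (K := fun x e => K x e * phi e) (K1 := fun x e => K1 x e * phi e)).
- apply: filterS (near_eball x1) => y y1 e He; have dKy := dK y e y1 He.
  by apply: derE (has_derM dKy (has_der_cst _ _ (phi e))) _; ring.
- by move=> e He; apply: cont_phi => //; exact: cK1.
- by apply: filterS (near_eball x1) => y y1; exact: csphere_mean_with.
Qed.

End Differentiation.

Lemma der_poisson_integral v x : eball R N x ->
  is_derive x v poisson_integral (mean_with (poisson1 v) x).
Proof.
move=> x1; apply: der_mean_with => //; [exact: cont_poisson|exact: der_poisson|].
by move=> y e y1 He; exact: cont_poisson1.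
Qed.

Lemma der_poisson_integral1 w v x : eball R N x ->
  is_derive x w (mean_with (poisson1 v)) (mean_with (poisson2 w v) x).
Proof.
move=> x1; apply: der_mean_with => //.
- by move=> y e y1 He; exact: cont_poisson1.
- by move=> y e y1 He; exact: der_poisson1.
- by move=> y e y1 He; exact: cont_poisson2.
Qed.

Lemma poisson_integral_harmonic x : eball R N x ->
  \sum_(i < N) mean_with (poisson2 (delta_mx 0 i) (delta_mx 0 i)) x = 0.
Proof.
move=> x1; rewrite /mean_with -(mean_sum LP) => [|i]; last first.
  by apply: csphere_mean_with => // y e y1 He; exact: cont_poisson2.
rewrite (mean_eq LP (g := fun=> 0)) ?(mean_cst LP)//; last first.
- by move=> e He; rewrite -mulr_suml sum_poisson2// mul0r.
- exact: csphere_cst.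
apply: (@csphere_joint _ _ _ x
  (fun x e => \sum_(i < N) poisson2 (delta_mx 0 i) (delta_mx 0 i) x e * phi e)) => e He.
by apply: cont_sum => i; apply: cont_phi => //; exact: cont_poisson2.
Qed.

Lemma csphere_poisson x : eball R N x -> csphere (poisson x).
Proof. by move=> x1; apply: (@csphere_joint _ _ _ x poisson) => e He; exact: cont_poisson. Qed.

(** On a radius the kernel is zonal, which reduces its mean to the radial case. *)
Lemma poissonZ r xi e : esphere R N xi -> poisson (r *: xi) e = kernel k r (dot e xi).
Proof.
move=> /esphereE xx.
by rewrite /poisson /kernel /sqd /sqdist !dotZl !dotZr xx mulr1 -expr2 (dotC xi e) mulrA.
Qed.

Lemma mean_poisson x : eball R N x -> L (poisson x) = 1.
Proof.
move=> x1; have [->|x0] := eqVneq x 0.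
  rewrite (_ : poisson 0 = fun=> 1) ?(mean_cst LP)//; apply/funext => e.
  by rewrite /poisson /sqd !dot0l mulr0 addr0 !subr0 powR1 mul1r.
have xn : 0 < enorm x by rewrite lt_def enorm_ge0 andbT -sqrf_eq0 enorm_sqr dotxx_eq0.
have xi1 : esphere R N ((enorm x)^-1 *: x).
  by rewrite /esphere /= enormZ ger0_norm ?invr_ge0 ?enorm_ge0// mulVf// gt_eqF.
have -> : x = enorm x *: ((enorm x)^-1 *: x).
  by rewrite scalerA divff ?scale1r// gt_eqF.
rewrite (_ : poisson _ = fun e => kernel k (enorm x) (dot e ((enorm x)^-1 *: x))).
  by apply: (mean_kernel LP LD xi1); rewrite enorm_ge0.
by apply/funext => e; rewrite poissonZ.
Qed.

End Poisson.

(** * Boundary values of the Poisson integral *)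

Section Boundary.
Variables (R : realType) (k : nat).
Local Notation N := k.+3.
Local Notation V := 'rV[R]_N.
Local Notation s := (half_dim R k).

Lemma nbhs_enorm n (x : 'rV[R]_n) (P : 'rV[R]_n -> Prop) : (\forall y \near x, P y) ->
  exists2 d : R, 0 < d & forall y, enorm (y - x) < d -> P y.
Proof.
move=> /nbhs_ballP [d /= d0 dP]; exists d => // y yx; apply: dP.
rewrite mx_norm_ball /ball_ /= distrC.
by apply: le_lt_trans yx; exact: norm_le_enorm.
Qed.

Lemma near_enorm n (x : 'rV[R]_n) (d : R) : 0 < d ->
  \forall y \near x, enorm (y - x) < d.
Proof.
move=> d0; have FF : Filter (nbhs x) by exact: nbhs_filter.
have c : enorm (y - x) @[y --> x] --> enorm (x - x).
  apply: (@cvg_enorm _ _ _ (nbhs x) _ (fun y => y - x)).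
  apply: (@cvgB _ _ _ (nbhs x)); [exact: cvg_id|exact: cvg_cst].
by apply: (@cvgr_lt _ _ _ _ _ _ c); rewrite subrr enorm0.
Qed.

Variables (L : (V -> R) -> R) (LP : spherical_mean L) (LD : divergence_free L).
Variables (phi : V -> R) (cphi : csphere phi).

Lemma mean_norm_le f g : csphere f -> csphere g ->
  (forall e, esphere R N e -> `|f e| <= g e) -> `|L f| <= L g.
Proof.
move=> cf cg fg; have cng : csphere (fun e => - g e).
  by move=> e He; apply: contN; exact: cg.
have E : L (fun e => - g e) = - L g.
  have := meanZ LP (- 1) cg; rewrite mulN1r => <-.
  by congr L; apply/funext => e; rewrite mulN1r.
rewrite ler_norml -E; apply/andP; split; apply: (mean_le LP) => // e /fg;
  by rewrite ler_norml => /andP[].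
Qed.

Lemma csphere_bounded : exists2 M : R, 0 < M & forall e, esphere R N e -> `|phi e| <= M.
Proof.
have cn : {within esphere R N, continuous (fun e => `|phi e|)}.
  apply: continuous_in_subspaceT => e; rewrite inE => He.
  by apply: (cont_comp (F := fun x => `|x|)); [exact: norm_continuous|exact: cphi].
have ne : esphere R N !=set0 by exists (delta_mx 0 ord0); exact: esphere_delta.
have [c cS cmax] := EVT_max_rV ne (@compact_esphere R N) cn.
exists (`|phi c| + 1); first by rewrite ltr_wpDl.
by move=> e He; rewrite ler_wpDr// cmax// inE.
Qed.

(** The kernel has mean 1, and for [x] near [e0] it is small at the points of the
    sphere that are away from [e0]. *)
Lemma poisson_integral_boundary e0 (d : R) : esphere R N e0 -> 0 < d ->
  \forall x \near e0, eball R N x -> `|poisson_integral L phi x - phi e0| <= d.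
Proof.
move=> He0 d0; have d2 : 0 < d / 2 by rewrite divr_gt0.
have [M M0 MP] := csphere_bounded.
have [r r0 rP] : exists2 r : R, 0 < r & forall e, enorm (e - e0) < r -> `|phi e0 - phi e| < d / 2.
  by apply: nbhs_enorm; exact: (@cvgr_dist_lt _ _ _ _ _ _ _ (cphi He0)).
have r2 : 0 < r / 2 by rewrite divr_gt0.
pose C := ((r / 2) ^+ 2) `^ (- s).
have C0 : 0 < C by rewrite powR_gt0// exprn_gt0.
have small : \forall x \near e0, 1 - dot x x < d / 2 / (2 * M * C).
  have FF : Filter (nbhs e0) by exact: nbhs_filter.
  have c : {for e0, continuous (fun x => 1 - dot x x)}.
    apply: contD; first exact: cst_continuous.
    apply: contN; apply: (@cvg_dot _ _ _ (nbhs e0) _ idfun idfun); exact: cvg_id.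
  apply: (@cvgr_lt _ _ _ _ _ _ c); move: He0 => /esphereE ->.
  by rewrite subrr divr_gt0// !mulr_gt0.
have FF : Filter (nbhs e0) by exact: nbhs_filter.
apply: filter_app2 small (near_enorm e0 r2); near=> x => x2 xr x1.
have xx : 0 < 1 - dot x x by rewrite subr_gt0 dot_lt1.
have cp := csphere_poisson x1.
have cpp : csphere (fun e => poisson x e * phi e) by exact: csphereM.
have cpc : csphere (fun e => phi e0 * poisson x e) by exact: csphereZ.
have -> : poisson_integral L phi x - phi e0 =
    L (fun e => poisson x e * phi e - phi e0 * poisson x e).
  by rewrite (meanB LP cpp cpc) (meanZ LP)// (mean_poisson LP LD x1) mulr1.
have cd : csphere (fun e => d / 2 * poisson x e) by exact: csphereZ.
have cc : csphere (fun _ : V => 2 * M * C * (1 - dot x x)) by exact: csphere_cst.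
have le : `|L (fun e => poisson x e * phi e - phi e0 * poisson x e)| <=
    L (fun e => d / 2 * poisson x e + 2 * M * C * (1 - dot x x)).
  apply: mean_norm_le; [exact: csphereB|exact: csphereD|] => e He.
  have P0 := poisson_gt0 x1 He.
  rewrite mulrC -mulrBl normrM (gtr0_norm P0).
  have [er|er] := ltP (enorm (e - e0)) r.
    apply: ler_wpDr; first by rewrite !mulr_ge0// ltW.
    by rewrite ler_pM2r// distrC ltW// rP.
  apply: ler_wpDl; first by rewrite mulr_ge0 ?ltW.
  have h1 : `|phi e - phi e0| <= 2 * M.
    apply: le_trans (ler_normB _ _) _.
    by have := MP _ He; have := MP _ He0; lra.
  have h2 : poisson x e <= C * (1 - dot x x).
    rewrite /poisson mulrC ler_pM2r// /C !powRN lef_pV2 ?posrE ?powR_gt0 ?exprn_gt0//; last first.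
      exact: sqd_gt0.
    apply: ge0_ler_powR; rewrite ?nnegrE ?sqr_ge0//.
    - by rewrite /half_dim divr_ge0.
    - by rewrite ltW// sqd_gt0.
    rewrite sqdE// ler_pXn2r// ?nnegrE ?enorm_ge0 ?ltW//.
    have := enormD (e - x) (x - e0); rewrite addrA subrK => h.
    rewrite -[x - e]opprB enormN.
    by move: (le_trans er h) xr; lra.
  apply: le_trans (ler_pM _ _ h1 h2) _; rewrite ?normr_ge0 ?(ltW P0)//.
  by rewrite mulrA.
apply: le_trans le _.
rewrite (meanD LP cd cc) (meanZ LP)// (mean_poisson LP LD x1) mulr1 (mean_cst LP).
rewrite [leRHS](splitr d) lerD2l mulrC.
by move: x2; rewrite ltr_pdivlMr ?mulr_gt0// => /ltW.
Unshelve. all: by end_near. Qed.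

Definition poisson_ext x : R :=
  if enorm x < 1 then poisson_integral L phi x else phi x.

Lemma poisson_ext_ball x : eball R N x -> poisson_ext x = poisson_integral L phi x.
Proof. by rewrite /poisson_ext /eball /= => ->. Qed.

Lemma poisson_ext_sphere x : esphere R N x -> poisson_ext x = phi x.
Proof. by rewrite /poisson_ext /esphere /= => ->; rewrite ltxx. Qed.

Lemma continuous_poisson_ext : {within eclosed_ball R N, continuous poisson_ext}.
Proof.
suff h x : enorm x <= 1 ->
    poisson_ext y @[y --> within (eclosed_ball R N) (nbhs x)] --> poisson_ext x.
  by apply/subspace_continuousP => x x1; exact: h.
move=> x1; have [xb|xs] : eball R N x \/ esphere R N x.
  by move: x1; rewrite /eclosed_ball /eball /esphere /= le_eqVlt => /predU1P[]; [right|left].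
- apply: cvg_within_filter; rewrite poisson_ext_ball//.
  have c := continuous_mean_with LP cphi (@cont_poisson R k) xb.
  rewrite /prop_for /continuous_at in c.
  apply: cvg_trans c; apply: near_eq_cvg.
  by apply: filterS (near_eball xb) => y y1; rewrite poisson_ext_ball.
- apply/cvgrPdist_le => d d0; rewrite poisson_ext_sphere//.
  have c := @cvgr_dist_lt _ _ _ _ _ _ _ (cphi xs) d d0.
  have FF : Filter (nbhs x) by exact: nbhs_filter.
  have {}c := c FF.
  have b := poisson_integral_boundary xs d0.
  rewrite near_withinE; apply: filter_app2 c b; near=> y => /= yc yb.
  rewrite /eclosed_ball /= le_eqVlt => /predU1P[ys|y1].
    by rewrite poisson_ext_sphere// ltW.
  by rewrite poisson_ext_ball// distrC; exact: yb.
Unshelve. all: by end_near. Qed.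

End Boundary.

(** * The maximum principle *)

Section MaximumPrinciple.
Variable R : realType.

(** If [l] were positive, [g1] would be positive on the right of 0, where it
    vanishes by Fermat, and [g] would increase there. *)
Lemma second_derivative_le0 (g g1 : R -> R) (l : R) :
  (\forall t \near (0 : R), is_derive t (1 : R) g (g1 t)) ->
  is_derive (0 : R) (1 : R) g1 l ->
  (\forall t \near (0 : R), g t <= g 0) -> l <= 0.
Proof.
move=> dg dg1 gmax; rewrite leNgt; apply/negP => l0.
have [r /= r0 rP] : \forall t \near (0 : R),
    is_derive t (1 : R) g (g1 t) /\ g t <= g 0.
  by near=> t; split; near: t.
have inr t : - r < t < r -> is_derive t (1 : R) g (g1 t) /\ g t <= g 0.
  by move=> tr; apply: rP; rewrite /ball_ /= sub0r normrN ltr_norml.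
have g10 : g1 0 = 0.
  have r01 : - r < r by lra.
  have m01 : (0 : R) \in `]- r, r[ by rewrite in_itv/=; lra.
  have [||dd] := derive1_at_max (f := g) (ltW r01) _ m01.
  - by move=> t; rewrite in_itv/= => /inr [[]].
  - by move=> t; rewrite in_itv/= => /inr [].
  have [dd' _] := inr 0 (m01 : _ < _ < _).
  by have [_ <-] := dd'.
have /cvgr_gt : h^-1 *: (g1 (h + 0) - g1 0) @[h --> 0^'] --> l.
  have [/cvg_ex [l' cl'] e] := dg1.
  have el : l' = l by rewrite -e; apply/esym/cvg_lim.
  rewrite el in cl'; apply: cvg_trans cl'; apply: near_eq_cvg; near=> h.
  by rewrite /= [_%:A]mulr1.
move=> /(_ 0 l0) [r' /= r'0 r'P].
pose t := Num.min (r / 2) (r' / 2).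
have t0 : 0 < t by rewrite lt_min !divr_gt0.
have tr : t <= r / 2 by rewrite ge_min lexx.
have tr' : t <= r' / 2 by rewrite ge_min lexx orbT.
have df x : x \in `]0, t[ -> is_derive x (1 : R) g (g1 x).
  by rewrite in_itv/= => /andP[x0 xt]; apply: (inr x _).1; lra.
have cf : {within `[0, t], continuous g}.
  apply: derivable_within_continuous => x; rewrite in_itv/= => /andP[x0 xt].
  by have [[]] : is_derive x (1 : R) g (g1 x) /\ g x <= g 0 by apply: inr; lra.
have [c] := MVT t0 df cf; rewrite in_itv/= => /andP[c0 ct] E.
have : 0 < g1 c.
  have := r'P c; rewrite /ball_ /= sub0r normrN gtr0_norm// addr0 g10 subr0.
  move=> /(_ _ _); rewrite -(pmulr_rgt0 (g1 c) (x := c^-1)) ?invr_gt0//; apply.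
    by lra.
  by rewrite gt_eqF.
move=> g1c; have : 0 < g1 c * (t - 0) by rewrite mulr_gt0// subr0.
rewrite -E subr_gt0; apply/negP; rewrite -leNgt.
by apply: (inr t _).2; lra.
Unshelve. all: by end_near. Qed.

Lemma within_contD (T : topologicalType) (A : set T) (f g : T -> R) :
  {within A, continuous f} -> {within A, continuous g} ->
  {within A, continuous (fun x => f x + g x)}.
Proof.
move=> /subspace_continuousP cf /subspace_continuousP cg.
apply/subspace_continuousP => x Ax.
by apply: (cvgD (cf x Ax) (cg x Ax)).
Qed.

Lemma within_contN (T : topologicalType) (A : set T) (f : T -> R) :
  {within A, continuous f} -> {within A, continuous (fun x => - f x)}.
Proof.
move=> /subspace_continuousP cf; apply/subspace_continuousP => x Ax.
exact: (cvgN (cf x Ax)).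
Qed.

Lemma within_contZ (T : topologicalType) (A : set T) (c : R) (f : T -> R) :
  {within A, continuous f} -> {within A, continuous (fun x => c * f x)}.
Proof.
move=> /subspace_continuousP cf; apply/subspace_continuousP => x Ax.
by apply: (cvgM _ (cf x Ax)); exact: cvg_cst.
Qed.

Lemma continuous_quadratic m (c : R) :
  continuous (fun x : 'rV[R]_m => c * (dot x x - 1)).
Proof.
move=> y; have FF : Filter (nbhs y) by exact: nbhs_filter.
have cy : {for y, continuous (fun x : 'rV[R]_m => dot x x)}.
  by apply: (@cvg_dot _ _ _ (nbhs y) _ idfun idfun); exact: cvg_id.
by have : {for y, continuous (fun x : 'rV[R]_m => c * (dot x x - 1))} by cont.
Qed.

Variable n : nat.
Local Notation V := 'rV[R]_n.+1.

(** Derivatives along the axes, given explicitly: only the pure second ones enter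
    the Laplacian. *)
Definition twice_derivable (u : V -> R) (u1 u2 : 'I_n.+1 -> V -> R) : Prop :=
  forall x i, eball R n.+1 x ->
    is_derive x (delta_mx 0 i) u (u1 i x) /\
    is_derive x (delta_mx 0 i) (u1 i) (u2 i x).

(** Adding a small multiple of [|x|^2 - 1] makes the Laplacian positive, which
    excludes an interior maximum. *)
Lemma max_principle (w : V -> R) (w1 w2 : 'I_n.+1 -> V -> R) :
  {within eclosed_ball R n.+1, continuous w} -> twice_derivable w w1 w2 ->
  (forall x, eball R n.+1 x -> 0 <= \sum_i w2 i x) ->
  (forall x, esphere R n.+1 x -> w x <= 0) ->
  forall x, eclosed_ball R n.+1 x -> w x <= 0.
Proof.
move=> cw dw w2ge0 wS x0 x01; rewrite leNgt; apply/negP => w0.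
pose d := w x0 / 2; have d0 : 0 < d by rewrite divr_gt0.
pose W x := w x + d * (dot x x - 1).
have cW : {within eclosed_ball R n.+1, continuous W}.
  by apply: within_contD => //; apply: continuous_subspaceT; exact: continuous_quadratic.
have ne : eclosed_ball R n.+1 !=set0 by exists x0.
have [c] := EVT_max_rV ne (@compact_eclosed_ball R n.+1 1) cW.
rewrite inE => c1 cmax.
have Wc : 0 < W c.
  apply: (@lt_le_trans _ _ (W x0)); last by apply: cmax; rewrite inE.
  rewrite /W; have := dotxx_ge0 x0; rewrite /d; have : 0 < w x0 by []; nra.
have cb : eball R n.+1 c.
  move: c1; rewrite /eclosed_ball /eball /= le_eqVlt => /predU1P[cs|//].
  have /esphereE cc : esphere R n.+1 c by [].
  by move: Wc; rewrite /W cc subrr mulr0 addr0 ltNge wS.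
have nb := near_eball cb.
have le0 i : w2 i c + 2 * d <= 0.
  have dW x : eball R n.+1 x -> is_derive x (delta_mx 0 i) W (w1 i x + 2 * d * x 0 i).
    move=> x1; have [h1 h2] := dw x i x1; have h3 := has_der_dotxx x (delta_mx 0 i).
    have h4 : has_der x (delta_mx 0 i) w (w1 i x) by [].
    by rewrite /W; der; rewrite /= dot_delta; ring.
  have dW1 x : eball R n.+1 x ->
      is_derive x (delta_mx 0 i) (fun x => w1 i x + 2 * d * x 0 i) (w2 i x + 2 * d).
    move=> x1; have [h1 h2] := dw x i x1.
    have h4 : has_der x (delta_mx 0 i) (w1 i) (w2 i x) by [].
    have h3 := has_der_coord x i.
    by der; rewrite /=; ring.
  apply: (@second_derivative_le0 (fun h : R => W (h *: delta_mx 0 i + c))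
    (fun h : R => w1 i (h *: delta_mx 0 i + c) + 2 * d * (h *: delta_mx 0 i + c) 0 i)).
  - apply: filterS (near_line (delta_mx 0 i) nb) => h hb.
    by apply: has_der_line; exact: dW.
  - have E : 0 *: delta_mx 0 i + c = c by rewrite scale0r add0r.
    apply: (has_der_line (f := fun x => w1 i x + 2 * d * x 0 i)).
    by rewrite E; exact: dW1.
  - rewrite scale0r add0r; apply: filterS (near_line (delta_mx 0 i) nb) => h hb.
    by apply: cmax; rewrite inE; exact: ltW.
have : \sum_i (w2 i c + 2 * d) <= 0 by apply: sumr_le0 => i _; exact: le0.
rewrite big_split/= sumr_const card_ord leNgt => /negP; apply.
rewrite ltr_wpDl ?w2ge0// pmulrn_lgt0// mulr_gt0//.
Qed.

(** The quadratic term has Laplacian [- G] and vanishes on the sphere. *)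
Lemma comparison (u h : V -> R) (u1 u2 h1 h2 : 'I_n.+1 -> V -> R) (G : R) :
  {within eclosed_ball R n.+1, continuous u} -> twice_derivable u u1 u2 ->
  {within eclosed_ball R n.+1, continuous h} -> twice_derivable h h1 h2 ->
  (forall x, eball R n.+1 x -> - G <= \sum_i u2 i x - \sum_i h2 i x) ->
  (forall x, esphere R n.+1 x -> u x = h x) ->
  forall x, eclosed_ball R n.+1 x -> u x <= h x + G / (2 * n.+1%:R) * (1 - dot x x).
Proof.
move=> cu du ch dh le uh x x1.
pose c := G / (2 * n.+1%:R).
suff : u x - h x + c * (dot x x - 1) <= 0 by rewrite -/c; lra.
pose w x := u x - h x + c * (dot x x - 1).
pose w1 i x := u1 i x - h1 i x + 2 * c * x 0 i.
pose w2 i x := u2 i x - h2 i x + 2 * c.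
apply: (@max_principle w w1 w2) => //.
- apply: within_contD; first by apply: within_contD => //; exact: within_contN.
  by apply: continuous_subspaceT; exact: continuous_quadratic.
- move=> {x1}x i x1; have [a1 a2] := du x i x1; have [b1 b2] := dh x i x1.
  have h3 := has_der_dotxx x (delta_mx 0 i).
  have h4 := has_der_coord x i.
  have h5 : has_der x (delta_mx 0 i) u (u1 i x) by [].
  have h6 : has_der x (delta_mx 0 i) h (h1 i x) by [].
  have h7 : has_der x (delta_mx 0 i) (u1 i) (u2 i x) by [].
  have h8 : has_der x (delta_mx 0 i) (h1 i) (h2 i x) by [].
  split.
    by rewrite /w; der; rewrite /= /w1 dot_delta; ring.
  by rewrite /w1; der; rewrite /= /w2; ring.
- move=> {x1}x x1; rewrite /w2 !big_split/= sumr_const card_ord sumrN.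
  have := le x x1; have -> : 2 * c *+ n.+1 = G.
    rewrite -mulr_natl /c; field.
    by rewrite nat1r pnatr_eq0.
  by lra.
- by move=> {x1}x /[dup] /uh xu /esphereE xx; rewrite /w xu xx !subrr mulr0 addr0.
Qed.

End MaximumPrinciple.

(** * The Gamma function at half-integers *)

Section GammaValues.
Variable R : realType.
Implicit Types (a l : R).

(** Carrying a primitive of the integrand along makes the functional equation of
    Gamma an identity between primitives. *)
Definition gamma_primitive a l := exists F : R -> R,
  [/\ forall x : R, 0 < x -> is_derive x (1 : R) F (x `^ (a - 1) * expR (- x)),
      F 0 = 0, F x @[x --> 0^'+] --> (0 : R) & F x @[x --> +oo] --> l].

(** For [a >= 1] the integrand is bounded near 0, as the fundamental theorem of
    calculus on the half-line requires. *)
Lemma gamma_primitive_Gamma a l : 1 <= a -> gamma_primitive a l -> Gamma a = l.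
Proof.
move=> a1 [F [dF F0 cF0 cF]].
pose f x : R := x `^ (a - 1) * expR (- x).
have f0 x : 0 <= f x by rewrite mulr_ge0 ?powR_ge0 ?expR_ge0.
have cexp : continuous (fun x : R => expR (- x)).
  move=> x; apply: (cont_comp (F := expR)); first exact: continuous_expR.
  by cont.
have cf : {within `[0, +oo[, continuous f}.
  apply/continuous_within_itvcyP; split.
    move=> x; rewrite in_itv/= andbT => x0.
    have ce := cexp x.
    by apply: (@contM _ _ x (fun x => x `^ (a - 1)) (fun x => expR (- x))) => //; cont.
  apply: cvgM; last exact: (cvg_at_right_filter (cexp 0)).
  move: a1; rewrite le_eqVlt => /predU1P[<-|a1].
    rewrite subrr powRr0; under eq_fun do rewrite powRr0; exact: cvg_cst.
  by rewrite powR0 ?subr_eq0 ?gt_eqF//; apply: powR_cvg0; rewrite subr_gt0.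
rewrite /Gamma /Rintegral integral_itv_obnd_cbnd; last first.
  apply/measurable_realfun.measurable_EFinP; apply: measurable_realfun.measurable_funM.
    exact: (measurable_funTS (measurable_realfun.measurable_powR _)).
  apply: measurable_funTS; exact: measurable_realfun.continuous_measurable_fun.
have := @Rintegral_ge0_continuous_FTC2y R f F 0 l.
rewrite /Rintegral F0 subr0 /f => -> //.
- by move=> x _; exact: f0.
- by move=> x x0; have [] := dF x x0.
- by move=> x; rewrite in_itv/= andbT => x0; rewrite derive1E; have [] := dF x x0.
Qed.

Lemma cvg_powR_expRN a : x `^ a * expR (- x) @[x --> +oo] --> (0 : R).
Proof.
pose n := (Num.truncn `|a|).+1.
have an : a <= n%:R.
  by apply: le_trans (ler_norm _) _; apply: ltW; exact: truncnS_gt.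
apply/cvgrPdist_le => d d0; near=> x.
have x1 : 1 <= x by near: x; apply: nbhs_pinfty_ge; exact: num_real.
have x0 : 0 < x by apply: lt_le_trans x1.
rewrite sub0r normrN ger0_norm ?mulr_ge0 ?powR_ge0 ?expR_ge0//.
have h1 : x `^ a <= x ^+ n.
  by rewrite -powR_mulrn ?(ltW x0)//; exact: ler_powR.
have h2 : x ^+ n.+1 / n.+1`!%:R <= expR x.
  by apply: le_trans (expR_ge1Dxn n (ltW x0)); rewrite lerDr.
have fn : 0 < n.+1`!%:R :> R by rewrite ltr0n fact_gt0.
apply: (@le_trans _ _ (x ^+ n * expR (- x))).
  by rewrite ler_wpM2r// expR_ge0.
rewrite expRN ler_pdivrMr ?expR_gt0//.
apply: le_trans (ler_wpM2l (ltW d0) h2).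
rewrite mulrA ler_pdivlMr// mulrC exprS mulrA ler_wpM2r ?exprn_ge0 ?(ltW x0)//.
rewrite mulrC -ler_pdivrMr//.
Unshelve. all: by end_near. Qed.

(** Integration by parts. *)
Lemma gamma_primitiveS a l : 0 < a -> gamma_primitive a l -> gamma_primitive (a + 1) (a * l).
Proof.
move=> a0 [F [dF F0 cF0 cF]].
exists (fun x => a * F x - x `^ a * expR (- x)); split.
- move=> x x0; have h : has_der x (1 : R) F (x `^ (a - 1) * expR (- x)) by exact: dF.
  der; [exact: x0|rewrite /= addrK]; ring.
- by rewrite F0 powR0 ?gt_eqF// mulr0 mul0r subr0.
- have : a * F x - x `^ a * expR (- x) @[x --> 0^'+] --> a * 0 - 0 * expR (- 0).
    apply: cvgB; first by apply: cvgM => //; exact: cvg_cst.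
    apply: cvgM; first exact: powR_cvg0.
    apply: cvg_at_right_filter.
    have : {for (0 : R), continuous (fun x : R => expR (- x))}.
      apply: (cont_comp (F := expR)); first exact: continuous_expR.
      by cont.
    exact.
  by rewrite mulr0 mul0r subr0.
- rewrite -[X in _ --> X]subr0; apply: cvgB; last exact: cvg_powR_expRN.
  by apply: cvgM => //; exact: cvg_cst.
Qed.

Lemma gamma_primitive1 : gamma_primitive 1 1.
Proof.
exists (fun x => 1 - expR (- x)); split.
- by move=> x x0; der; rewrite /= subrr powRr0; ring.
- by rewrite oppr0 expR0 subrr.
- apply: cvg_at_right_filter.
  have : {for (0 : R), continuous (fun x : R => 1 - expR (- x))}.
    apply: contD; first exact: cst_continuous.
    apply: contN; apply: (cont_comp (F := expR)); first exact: continuous_expR.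
    by cont.
  by rewrite /prop_for /continuous_at oppr0 expR0 subrr.
- rewrite -[X in _ --> X](subr0 1); apply: cvgB; first exact: cvg_cst.
  exact: cvgr_expR.
Qed.

Lemma cvg_sqrt_pinfty : Num.sqrt x @[x --> +oo] --> (+oo : set_system R).
Proof.
apply/cvgryPge => A; near=> x.
apply: (@le_trans _ _ (Num.sqrt (A ^+ 2))); first by rewrite sqrtr_sqr ler_norm.
rewrite ler_sqrt; first by near: x; apply: nbhs_pinfty_ge; exact: num_real.
by near: x; apply: nbhs_pinfty_ge; exact: num_real.
Unshelve. all: by end_near. Qed.

(** The substitution [x = y^2] and an integration by parts reduce this value
    to the Gauss integral. *)
Lemma gamma_primitive32 : gamma_primitive (3 / 2) (Num.sqrt pi / 2).
Proof.
pose J := @gauss_integral_proof.integral0_gauss R.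
have intg_gauss (b : R) : lebesgue_measure.-integrable `[0, b] (EFin \o @gauss_fun R).
  apply: continuous_compact_integrable; first exact: segment_compact.
  by apply: continuous_subspaceT; exact: continuous_gauss_fun.
have J0 : J 0 = 0 by rewrite /J /gauss_integral_proof.integral0_gauss set_itv1 Rintegral_set1.
have dJ (y : R) : 0 < y -> is_derive y (1 : R) J (expR (- y ^+ 2)).
  move=> y0; have y1 : y < y + 1 by rewrite ltrDl.
  have [dJ eJ] := continuous_FTC1_closed y1 (intg_gauss (y + 1)) y0 (@continuous_gauss_fun R y).
  apply: DeriveDef; first exact: dJ.
  by rewrite -derive1E; exact: eJ.
have cJ0 : J y @[y --> 0] --> (0 : R).
  exact: (parameterized_integral_cvg_left ltr01 (intg_gauss 1)).
have cJ : J y @[y --> +oo] --> Num.sqrt pi / 2.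
  have : Num.sqrt (J x ^+ 2) @[x --> +oo] --> Num.sqrt (pi / 4).
    apply: continuous_cvg; first exact: sqrt_continuous.
    exact: gauss_integral_proof.cvg_integral0_gauss_sqr.
  rewrite sqrtrM ?pi_ge0// sqrtrV// (_ : 4 = 2 ^+ 2); last by rewrite expr2 -natrM.
  rewrite sqrtr_sqr ger0_norm//; under eq_fun do rewrite sqrtr_sqr ger0_norm
    ?gauss_integral_proof.integral0_gauss_ge0//.
  exact.
pose H y := J y - y * expR (- y ^+ 2).
have cH0 : {for 0, continuous H}.
  apply: contD; first by rewrite /prop_for /continuous_at J0.
  apply: contN; apply: contM; first exact: cont_id.
  apply: (cont_comp (F := expR)); first exact: continuous_expR.
  by cont.
have H0 : H 0 = 0 by rewrite /H J0 mul0r subrr.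
exists (fun x => H (Num.sqrt x)); split.
- move=> x x0; have s0 : 0 < Num.sqrt x by rewrite sqrtr_gt0.
  have hJ : has_der (Num.sqrt x) (1 : R) J (expR (- Num.sqrt x ^+ 2)) by exact: dJ.
  have hH : has_der (Num.sqrt x) (1 : R) H (2 * Num.sqrt x ^+ 2 * expR (- Num.sqrt x ^+ 2)).
    by rewrite /H; apply: has_derP; [by der_rec|rewrite /=; ring].
  apply: has_derP.
    apply: (has_der_comp (f := Num.sqrt) hH).
    exact: (is_derive1_sqrt x0).
  rewrite sqr_sqrtr ?(ltW x0)// (_ : 3 / 2 - 1 = 2^-1); last by field.
  rewrite powR12_sqrt ?(ltW x0)//.
  rewrite -{1}(sqr_sqrtr (ltW x0)); field.
  by rewrite gt_eqF.
- by rewrite sqrtr0.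
- apply: cvg_at_right_filter.
  have : {for 0, continuous (fun x => H (Num.sqrt x))}.
    apply: (cont_comp (F := H)); first by rewrite sqrtr0.
    exact: sqrt_continuous.
  by rewrite /prop_for /continuous_at sqrtr0 H0.
- have cH : H y @[y --> +oo] --> Num.sqrt pi / 2.
    rewrite -[X in _ --> X]subr0; apply: cvgB => //.
    apply/cvgrPdist_le => d d0; near=> y.
    have y1 : 1 <= y by near: y; apply: nbhs_pinfty_ge; exact: num_real.
    have y0 : 0 <= y by lra.
    rewrite sub0r normrN ger0_norm ?mulr_ge0 ?expR_ge0//.
    apply: (@le_trans _ _ (y `^ 1 * expR (- y))).
      by rewrite powRr1// ler_wpM2l ?ler_expR ?lerN2// expr2 ler_peMl.
    near: y; have /cvgrPdist_le := cvg_powR_expRN 1.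
    move=> /(_ d d0); apply: filterS => y; rewrite sub0r normrN => h.
    by apply: le_trans h; exact: ler_norm.
  exact: (cvg_comp _ _ cvg_sqrt_pinfty cH).
Unshelve. all: by end_near. Qed.

End GammaValues.

(** * Evaluation of the constant *)

Section WallisGamma.
Variable R : realType.

(** Both sides satisfy the same recursion of step 2 in [j]. *)
Lemma wallis_gamma_primitive j : exists2 l : R,
  gamma_primitive ((j%:R + 3) / 2) l &
  wallis R j * (j.+1%:R * j.+1`!%:R) = 2 ^+ j.+2 * l ^+ 2.
Proof.
elim/ltn_ind: j => -[|[|j]] IH.
- exists (Num.sqrt pi / 2).
    by rewrite add0r; exact: gamma_primitive32.
  by rewrite wallis0 exprMn sqr_sqrtr ?pi_ge0// (_ : 1`!%:R = 1 :> R)//; field.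
- exists (1 * 1).
    rewrite (_ : (1%:R + 3) / 2 = 1 + 1); last by field.
    by apply: gamma_primitiveS => //; exact: gamma_primitive1.
  rewrite wallis1 (_ : 2`!%:R = 2 :> R)//; ring.
- have jj : (j < j.+2)%N by rewrite leqW.
  have [l gl wl] := IH j jj.
  exists ((j%:R + 3) / 2 * l).
    rewrite (_ : (j.+2%:R + 3) / 2 = (j%:R + 3) / 2 + 1); last first.
      by rewrite -addn2 natrD; field.
    by apply: gamma_primitiveS => //; rewrite divr_gt0// ltr_wpDl.
  have W := wallisSS R j.
  have -> : wallis R j.+2 = j.+1%:R / j.+2%:R * wallis R j.
    by rewrite mulrAC -W mulrC mulKf// pnatr_eq0.
  have -> : 2 ^+ j.+4 * ((j%:R + 3) / 2 * l) ^+ 2 =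
    (j%:R + 3) ^+ 2 * (2 ^+ j.+2 * l ^+ 2) by rewrite (exprD _ 2 j.+2); field.
  rewrite -wl !factS !natrM -(natr1 j.+2) -(natr1 j.+1) -(natr1 j).
  have j0 := ler0n R j; field.
  by apply/eqP; lra.
Qed.

Lemma wallis_Gamma j :
  wallis R j * (j.+1%:R * j.+1`!%:R) = 2 ^+ j.+2 * Gamma ((j%:R + 3) / 2) ^+ 2.
Proof.
have [l gl ->] := wallis_gamma_primitive j.
by rewrite (gamma_primitive_Gamma _ gl)// ler_pdivlMr// mul1r; have := ler0n R j; lra.
Qed.

Lemma Gamma_halfS j :
  Gamma ((j%:R + 5) / 2 : R) = (j%:R + 3) / 2 * Gamma ((j%:R + 3) / 2).
Proof.
have [l gl _] := wallis_gamma_primitive j.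
have a0 : 0 < (j%:R + 3) / 2 :> R by rewrite divr_gt0// ltr_wpDl.
have := gamma_primitiveS a0 gl.
rewrite (_ : (j%:R + 3) / 2 + 1 = (j%:R + 5) / 2); last by field.
have j0 := ler0n R j.
move=> /gamma_primitive_Gamma ->; last by rewrite ler_pdivlMr// mul1r; lra.
by rewrite (gamma_primitive_Gamma _ gl)// ler_pdivlMr// mul1r; lra.
Qed.

End WallisGamma.

Section HalfAngle.
Variables (R : realType) (m : nat).
Local Notation n := m.+2.
Implicit Types t : R.

Let C t : R := cos (t / 2).
Let S t : R := sin (t / 2).

(** The Poisson kernel at the boundary point [zeta] and an equatorial point,
    without its factor [1 - r^2]; also the boundary term at [pi/2] of the
    integrations by parts below. *)
Definition kap : R := 2 `^ (- (n%:R / 2)).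

Lemma cos_pi4_gt0 : 0 < cos (pi / 4 : R).
Proof. by apply: cos_gt0_pihalf; have := pi_gt0 R; lra. Qed.

Lemma cos_pi4_sqr : cos (pi / 4 : R) ^+ 2 = 2^-1.
Proof.
have := cos_mulr2n (pi / 4 : R); rewrite (_ : pi / 4 *+ 2 = pi / 2); last by field.
by rewrite cos_pihalf => h; lra.
Qed.

Let sin_pi4 : sin (pi / 4 : R) = cos (pi / 4).
Proof.
have c0 := cos_pi4_gt0.
have s0 : 0 < sin (pi / 4 : R) by apply: sin_gt0_pi; have := pi_gt0 R; lra.
apply/eqP; rewrite -(@eqrXn2 _ 2)// ?ltW// sin2cos2 cos_pi4_sqr.
by apply/eqP; field.
Qed.

Let C2 : C (pi / 2) = cos (pi / 4).
Proof. by rewrite /C; congr cos; field. Qed.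

Let S2 : S (pi / 2) = cos (pi / 4).
Proof. by rewrite -sin_pi4 /S; congr sin; field. Qed.

Lemma kapE : cos (pi / 4) ^+ n = kap.
Proof.
have c0 := cos_pi4_gt0; have -> : cos (pi / 4) = 2 `^ (- 2^-1) :> R.
  apply/eqP; rewrite -(@eqrXn2 _ 2)// ?powR_ge0 ?ltW// cos_pi4_sqr.
  rewrite -powR_mulrn ?powR_ge0// -powRrM (_ : - 2^-1 * 2 = - 1); last by field.
  by rewrite powR_inv1.
rewrite -powR_mulrn ?powR_ge0// -powRrM /kap; congr (_ `^ _).
by field.
Qed.

Let S_gt0 t : pi / 2 <= t <= pi -> 0 < S t.
Proof. by move=> /andP[t1 t2]; apply: sin_gt0_pi; have := pi_gt0 R; lra. Qed.

Let C_ge0 t : pi / 2 <= t <= pi -> 0 <= C t.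
Proof. by move=> /andP[t1 t2]; apply: cos_ge0_pihalf; have := pi_gt0 R; lra. Qed.

Let C_le_S t : pi / 2 <= t <= pi -> C t <= S t.
Proof.
move=> /[dup] /[dup] tI /C_ge0 c0 /S_gt0 s0; have /andP[t1 t2] := tI.
rewrite -(@ler_pXn2r _ 2)// ?nnegrE ?(ltW s0)// /S sin2cos2 -/(C t).
have c : cos t <= 0.
  have -> : t = - (pi - t) + pi by ring.
  rewrite cosDpi cosN oppr_le0 cos_ge0_pihalf//; have := pi_gt0 R; lra.
have := cos_mulr2n (t / 2); rewrite (_ : t / 2 *+ 2 = t); last by field.
by rewrite -/(C t) => h; lra.
Qed.

Let SC1 t : S t ^+ 2 = 1 - C t ^+ 2.
Proof. exact: sin2cos2. Qed.

(** Integrals over the lower hemisphere, where [tan(t/2) >= 1]. *)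
Definition half_int (a b : nat) : R := intg (pi / 2) pi (fun t => C t ^+ a / S t ^+ b).

Lemma cont_half a b : {within `[pi / 2, pi], continuous (fun t => C t ^+ a / S t ^+ b)}.
Proof.
apply: within_continuous => t; rewrite in_itv/= => /S_gt0 s0.
have h : {for t, continuous (fun t : R => t / 2)} by cont.
have c1 : {for t, continuous C} by rewrite /C; apply: (cont_comp (@continuous_cos R _)).
have c2 : {for t, continuous S} by rewrite /S; apply: (cont_comp (@continuous_sin R _)).
apply: contM; first by cont.
by apply: contV; [rewrite expf_neq0// gt_eqF|cont].
Qed.

(** The derivative of [cos(t/2)^(a+1) / sin(t/2)^(b+1)] is a combination of both
    integrands; its boundary term at [pi] vanishes. *)
Lemma half_int_rec a b : a.+1%:R * half_int a b + b.+1%:R * half_int a.+2 b.+2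
  = 2 * (cos (pi / 4) ^+ a.+1 / cos (pi / 4) ^+ b.+1).
Proof.
have pp : pi / 2 < pi :> R by have := pi_gt0 R; lra.
have F : intg (pi / 2) pi (fun t => a.+1%:R * (C t ^+ a / S t ^+ b) + b.+1%:R * (C t ^+ a.+2 / S t ^+ b.+2)) =
   - 2 * (C pi ^+ a.+1 / S pi ^+ b.+1) - (- 2 * (C (pi / 2) ^+ a.+1 / S (pi / 2) ^+ b.+1)).
  apply: (intg_FTC (F := fun t => - 2 * (C t ^+ a.+1 / S t ^+ b.+1))) => //.
  - move=> t /S_gt0 s0; rewrite /C /S; apply: has_derP.
      by der_rec; rewrite expf_neq0// gt_eqF.
    rewrite /= -/(C t) -/(S t); have sn : S t != 0 by rewrite gt_eqF.
    rewrite !exprS; field.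
    by rewrite sn expf_neq0.
  - by apply: within_contD; apply: within_contZ; exact: cont_half.
rewrite /half_int -(intgZ _ (@cont_half a b)) -(intgZ _ (@cont_half a.+2 b.+2)).
rewrite -intgD; [|by apply: within_contZ; exact: cont_half..].
rewrite F /C /S -/(C (pi / 2)) -/(S (pi / 2)) C2 S2 cos_pihalf exprS !mul0r mulr0.
by rewrite sub0r mulNr opprK.
Qed.

(** The usual reduction of the powers of the cosine. *)
Lemma half_int_rec0 a : a.+2%:R * half_int a.+2 0 = a.+1%:R * half_int a 0 -
  2 * (cos (pi / 4) ^+ a.+2).
Proof.
have pp : pi / 2 < pi :> R by have := pi_gt0 R; lra.
have c0 i : {within `[pi / 2, pi], continuous (fun t => C t ^+ i)}.
  have -> : (fun t => C t ^+ i) = (fun t => C t ^+ i / S t ^+ 0).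
    by apply/funext => t; rewrite expr0 divr1.
  exact: cont_half.
have E0 i : half_int i 0 = intg (pi / 2) pi (fun t => C t ^+ i).
  by apply: eq_intg => t _; rewrite expr0 divr1.
rewrite !E0 -(intgZ _ (c0 a)) -(intgZ _ (c0 a.+2)).
have F : intg (pi / 2) pi (fun t => a.+2%:R * C t ^+ a.+2 + - a.+1%:R * C t ^+ a) =
   2 * (C pi ^+ a.+1 * S pi) - 2 * (C (pi / 2) ^+ a.+1 * S (pi / 2)).
  apply: (intg_FTC (F := fun t => 2 * (C t ^+ a.+1 * S t))) => //.
  - move=> t /S_gt0 s0; rewrite /C /S; apply: has_derP; first by der_rec.
    rewrite /= -/(C t) -/(S t).
    have -> : 2 * (C t ^+ a.+1 * (C t * (t * 0 + 2^-1 * 1)) +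
      S t * (a.+1%:R * C t ^+ a * (- S t * (t * 0 + 2^-1 * 1)))) + C t ^+ a.+1 * S t * 0 =
      C t ^+ a.+2 - a.+1%:R * C t ^+ a * S t ^+ 2 by rewrite !exprS; field.
    rewrite SC1; have -> : a.+2%:R = a.+1%:R + 1 :> R by rewrite natr1.
    by rewrite !exprS; ring.
  - by apply: within_contD; apply: within_contZ; exact: c0.
apply/eqP; rewrite -subr_eq opprK; apply/eqP; rewrite addrC.
have := F; rewrite intgD; [|by apply: within_contZ; exact: c0..].
have Cpi : C pi = 0 by exact: cos_pihalf.
rewrite !(intgZ _ (c0 _)) C2 S2 Cpi (exprS 0) !mul0r mulr0 -exprSr => h.
by move: h; rewrite mulNr; lra.
Qed.

(** The integrand is at most 1 since [cos(t/2) <= sin(t/2)] here. *)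
Lemma half_int_bound N : 0 <= half_int (n + N.*2) N.*2 <= pi / 2.
Proof.
have pp : pi / 2 < pi :> R by have := pi_gt0 R; lra.
have cc (c : R) : {within `[pi / 2, pi], continuous (fun=> c)}.
  by apply: continuous_subspaceT => t; exact: cst_continuous.
have E (c : R) : intg (pi / 2) pi (fun=> c) = c * (pi / 2).
  rewrite (intg_FTC (F := fun t => c * t)) //; first by field.
  by move=> t _; der; rewrite /=; ring.
apply/andP; split.
  rewrite -[leLHS](mul0r (pi / 2)) -E; apply: intg_le => //; first exact: cont_half.
  move=> t tI; rewrite divr_ge0// exprn_ge0 ?C_ge0// ltW// S_gt0//.
rewrite -[leRHS]mul1r -E; apply: intg_le => //; first exact: cont_half.
move=> t tI; have s0 := S_gt0 tI; have c0 := C_ge0 tI; have cs := C_le_S tI.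
have c1 : C t <= 1 by rewrite /C cos_le1.
rewrite exprD -mulrA -expr_div_n.
apply: mulr_ile1; rewrite ?exprn_ge0 ?divr_ge0 ?(ltW s0)//.
  by rewrite exprn_ile1.
by rewrite exprn_ile1 ?divr_ge0 ?(ltW s0)// ler_pdivrMr// mul1r.
Qed.

End HalfAngle.

Section Constant.
Variables (R : realType) (m : nat).
Local Notation n := m.+2.
Local Notation b := (cos (pi / 4 : R)).
Local Notation kap := (kap R m).

Lemma kap_gt0 : 0 < kap.
Proof. by rewrite powR_gt0. Qed.

(** The integrals met when [half_int_rec] is iterated from [half_int n 0]. *)
Let T N : R := half_int R (n + N.*2) N.*2.

Let T_rec N : (n + N.*2).+1%:R * T N + (N.*2).+1%:R * T N.+1 = 2 * kap.
Proof.
have -> : T N.+1 = half_int R (n + N.*2).+2 (N.*2).+2 by rewrite /T doubleS !addnS.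
rewrite /T half_int_rec -(kapE R m); congr (_ * _).
by rewrite -addnS exprD -mulrA divff ?mulr1// expf_neq0// gt_eqF// cos_pi4_gt0.
Qed.

Lemma pochhammerS (a : R) N : pochhammer a N.+1 = pochhammer a N * (a + N%:R).
Proof. by rewrite /pochhammer big_nat_recr. Qed.

Lemma pochhammer1 N : pochhammer 1 N = N`!%:R :> R.
Proof.
elim: N => [|N IH]; first by rewrite /pochhammer big_geq.
by rewrite pochhammerS IH factS natrM mulrC nat1r.
Qed.

Lemma pochhammer_gt0 (a : R) N : 0 < a -> 0 < pochhammer a N.
Proof. by move=> a0; apply: prodr_gt0 => i _; rewrite ltr_pwDl. Qed.

Lemma pochhammer_shift (a : R) N : pochhammer a N.+1 = a * pochhammer (a + 1) N.
Proof.
rewrite /pochhammer big_nat_recl// addr0; congr (_ * _).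
by apply: eq_bigr => i _; rewrite -addrA nat1r.
Qed.

Let c : R := (n%:R + 3) / 2.
Let c1 : R := (n%:R + 1) / 2.
Let u N : R := pochhammer (1 / 2) N * pochhammer 1 N / pochhammer c N * ((- 1) ^+ N / N`!%:R).
(** The coefficient of [T N] in the iteration, up to sign and a constant factor. *)
Let rho N : R := pochhammer (1 / 2) N / pochhammer c1 N.

Let c1_gt0 : 0 < c1.
Proof. by rewrite /c1 divr_gt0// ltr_wpDl. Qed.

Let rhoS N : rho N.+1 = rho N * (N.*2.+1%:R / (n + N.*2).+1%:R).
Proof.
have p0 := pochhammer_gt0 N c1_gt0; have N0 := ler0n R N; have m0 := ler0n R m.
rewrite /rho !pochhammerS; move: (pochhammer c1 N) p0 => p p0.
rewrite -!natr1 natrD -mul2n natrM /c1 -!natr1; field.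
by rewrite (gt_eqF p0) !gt_eqF//; lra.
Qed.

Let u_rho N : u N = (- 1) ^+ N * rho N * ((n%:R + 1) / (n + N.*2).+1%:R).
Proof.
have p0 := pochhammer_gt0 N c1_gt0; have N0 := ler0n R N; have m0 := ler0n R m.
have f0 : 0 < N`!%:R :> R by rewrite ltr0n fact_gt0.
have := pochhammer_shift c1 N; rewrite pochhammerS.
rewrite (_ : c1 + 1 = c); last by rewrite /c1 /c; field.
move=> E; rewrite /u /rho pochhammer1.
have -> : pochhammer c N = pochhammer c1 N * (c1 + N%:R) / c1.
  by rewrite E mulrC mulKf// gt_eqF.
move: (pochhammer c1 N) p0 {E} => p p0.
rewrite -!natr1 natrD -mul2n natrM /c1 -!natr1; field.
by rewrite (gt_eqF p0) (gt_eqF f0) !gt_eqF//; lra.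
Qed.

(** Each use of [T_rec] splits off one term of the hypergeometric series. *)
Let partial_sum N : T 0 * ((n%:R + 1) / (2 * kap)) =
  series u N + (- 1) ^+ N * rho N * (T N * ((n%:R + 1) / (2 * kap))).
Proof.
have k0 := kap_gt0.
set q := (n%:R + 1) / (2 * kap); elim: N => [|N IH].
  by rewrite /series/= big_geq// add0r expr0 mul1r /rho /pochhammer !big_geq// divr1 mul1r.
have -> : series u N.+1 = series u N + u N by rewrite /series /= big_nat_recr.
rewrite {}IH -(addrA (series u N)); apply: congr1.
have M0 : (n + N.*2).+1%:R != 0 :> R by rewrite pnatr_eq0.
have -> : T N = (2 * kap - N.*2.+1%:R * T N.+1) / (n + N.*2).+1%:R.
  by rewrite -(T_rec N) addrK mulrC mulKf.
rewrite u_rho rhoS exprS /q; move: (rho N) (T N.+1) ((-1) ^+ N) => x y z.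
move: M0; move: ((n + N.*2).+1%:R : R) (N.*2.+1%:R : R) (n%:R : R) => p q' r M0; field.
by rewrite M0 gt_eqF.
Qed.

(** [rho (N+1) / rho N = (2N+1) / (n+2N+1)] is at most [(2N+1) / (2N+3)]. *)
Let rho_bound N : 0 <= rho N <= (N.*2.+1%:R)^-1.
Proof.
elim: N => [|N /andP[IH0 IH]]; first by rewrite /rho /pochhammer !big_geq// divr1 invr1 ler01 lexx.
rewrite rhoS mulr_ge0//=.
apply: le_trans (ler_wpM2r _ IH) _ => //.
rewrite mulrA mulVf ?pnatr_eq0// mul1r lef_pV2 ?posrE ?ltr0n// ler_nat.
by rewrite doubleS ltnS !addSn !ltnS leq_addl.
Qed.

Lemma hyp2F1E : hyp2F1 (1 / 2) 1 ((n%:R + 3) / 2) (- 1) =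
  half_int R n 0 * ((n%:R + 1) / (2 * kap)).
Proof.
rewrite /hyp2F1 -/c -/u; apply/cvg_lim => //.
have k0 := kap_gt0.
have q0 : 0 < (n%:R + 1) / (2 * kap) by rewrite divr_gt0 ?mulr_gt0// ltr_wpDl.
have -> : half_int R n 0 = T 0 by rewrite /T addn0.
apply/cvgrPdist_le => d d0; near=> N.
rewrite (partial_sum N) addrAC subrr add0r.
have /andP[r0 r1] := rho_bound N; have /andP[t0 t1] := half_int_bound R m N.
rewrite -/(T N) in t0 t1; have p0 := pi_gt0 R.
move: q0; set q := (n%:R + 1) / (2 * kap) => q0.
have -> : `|(- 1) ^+ N * rho N * (T N * q)| = rho N * (T N * q).
  move: (rho N) (T N) q r0 t0 q0 => x y z x0 y0 z0.
  by rewrite normrM normrM normrX normrN1 expr1n mul1r !ger0_norm// mulr_ge0// ltW.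
apply: (@le_trans _ _ ((N.*2.+1%:R)^-1 * (pi / 2 * q))).
  by apply: ler_pM => //; [rewrite mulr_ge0// ltW|rewrite ler_pM2r].
rewrite mulrC ler_pdivrMr ?ltr0n//; apply: (@le_trans _ _ (d * N%:R)).
  rewrite -ler_pdivrMl//; near: N; exact: nbhs_infty_ger.
by rewrite ler_wpM2l ?(ltW d0)// ler_nat -mul2n ltnW// ltnS leq_pmull.
Unshelve. all: by end_near. Qed.

(** All integrals reduce to [half_int m 0] and [kap]: [half_int_rec0] gives the
    one in the hypergeometric function, [half_int_rec] and [Q] the right-hand
    side. *)
Lemma A_E : A_ R n = half_int R m 2 / wallis R m.
Proof.
have k0 := kap_gt0; have m0 := ler0n R m.
have Q : half_int R m 2 = half_int R n 2 + half_int R m 0.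
  rewrite /half_int -intgD; [|exact: cont_half..].
  apply: eq_intg => t /andP[t1 t2].
  have s0 : sin (t / 2) != 0.
    by rewrite gt_eqF// sin_gt0_pi//; have := pi_gt0 R; lra.
  have : cos (t / 2) ^+ 2 + sin (t / 2) ^+ 2 = 1 := cos2Dsin2 _.
  rewrite expr0 divr1 (exprD _ 2 m) => h.
  move: (cos (t / 2)) (sin (t / 2)) s0 h => x y y0 h.
  apply/eqP; rewrite -subr_eq0; apply/eqP.
  have -> : x ^+ m / y ^+ 2 - (x ^+ 2 * x ^+ m / y ^+ 2 + x ^+ m) =
    x ^+ m / y ^+ 2 * (1 - (x ^+ 2 + y ^+ 2)) by field.
  by rewrite h subrr mulr0.
have D := half_int_rec R m 0; have E := half_int_rec0 R m.
have bm : b ^+ m = 2 * kap.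
  by rewrite -(kapE R m) (exprD _ 2 m) cos_pi4_sqr; field.
rewrite kapE in E; rewrite exprS mulrAC expr1 divff ?gt_eqF ?cos_pi4_gt0// mul1r bm in D.
have W := wallis_Gamma R m; have w0 := wallis_gt0 R m.
have G := Gamma_halfS R m.
have g0 : Gamma ((m%:R + 3) / 2 : R) != 0.
  apply/eqP => g0; have : 0 < wallis R m * (m.+1%:R * m.+1`!%:R).
    by rewrite !mulr_gt0 ?ltr0n ?fact_gt0.
  by rewrite W g0 expr0n/= mulr0 ltxx.
rewrite /A_ hyp2F1E.
have -> : (n%:R + 1) / 2 = (m%:R + 3) / 2 :> R by rewrite -addn2 natrD; field.
have -> : (n%:R + 3) / 2 = (m%:R + 5) / 2 :> R by rewrite -addn2 natrD; field.
have P : 2 `^ (3 * n%:R / 2) = 2 ^+ n / kap :> R.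
  rewrite /kap -powR_mulrn// -powRB ?pnatr_eq0 ?implybT//; congr (_ `^ _); by field.
rewrite P G.
set w := wallis R m in W w0 *; set g := Gamma _ in W g0 *.
set t0 := half_int R n 0 in E *; set e := half_int R m 0 in E D Q *.
set d := half_int R n 2 in D Q *.
have {}D : d = 4 * kap - m.+1%:R * e by move: D; rewrite mul1r; lra.
rewrite {}Q {}D.
have n0 : n%:R != 0 :> R by rewrite pnatr_eq0.
have -> : t0 = (m.+1%:R * e - 2 * kap) / n%:R by rewrite -E mulrC mulKf.
have W2 : 2 ^+ n = w * (m.+1%:R * m.+1`!%:R) / g ^+ 2 by rewrite W mulfK// expf_neq0.
rewrite {}W2 [m.+2`!]factS natrM; have E1 : m.+1%:R = m%:R + 1 :> R by rewrite natr1.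
have E2 : m.+2%:R = m%:R + 2 :> R by rewrite -addn2 natrD.
rewrite {}E2 {}E1.
have f0 : m.+1`!%:R != 0 :> R by rewrite pnatr_eq0 -lt0n fact_gt0.
move: (m.+1`!%:R) f0 => f f0; field.
by rewrite f0 g0 !gt_eqF//; lra.
Qed.

End Constant.

Section AxialIntegral.
Variables (R : realType) (m : nat).
Local Notation n := m.+2.

Lemma half_wallis : intg 0 (pi / 2) (fun t : R => sin t ^+ m) = wallis R m / 2.
Proof.
have p0 := pi_gt0 R.
have c a b : {within `[a, b], continuous (fun t : R => sin t ^+ m)}.
  by apply: continuous_subspaceT => t; exact: continuous_sinX.
rewrite /wallis (@intg_split R 0 pi (pi / 2))//; [|lra..].
have := @intg_reflect R 0 (pi / 2) pi (fun t => sin t ^+ m); rewrite subr0.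
rewrite (_ : pi - pi / 2 = pi / 2); last by field.
move=> ->; [|lra|exact: continuous_sinX].
rewrite (_ : intg 0 (pi / 2) (fun t => sin (pi - t) ^+ m) = intg 0 (pi / 2) (fun t => sin t ^+ m)).
  by field.
apply: eq_intg => t _; congr (_ ^+ _).
by rewrite addrC sinDpi sinN opprK.
Qed.

(** The limit at [r = 1] of the radial factor of the Poisson kernel, replaced on
    the upper hemisphere by its value at the equator. *)
Definition capped_kernel (c : R) := (2 - 2 * Num.min c 0) `^ (- (n%:R / 2)).

Lemma continuous_capped_kernel : continuous capped_kernel.
Proof.
move=> c; have h : {for c, continuous (fun c : R => Num.min c 0)}.
  by apply: continuous_min; [exact: cvg_id|exact: cst_continuous].
have c0 : Num.min c 0 <= 0 by rewrite ge_min lexx orbT.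
suff : {for c, continuous (fun c : R => (2 - 2 * Num.min c 0) `^ (- (n%:R / 2)))} by [].
by apply: (cont_powR (f := fun c : R => 2 - 2 * Num.min c 0)); [lra|cont].
Qed.

Let cF : continuous (fun t : R => sin t ^+ m * capped_kernel (cos t)).
Proof.
move=> t; have h : {for t, continuous (fun t : R => capped_kernel (cos t))}.
  by apply: (@cont_comp _ _ _ capped_kernel cos); [exact: continuous_capped_kernel|exact: continuous_cos].
by have h2 : {for t, continuous (fun t : R => sin t ^+ m)} := @continuous_sinX _ _ t; exact: (contM h2 h).
Qed.

(** The upper hemisphere contributes [kap / 2]. On the lower one, [sin t] is
    [2 sin(t/2) cos(t/2)] and [2 - 2 cos t] is [4 sin(t/2)^2]. *)
Lemma axial_integral :
  (wallis R m)^-1 * intg 0 pi (fun t => sin t ^+ m * capped_kernel (cos t)) = (A_ R n + 2 * kap R m) / 4.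
Proof.
have p0 := pi_gt0 R; have w0 := wallis_gt0 R m.
rewrite (@intg_split R 0 pi (pi / 2) _ _ _ (continuous_subspaceT cF)); [|lra|lra].
have -> : intg 0 (pi / 2) (fun t => sin t ^+ m * capped_kernel (cos t)) = kap R m * (wallis R m / 2).
  rewrite -half_wallis -intgZ; last by apply: continuous_subspaceT => t; exact: continuous_sinX.
  apply: eq_intg => t /andP[t1 t2]; rewrite mulrC /capped_kernel min_r; last by apply: cos_ge0_pihalf; lra.
  by rewrite mulr0 subr0.
have -> : intg (pi / 2) pi (fun t => sin t ^+ m * capped_kernel (cos t)) = 4^-1 * half_int R m 2.
  rewrite -intgZ; last exact: cont_half.
  apply: eq_intg => t /andP[t1 t2].
  have c0 : cos t <= 0.
    have -> : t = - (pi - t) + pi by ring.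
    by rewrite cosDpi cosN oppr_le0 cos_ge0_pihalf//; lra.
  rewrite /capped_kernel min_l//.
  have s0 : 0 < sin (t / 2) by apply: sin_gt0_pi; lra.
  have E : t / 2 *+ 2 = t by field.
  rewrite -[in sin t]E -[in cos t]E sin_mulr2n cos_mulr2n.
  have -> : 2 - 2 * (cos (t / 2) ^+ 2 *+ 2 - 1) = (2 * sin (t / 2)) ^+ 2.
    by rewrite exprMn sin2cos2; ring.
  have y0 : 0 <= 2 * sin (t / 2) by rewrite mulr_ge0 ?ltW.
  have -> : ((2 * sin (t / 2)) ^+ 2) `^ (- (n%:R / 2)) = ((2 * sin (t / 2)) ^+ n)^-1.
    rewrite powRN -(powR_mulrn n y0) -(powR_mulrn 2 y0) -powRrM; congr (_ `^ _)^-1.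
    by field.
  move: (sin _) (cos _) s0 => x y x0.
  rewrite -mulrnAl -mulr_natl !exprMn !exprS; field.
  by rewrite gt_eqF// expf_neq0// gt_eqF.
rewrite A_E; field.
by rewrite gt_eqF.
Qed.

End AxialIntegral.

(** * Bounds for the Poisson kernel on a radius *)

Section RadialSlope.
Variables (R : realType) (k : nat).
Local Notation N := k.+3.
Local Notation V := 'rV[R]_N.
Local Notation s := (half_dim R k).
Implicit Types (r t d : R).

Definition radial r t : R := sqdist r t `^ (- s).

Lemma kernel_radial r t : kernel k r t = (1 - r ^+ 2) * radial r t.
Proof. by []. Qed.

Let s_ge0 : 0 <= s. Proof. by rewrite divr_ge0. Qed.

Lemma powRN_le (a b : R) : 0 < a -> a <= b -> b `^ (- s) <= a `^ (- s).
Proof.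
move=> a0 ab; rewrite !powRN lef_pV2 ?posrE ?powR_gt0//; last exact: lt_le_trans ab.
by apply: ge0_ler_powR => //; rewrite nnegrE; lra.
Qed.

Lemma radial_le r t t' : 0 <= r < 1 -> `|t'| <= 1 -> t <= t' -> radial r t <= radial r t'.
Proof.
move=> /andP[r0 r1] t1 tt; apply: powRN_le; first by apply: sqdist_gt0; rewrite // ger0_norm.
by rewrite /sqdist lerD2l lerN2 ler_wpM2l// mulr_ge0.
Qed.

Let min0 t : Num.min t 0 <= 0. Proof. by rewrite ge_min lexx orbT. Qed.

Let min_norm t : `|t| <= 1 -> `|Num.min t 0| <= 1.
Proof. by rewrite /Num.min; case: ifP => //; rewrite normr0. Qed.

(** For [t <= 0], [1 + r^2 - 2 r t <= 2 - 2 t]. *)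
Lemma capped_le_radial r t : 0 <= r < 1 -> `|t| <= 1 ->
  capped_kernel k.+1 t <= radial r (Num.min t 0).
Proof.
move=> /andP[r0 r1] t1; apply: powRN_le.
  by apply: sqdist_gt0; [rewrite ger0_norm|exact: min_norm].
by rewrite /sqdist; have := min0 t; set m := Num.min t 0; nra.
Qed.

(** For [t <= 0], [r^2 (2 - 2 t) <= 1 + r^2 - 2 r t]. *)
Lemma radial_le_capped r t : 0 < r < 1 -> `|t| <= 1 ->
  radial r (Num.min t 0) <= r `^ (- N%:R) * capped_kernel k.+1 t.
Proof.
move=> /andP[r0 r1] t1; have m0 := min0 t.
have -> : r `^ (- N%:R) = (r ^+ 2) `^ (- s).
  by rewrite -powR_mulrn ?ltW// -powRrM /half_dim; congr (_ `^ _); field.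
rewrite -powRM ?sqr_ge0//; last by move: m0; set m := Num.min t 0; lra.
apply: powRN_le; first by rewrite mulr_gt0 ?exprn_gt0//; lra.
rewrite /sqdist; move: m0; set m := Num.min t 0 => m0.
have h1 : 0 <= (1 - r) * (1 + r) by rewrite mulr_ge0//; lra.
have h2 : 0 <= r * (1 - r) * - m by rewrite !mulr_ge0//; lra.
by nra.
Qed.

(** The product is smallest for [w = 2] on the lower and [w = 0] on the upper
    hemisphere, and for [t <= 0] the kernel is at least its limit at [r = 1]. *)
Lemma gain_lower r t (w : R) : 0 <= r < 1 -> `|t| <= 1 -> 0 <= w <= 2 ->
  2 * (capped_kernel k.+1 t - radial r 0) <= (radial r t - radial r 0) * w.
Proof.
move=> rI t1 /andP[w0 w2]; have := capped_le_radial rI t1.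
have [t0|t0] := leP t 0; last first.
  move=> h.
  have h0 : radial r 0 <= radial r t by apply: radial_le => //; exact: ltW.
  have : 0 <= (radial r t - radial r 0) * w by rewrite mulr_ge0// subr_ge0.
  by lra.
move=> h.
have h0 : radial r t <= radial r 0 by apply: radial_le => //; rewrite normr0.
by nra.
Qed.

(** A continuous odd approximation of the sign. *)
Definition clamp d t : R := Num.max (- 1) (Num.min 1 (t / d)).

Lemma clamp_cases d t : 0 < d ->
  [\/ d <= t /\ clamp d t = 1, t <= - d /\ clamp d t = - 1 |
   - d < t < d /\ clamp d t = t / d].
Proof.
move=> d0; rewrite /clamp; have [td|td] := leP d t.
  constructor 1; split => //; have h : 1 <= t / d by rewrite ler_pdivlMr// mul1r.
  by rewrite min_l// max_r//; lra.
have h : t / d <= 1 by rewrite ler_pdivrMr// mul1r ltW.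
rewrite min_r//; have [td'|td'] := leP t (- d).
  by constructor 2; split => //; rewrite max_l// ler_pdivrMr// mulN1r.
by constructor 3; split; [apply/andP|rewrite max_r// ler_pdivlMr// mulN1r ltW].
Qed.

Lemma clamp_le1 d t : `|clamp d t| <= 1.
Proof.
rewrite ler_norml /clamp le_max lexx/= ge_max; apply/andP; split; first by lra.
by rewrite ge_min lexx.
Qed.

Lemma clampN d t : 0 < d -> clamp d (- t) = - clamp d t.
Proof.
move=> d0; have [[h ->]|[h ->]|[/andP[h1 h2] ->]] := clamp_cases t d0;
  have [[h' ->]|[h' ->]|[/andP[h1' h2'] ->]] := clamp_cases (- t) d0; rewrite ?mulNr ?opprK//; lra.
Qed.

Lemma continuous_clamp d : continuous (clamp d).
Proof.
move=> t; have h : {for t, continuous (fun t : R => t / d)} by cont.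
apply: (@continuous_max _ _ (fun=> - 1) (fun t => Num.min 1 (t / d))); first exact: cst_continuous.
by apply: (@continuous_min _ _ (fun=> 1) (fun t => t / d)); [exact: cst_continuous|exact: h].
Qed.

(** The second summand on the right pays for the strip [|t| < d], where the
    clamped function is not yet the sign. *)
Lemma gain_upper r t d : 0 < r < 1 -> 0 < d <= 1 -> `|t| <= 1 ->
  (radial r t - radial r 0) * (1 - clamp d t) <=
  2 * (r `^ (- N%:R) * capped_kernel k.+1 t - radial r 0)
  + (2 * (radial r 0 - radial r (- d)) + (radial r d - radial r 0)).
Proof.
move=> rI /andP[d0 d1] t1; have h := radial_le_capped rI t1.
have rI' : 0 <= r < 1 by case/andP: rI => /ltW -> ->.
have n0 : `|0 : R| <= 1 by rewrite normr0.
have nd : `|d| <= 1 by rewrite ger0_norm// ltW.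
have h1 : radial r (- d) <= radial r 0 by apply: radial_le => //; lra.
have h2 : radial r 0 <= radial r d by apply: radial_le => //; lra.
move: h; have [t0|t0] := leP t 0.
  move=> h; have ht : radial r t <= radial r 0 by exact: radial_le.
  have [[b ->]|[b ->]|[/andP[b1 b2] _]] := clamp_cases t d0; [lra|nra|].
  have hd : radial r (- d) <= radial r t by apply: radial_le => //; exact: ltW.
  have : 0 <= (radial r 0 - radial r t) * (1 - clamp d t).
    by rewrite mulr_ge0 ?subr_ge0//; have := clamp_le1 d t; rewrite ler_norml => /andP[].
  by lra.
move=> h; have ht : radial r 0 <= radial r t by apply: radial_le => //; exact: ltW.
have [[b ->]|[b ->]|[/andP[b1 b2] ->]] := clamp_cases t d0; [lra|lra|].
have hd : radial r t <= radial r d by apply: radial_le => //; exact: ltW.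
have td : 0 <= t / d by rewrite divr_ge0 ?ltW.
by nra.
Qed.

End RadialSlope.

(** * Poisson integrals along a radius *)

Section AxialGap.
Variables (R : realType) (k : nat) (zeta : 'rV[R]_k.+3).
Local Notation N := k.+3.
Local Notation V := 'rV[R]_N.
Local Notation s := (half_dim R k).
Variables (L : (V -> R) -> R) (phi : V -> R).
Hypotheses (LP : spherical_mean L) (LD : divergence_free L).
Hypothesis zonal : forall F : R -> R, L (fun e => F (dot e zeta)) =
  (wallis R k.+1)^-1 * intg 0 pi (fun t => sin t ^+ k.+1 * F (cos t)).
Hypotheses (zeta1 : esphere R N zeta) (cphi : csphere phi).
Hypothesis phi_le1 : forall e, esphere R N e -> `|phi e| <= 1.

Lemma csphere_zonal (F : R -> R) : continuous F -> csphere (fun e : V => F (dot e zeta)).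
Proof. by move=> cF e e1; apply: (cont_comp (cF _)); exact: csphere_dot. Qed.

Lemma mean_capped_kernel : L (fun e => capped_kernel k.+1 (dot e zeta)) =
  (A_ R N + 2 * kap R k.+1) / 4.
Proof. by rewrite zonal axial_integral. Qed.

Let dot1 e : esphere R N e -> `|dot e zeta| <= 1.
Proof. by move=> e1; rewrite -zeta1; exact: dot_sphere_le. Qed.

Let cball r : 0 <= r < 1 -> eball R N (r *: zeta).
Proof. by move=> /andP[r0 r1]; rewrite /eball /= enormZ zeta1 mulr1 ger0_norm. Qed.

Lemma csphere_radial r : 0 <= r < 1 -> csphere (fun e : V => radial k r (dot e zeta)).
Proof.
move=> /[dup] rI /andP[r0 r1] e e1; have c := csphere_dot (xi := zeta) e1.
have h : {for e, continuous (fun e : V => sqdist r (dot e zeta))} by rewrite /sqdist; cont.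
apply: (@cont_powR _ _ _ (fun e : V => sqdist r (dot e zeta))) => //.
by apply: sqdist_gt0; [rewrite ger0_norm|exact: dot1].
Qed.

Let cgain r : 0 <= r < 1 ->
  csphere (fun e : V => (radial k r (dot e zeta) - radial k r 0) * (1 - phi e)).
Proof.
move=> rI; apply: csphereM; first by apply: csphereB; [exact: csphere_radial|exact: csphere_cst].
by apply: csphereB => //; exact: csphere_cst.
Qed.

(** The value of the kernel at the equator is subtracted, so that the weight of
    [1 - phi] has the sign of [dot e zeta]. *)
Lemma gap_mean r : 0 <= r < 1 -> 1 - poisson_ext L phi (r *: zeta) =
  (1 - r ^+ 2) * (L (fun e => (radial k r (dot e zeta) - radial k r 0) * (1 - phi e))
    + radial k r 0 * (1 - L phi)).
Proof.
move=> rI; have b := cball rI; rewrite poisson_ext_ball// /poisson_integral /mean_with.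
have cP := csphere_poisson b.
rewrite -[X in X - _](mean_poisson LP LD b) -(meanB LP)//; last exact: csphereM.
have c1 : csphere (fun e => 1 - phi e) by apply: csphereB => //; exact: csphere_cst.
have <- : L (fun e => 1 - phi e) = 1 - L phi by rewrite (meanB LP)// ?(mean1 LP)//; exact: csphere_cst.
rewrite -(meanZ LP)// -(meanD LP)//; [|exact: cgain|exact: csphereZ].
rewrite -(meanZ LP); last by apply: csphereD; [exact: cgain|exact: csphereZ].
apply: (mean_eq LP).
- by apply: csphereB => //; exact: csphereM.
- by apply: csphereZ; apply: csphereD; [exact: cgain|exact: csphereZ].
by move=> e e1; rewrite poissonZ// kernel_radial; ring.
Qed.

Lemma gap_lower r : 0 <= r < 1 ->
  (1 - r ^+ 2) * ((A_ R N + 2 * kap R k.+1) / 2 - radial k r 0 * (1 + L phi)) <=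
  1 - poisson_ext L phi (r *: zeta).
Proof.
move=> rI; have ccap := csphere_zonal (@continuous_capped_kernel R k.+1).
rewrite gap_mean//; apply: ler_wpM2l.
  by case/andP: rI => r0 r1; rewrite subr_ge0 expr_le1// ltW.
have cl : csphere (fun e : V => 2 * (capped_kernel k.+1 (dot e zeta) - radial k r 0)).
  by apply: csphereZ; apply: csphereB => //; exact: csphere_cst.
have := mean_le LP cl (cgain rI); rewrite (meanZ LP); last by apply: csphereB => //; exact: csphere_cst.
rewrite (meanB LP)//; last exact: csphere_cst.
rewrite (mean_cst LP) mean_capped_kernel => h; suff : 2 * ((A_ R N + 2 * kap R k.+1) / 4 - radial k r 0) <=
    L (fun e => (radial k r (dot e zeta) - radial k r 0) * (1 - phi e)) by lra.
apply: h => e e1; apply: gain_lower => //; first exact: dot1.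
by have := phi_le1 e1; rewrite ler_norml => /andP[h1 h2]; lra.
Qed.

Lemma poisson_ext0 : poisson_ext L phi 0 = L phi.
Proof.
have b : eball R N 0 by rewrite /eball/= enorm0.
rewrite poisson_ext_ball//; apply: (mean_eq LP) => // [|e e1].
  by apply: csphereM => //; exact: csphere_poisson.
by rewrite /poisson /sqd !dot0l mulr0 addr0 !subr0 powR1 !mul1r.
Qed.

End AxialGap.

Section Extremal.
Variables (R : realType) (k : nat) (zeta : 'rV[R]_k.+3) (d : R).
Local Notation N := k.+3.
Local Notation V := 'rV[R]_N.
Variables (L : (V -> R) -> R).
Hypotheses (LP : spherical_mean L) (LD : divergence_free L).
Hypothesis zonal : forall F : R -> R, L (fun e => F (dot e zeta)) =
  (wallis R k.+1)^-1 * intg 0 pi (fun t => sin t ^+ k.+1 * F (cos t)).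
Hypotheses (zeta1 : esphere R N zeta) (d01 : 0 < d <= 1).

Definition clamped_height (e : V) : R := clamp d (dot e zeta).

Let d0 : 0 < d. Proof. by case/andP: d01. Qed.

Lemma csphere_clamped_height : csphere clamped_height.
Proof. exact: (csphere_zonal (F := clamp d)) (continuous_clamp (d := d)). Qed.

Lemma clamped_height_le1 e : `|clamped_height e| <= 1.
Proof. exact: clamp_le1. Qed.

(** The boundary function is odd in the height. *)
Lemma mean_clamped_height : L clamped_height = 0.
Proof.
rewrite /clamped_height zonal; apply/eqP; rewrite mulf_eq0; apply/orP; right; apply/eqP.
have c : continuous (fun t : R => sin t ^+ k.+1 * clamp d (cos t)).
  move=> t; have h : {for t, continuous (fun t : R => clamp d (cos t))}.
    by apply: (@cont_comp _ _ _ (clamp d) cos); [exact: continuous_clamp|exact: continuous_cos].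
  by have h2 : {for t, continuous (fun t : R => sin t ^+ k.+1)} := @continuous_sinX _ _ t; exact: (contM h2 h).
have := intg_reflect pi (pi_gt0 R) c; rewrite subr0 subrr.
set I := (X in X = _ -> _); suff -> : intg 0 pi (fun t : R => sin (pi - t) ^+ k.+1 * clamp d (cos (pi - t))) = - I.
  by move=> h; rewrite -/I; lra.
rewrite -mulN1r -intgZ; last exact: continuous_subspaceT.
apply: eq_intg => t _; rewrite addrC sinDpi cosDpi sinN cosN opprK clampN//.
by rewrite mulN1r mulrN.
Qed.

Lemma gap_upper r : 0 < r < 1 -> 1 - poisson_ext L clamped_height (r *: zeta) <=
  (1 - r ^+ 2) * (r `^ (- N%:R) * ((A_ R N + 2 * kap R k.+1) / 2) - radial k r 0
    + (2 * (radial k r 0 - radial k r (- d)) + (radial k r d - radial k r 0))).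
Proof.
move=> /[dup] rI /andP[r0 r1]; have rI' : 0 <= r < 1 by rewrite (ltW r0).
have ccap := csphere_zonal (zeta := zeta) (@continuous_capped_kernel R k.+1).
rewrite gap_mean//; last exact: csphere_clamped_height.
rewrite mean_clamped_height subr0 mulr1; apply: ler_wpM2l.
  by rewrite subr_ge0 expr_le1// ltW.
set c := (2 * _ + _).
have cu : csphere (fun e : V => 2 * (r `^ (- N%:R) * capped_kernel k.+1 (dot e zeta) - radial k r 0) + c).
  apply: csphereD; last exact: csphere_cst.
  by apply: csphereZ; apply: csphereB; [exact: csphereZ|exact: csphere_cst].
set D := (X in L X); suff : L D <= 2 * (r `^ (- N%:R) * ((A_ R N + 2 * kap R k.+1) / 4) - radial k r 0) + c by lra.
have <- : L (fun e : V => 2 * (r `^ (- N%:R) * capped_kernel k.+1 (dot e zeta) - radial k r 0) + c) =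
  2 * (r `^ (- N%:R) * ((A_ R N + 2 * kap R k.+1) / 4) - radial k r 0) + c.
  rewrite (meanD LP)//; last 2 first.
  - by apply: csphereZ; apply: csphereB; [exact: csphereZ|exact: csphere_cst].
  - exact: csphere_cst.
  rewrite (meanZ LP); last by apply: csphereB; [exact: csphereZ|exact: csphere_cst].
  rewrite (meanB LP); [|exact: csphereZ|exact: csphere_cst].
  by rewrite (meanZ LP)// !(mean_cst LP) mean_capped_kernel.
apply: (mean_le LP) => //.
  apply: csphereM; last by apply: csphereB; [exact: csphere_cst|exact: csphere_clamped_height].
  by apply: csphereB; [exact: csphere_radial|exact: csphere_cst].
by move=> e e1; apply: gain_upper => //; rewrite -zeta1; exact: dot_sphere_le.
Qed.

(** Strictness: the kernel at [x] is at least [w > 0] on the whole sphere, while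
    the functions [1 + phi] and [1 - phi] are nonnegative of mean 1. *)
Lemma poisson_ext_clamped_lt1 x : eball R N x -> `|poisson_ext L clamped_height x| < 1.
Proof.
move=> x1; have cp := csphere_clamped_height.
rewrite poisson_ext_ball// /poisson_integral /mean_with; have cP := csphere_poisson x1.
pose w := (1 - dot x x) * 4 `^ (- half_dim R k).
have w0 : 0 < w by rewrite mulr_gt0 ?powR_gt0// subr_gt0; exact: dot_lt1.
have wP e : esphere R N e -> w <= poisson x e.
  move=> e1; apply: ler_wpM2l; first by rewrite subr_ge0 ltW//; exact: dot_lt1.
  apply: powRN_le; first exact: sqd_gt0.
  rewrite sqdE//; have := enormD x (- e); rewrite enormN e1.
  by move: x1 (enorm_ge0 (x - e)); rewrite /eball/= => x1 h0 h; nra.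
have key (psi : V -> R) : csphere psi -> (forall e, `|psi e| <= 1) -> L psi = 0 ->
    L (fun e => poisson x e * psi e) < 1.
  move=> cpsi psi1 L0; rewrite -subr_gt0; apply: (lt_le_trans w0).
  have c1 : csphere (fun e => 1 - psi e) by apply: csphereB => //; exact: csphere_cst.
  have <- : w * L (fun e => 1 - psi e) = w.
    by rewrite (meanB LP)//; [rewrite (mean1 LP) L0 subr0 mulr1|exact: csphere_cst].
  rewrite -[X in _ <= X - _](mean_poisson LP LD x1) -(meanB LP)//; last exact: csphereM.
  rewrite -(meanZ LP)//; apply: (mean_le LP); first exact: csphereZ.
    by apply: csphereB => //; exact: csphereM.
  move=> e e1; have -> : poisson x e - poisson x e * psi e = poisson x e * (1 - psi e) by ring.
  apply: ler_wpM2r; last exact: wP.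
  by have := psi1 e; rewrite ler_norml => /andP[_ h]; rewrite subr_ge0.
rewrite ltr_norml key//; last 2 first.
- exact: clamped_height_le1.
- exact: mean_clamped_height.
rewrite andbT ltrNl -mulN1r -(meanZ LP); last exact: csphereM.
have -> : L (fun e => -1 * (poisson x e * clamped_height e)) = L (fun e => poisson x e * (-1 * clamped_height e)).
  apply: (mean_eq LP).
  - by apply: csphereZ; exact: csphereM.
  - by apply: csphereM => //; exact: csphereZ.
  - by move=> e _; ring.
apply: key; first exact: csphereZ.
  by move=> e; rewrite mulN1r normrN clamped_height_le1.
by rewrite (meanZ LP)// mean_clamped_height mulr0.
Qed.

End Extremal.

(** * Lower limits and radial limits *)

Section LowerLimit.
Variables (R : realType) (F : set_system R).
Context {FF : ProperFilter F}.

Lemma le_limf_einf (q B : R -> R) (b : R) : B @ F --> b ->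
  (\forall r \near F, B r <= q r) -> (b%:E <= limf_einf (fun r => (q r)%:E) F)%E.
Proof.
move=> Bb Bq; rewrite limf_einfE; apply/lee_subgt0Pr => e e0; rewrite -EFinB.
have be : b - e < b by rewrite ltrBlDr ltrDl.
have Fe : F [set r | b - e <= q r].
  have FF' : Filter F := @filter_filter _ _ FF.
  have Be := cvgr_gt b Bb _ be.
  by apply: filterS2 (Be FF') Bq => r h1 h2; apply: le_trans h2; exact: ltW.
apply: (@le_trans _ _ (ereal_inf [set (q r)%:E | r in [set r | b - e <= q r]])).
  by apply: le_ereal_inf_tmp => _ [r br <-]; rewrite lee_fin.
by apply: ereal_sup_ubound; exists [set r | b - e <= q r].
Unshelve. all: by end_near. Qed.

Lemma limf_einf_le (q : R -> R) (a : R) : (\forall r \near F, q r <= a) ->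
  (limf_einf (fun r => (q r)%:E) F <= a%:E)%E.
Proof.
move=> qa; rewrite limf_einfE; apply: ge_ereal_sup => _ [V FV <-].
have [r [Vr ra]] := @filter_ex _ F FF _ (filterI FV qa).
by apply: (@le_trans _ _ (q r)%:E); [apply: ereal_inf_lbound; exists r|rewrite lee_fin].
Qed.

End LowerLimit.

Section Radial.
Variables (R : realType) (n : nat).
Local Notation V := 'rV[R]_n.

Lemma radial_in_ball (e : V) : esphere R n e ->
  \forall r \near (1 : R)^'-, 0 < r < 1 /\ eball R n (r *: e).
Proof.
move=> e1; near=> r.
have r0 : 0 < r by near: r; apply: nbhs_left_gt.
have r1 : r < 1 by near: r; exact: nbhs_left_lt.
by rewrite r0 r1; split => //; rewrite /eball/= enormZ e1 mulr1 gtr0_norm.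
Unshelve. all: by end_near. Qed.

Lemma radial_cvg (T : topologicalType) (f : V -> T) (e : V) :
  {within eclosed_ball R n, continuous f} -> esphere R n e ->
  f (r *: e) @[r --> (1 : R)^'-] --> f e.
Proof.
move=> /subspace_continuousP cf e1 U fU.
have : within (eclosed_ball R n) (nbhs e) (f @^-1` U).
  by apply: (cf e) => //; rewrite /eclosed_ball /= e1.
rewrite /within /= => nU.
have c : r *: e @[r --> (1 : R)^'-] --> e.
  have h : {for (1 : R), continuous (fun r : R => r *: e)}.
    apply: (@cvg_row _ _ _ (nbhs (1 : R))) => j; rewrite !mxE; under eq_fun do rewrite !mxE.
    by have : {for (1 : R), continuous (fun r : R => r * e 0 j)} by cont.
  by apply: cvg_at_left_filter; rewrite -[X in _ --> X]scale1r.
have := c _ nU; rewrite /= => h; have b := radial_in_ball e1.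
suff : \forall r \near (1 : R)^'-, U (f (r *: e)) by [].
apply: filterS2 (h : \forall r \near (1 : R)^'-, eclosed_ball R n (r *: e) -> U (f (r *: e))) b.
by move=> r hr [_ rb]; apply: hr; exact: ltW.
Qed.

Variable m : nat.
Local Notation W := 'rV[R]_m.

Lemma within_cont_dot (f : V -> W) (w : W) (A : set V) :
  {within A, continuous f} -> {within A, continuous (fun x => dot (f x) w)}.
Proof.
move=> /subspace_continuousP cf; apply/subspace_continuousP => x Ax.
have FF : Filter (within A (nbhs x)) by exact: within_filter.
by apply: (cvg_dot FF); [exact: cf|exact: cvg_cst].
Qed.

Lemma within_cont_enorm (f : V -> W) (A : set V) :
  {within A, continuous f} -> {within A, continuous (fun x => enorm (f x))}.
Proof.
move=> /subspace_continuousP cf; apply/subspace_continuousP => x Ax.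
have FF : Filter (within A (nbhs x)) by exact: within_filter.
by apply: (cvg_enorm FF); exact: cf.
Qed.

Lemma supnorm_ge (g : V -> W) x : {within eclosed_ball R n, continuous g} ->
  eball R n x -> enorm (g x) <= supnorm g.
Proof.
move=> cg x1; apply: ub_le_sup; last by exists x.
have ne : eclosed_ball R n !=set0 by exists x; exact: ltW.
have [c _ cmax] := EVT_max_rV ne (@compact_eclosed_ball R n 1) (within_cont_enorm cg).
exists (enorm (g c)) => _ [y y1 <-]; apply: cmax; rewrite inE; exact: ltW.
Qed.

Lemma supnorm_ge0 (g : V -> W) : {within eclosed_ball R n, continuous g} -> 0 <= supnorm g.
Proof.
move=> cg; apply: le_trans (enorm_ge0 (g 0)) _; apply: supnorm_ge => //.
by rewrite /eball/= enorm0.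
Qed.

Lemma enorm_le1_closed (f : V -> W) : {within eclosed_ball R n, continuous f} ->
  f @` eball R n `<=` eball R m -> forall x, eclosed_ball R n x -> enorm (f x) <= 1.
Proof.
move=> cf fb x; rewrite /eclosed_ball/= le_eqVlt => /predU1P[x1|x1]; last first.
  by apply: ltW; apply: fb; exists x.
have c := radial_cvg (within_cont_enorm cf) x1.
apply: (cvgr_to_le c).
apply: filterS (radial_in_ball x1) => r [_ rb].
by apply: ltW; apply: fb; exists (r *: x).
Qed.

End Radial.

(** * The lower bound for the slope *)

Section PoissonData.
Variables (R : realType) (k : nat).
Local Notation N := k.+3.
Local Notation V := 'rV[R]_N.
Variables (L : (V -> R) -> R) (phi : V -> R).
Hypotheses (LP : spherical_mean L) (cphi : csphere phi).
Let dl i : V := delta_mx 0 i.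

Definition poisson_d i := mean_with L phi (poisson1 (dl i)).
Definition poisson_dd j i := mean_with L phi (poisson2 (dl j) (dl i)).

Lemma der_poisson_ext i x : eball R N x ->
  is_derive x (dl i) (poisson_ext L phi) (poisson_d i x).
Proof.
move=> x1; apply: der_near (der_poisson_integral LP cphi (dl i) x1).
by apply: filterS (near_eball x1) => y y1; rewrite poisson_ext_ball.
Qed.

Lemma twice_derivable_poisson_ext :
  twice_derivable (poisson_ext L phi) poisson_d (fun i => poisson_dd i i).
Proof.
move=> x i x1; split; first exact: der_poisson_ext.
exact: der_poisson_integral1.
Qed.

End PoissonData.

Section LowerBound.
Variables (R : realType) (k m : nat).
Local Notation N := k.+3.
Local Notation V := 'rV[R]_N.
Local Notation W := 'rV[R]_m.
Variables (f g : V -> W) (zeta : V).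
Hypotheses (cg : {within eclosed_ball R N, continuous g})
  (cf : {within eclosed_ball R N, continuous f}) (f2 : C2_on (eball R N) f)
  (fb : f @` eball R N `<=` eball R m)
  (fg : forall x, eball R N x -> laplacian f x = g x)
  (f0 : f 0 = 0) (zeta1 : esphere R N zeta)
  (fzeta : enorm (f (r *: zeta)) @[r --> (1 : R)^'-] --> (1 : R)).

Let w : W := f zeta.
Let u x := dot (f x) w.
Local Notation G := (supnorm g).

Let w1 : enorm w = 1.
Proof.
have c := radial_cvg (within_cont_enorm cf) zeta1.
by rewrite -[RHS](cvg_lim _ fzeta)// (cvg_lim _ c).
Qed.

Let cu : {within eclosed_ball R N, continuous u}.
Proof. exact: within_cont_dot. Qed.

Let u_le1 x : eclosed_ball R N x -> `|u x| <= 1.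
Proof.
move=> x1; apply: le_trans (dot_le _ _) _; rewrite w1 mulr1.
exact: (enorm_le1_closed cf).
Qed.

Let u1 i x := \sum_j partial i (component f j) x * w 0 j.
Let u2 i x := \sum_j partial i (partial i (component f j)) x * w 0 j.

Let du : twice_derivable u u1 u2.
Proof.
move=> x i x1; split; apply: der_sum => j.
  have h : has_der x (delta_mx 0 i) (component f j) (partial i (component f j) x).
    by apply: derivableP; have [h _] := f2 j; have [_ /(_ i) []] := h x x1.
  have -> : (fun y => f y 0 j * w 0 j) = (fun y => component f j y * w 0 j) by [].
  by der; rewrite mulr0 add0r mulrC.
have h : has_der x (delta_mx 0 i) (partial i (component f j)) (partial i (partial i (component f j)) x).
  by apply: derivableP; have [_ /(_ i) h] := f2 j; have [_ /(_ i) []] := h x x1.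
by der; rewrite mulr0 add0r mulrC.
Qed.

Let lap_u x : eball R N x -> \sum_i u2 i x = dot (g x) w.
Proof.
move=> x1; rewrite -fg// exchange_big; apply: eq_bigr => j _.
by rewrite mxE mulr_suml.
Qed.

Let lap_u_le x : eball R N x -> `|\sum_i u2 i x| <= G.
Proof.
move=> x1; rewrite lap_u//; apply: le_trans (dot_le _ _) _.
by rewrite w1 mulr1 supnorm_ge.
Qed.

(** [u] is only continuous within the closed ball; its boundary values are
    extended radially. *)
Let phi (x : V) := u ((enorm x)^-1 *: x).

Let phi_sphere x : esphere R N x -> u x = phi x.
Proof. by move=> x1; rewrite /phi x1 invr1 scale1r. Qed.

Let cphi : csphere phi.
Proof.
move=> e e1; have e0 : enorm e != 0 by rewrite e1 oner_neq0.
have c : (enorm x)^-1 *: x @[x --> e] --> (enorm e)^-1 *: e.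
  have h : {for e, continuous (fun x : V => (enorm x)^-1)}.
    by apply: contV => //; exact: enorm_continuous.
  apply: (@cvg_row _ _ _ (nbhs e)) => j; rewrite !mxE; under eq_fun do rewrite !mxE.
  have h2 : {for e, continuous (fun x : V => x 0 j)} by exact: coord_continuous.
  exact: (contM h h2).
have e1' : (enorm e)^-1 *: e = e by rewrite e1 invr1 scale1r.
move=> U; rewrite /phi e1' => uU.
have /subspace_continuousP cu' := cu.
have := cu' e _ U uU; rewrite /from_subspace => /(_ _); rewrite /within /= => nU.
rewrite e1' in c; have := c _ (nU _); rewrite /= => h.
have e01 : 0 < enorm e by rewrite e1.
have ne : \forall x \near e, 0 < enorm x.
  by apply: (cvgr_gt _ (@enorm_continuous R N e) _ e01).
suff : \forall x \near e, U (u ((enorm x)^-1 *: x)) by [].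
have h' : \forall x \near e, eclosed_ball R N ((enorm x)^-1 *: x) -> U (u ((enorm x)^-1 *: x)).
  by apply: h; rewrite /eclosed_ball/= e1.
apply: filterS2 h' ne => x hx x0; apply: hx.
by rewrite /eclosed_ball/= enormZ gtr0_norm ?invr_gt0// mulVf// gt_eqF.
Qed.

Let phi_le1 e : esphere R N e -> `|phi e| <= 1.
Proof. by move=> e1; rewrite -phi_sphere// u_le1// /eclosed_ball/= e1. Qed.

Lemma slope_lower_bound :
  ((A_ R N - G / N%:R * (1 + kap R k.+1))%:E <= lower_radial_slope f zeta)%E.
Proof.
have [L [LP LD zonal]] := exists_axial_mean zeta1.
pose h := poisson_ext L phi.
have ch : {within eclosed_ball R N, continuous h} := continuous_poisson_ext LP LD cphi.
have dh := twice_derivable_poisson_ext LP cphi.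
have lh x : eball R N x -> \sum_i poisson_dd L phi i i x = 0.
  exact: poisson_integral_harmonic.
have uh x : esphere R N x -> u x = h x by move=> x1; rewrite /h poisson_ext_sphere// phi_sphere.
have G0 : 0 <= G := supnorm_ge0 cg.
have ule x : eclosed_ball R N x -> u x <= h x + G / (2 * N%:R) * (1 - dot x x).
  apply: (comparison cu du ch dh) => // y y1; rewrite lh// subr0.
  by have := lap_u_le y1; rewrite ler_norml => /andP[].
have hle x : eclosed_ball R N x -> h x <= u x + G / (2 * N%:R) * (1 - dot x x).
  apply: (comparison ch dh cu du) => // [y y1|y y1]; last by rewrite uh.
  by rewrite lh// sub0r lerN2; have := lap_u_le y1; rewrite ler_norml => /andP[].
have phi0 : L phi <= G / (2 * N%:R).
  have := hle 0; rewrite /h poisson_ext0// /u f0 !dot0l subr0 mulr1 add0r; apply.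
  by rewrite /eclosed_ball/= enorm0.
(* The lower bound for the slope at [r]; it tends to the claimed constant. *)
pose B r := (1 + r) * ((A_ R N + 2 * kap R k.+1) / 2 -
  radial k r 0 * (1 + G / (2 * N%:R)) - G / (2 * N%:R)).
apply: (@le_limf_einf _ _ _ _ B).
  have cr : {for (1 : R), continuous (fun r : R => radial k r 0)}.
    apply: (@cont_powR _ _ _ (fun r : R => sqdist r 0)); last by rewrite /sqdist; cont.
    by rewrite /sqdist; lra.
  have -> : A_ R N - G / N%:R * (1 + kap R k.+1) = B 1.
    rewrite /B; have -> : radial k 1 0 = kap R k.+1.
      by rewrite /radial /kap /half_dim /sqdist mulr0 subr0 expr1n.
    have N0 : N%:R != 0 :> R by rewrite pnatr_eq0.
    by move: (A_ R N) (N%:R) N0 => a x x0; field.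
  by apply: cvg_at_left_filter; have : {for (1 : R), continuous B} by rewrite /B; cont.
apply: filterS (radial_in_ball zeta1) => r [/andP[r0 r1] rb].
have rI : 0 <= r < 1 by rewrite ltW.
have r1' : 0 < 1 - r by rewrite subr_gt0.
rewrite ler_pdivlMr//; apply: (@le_trans _ _ (1 - u (r *: zeta))); last first.
  have -> : 1 - u (r *: zeta) = dot (f zeta - f (r *: zeta)) w.
    by rewrite dotBl -/w -enorm_sqr w1 expr1n.
  by apply: le_trans (ler_norm _) _; apply: le_trans (dot_le _ _) _; rewrite w1 mulr1.
have := gap_lower LP LD zonal zeta1 cphi phi_le1 rI; rewrite -/(h _).
have := ule _ (ltW rb : eclosed_ball R N (r *: zeta)).
have zz : dot zeta zeta = 1 by rewrite -enorm_sqr zeta1 expr1n.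
rewrite dotZl dotZr zz mulr1; move: phi0.
have : 0 <= radial k r 0 by rewrite powR_ge0.
rewrite /B; set c := radial k r 0; set a := G / _; set l := L phi; set A := (_ + _) / 2.
move=> c0 la hu gap.
have cl : c * l <= c * a by rewrite ler_wpM2l.
have : 0 <= (1 - r ^+ 2) * (c * a - c * l).
  by rewrite mulr_ge0 ?subr_ge0// expr_le1// ltW.
by nra.
Qed.

End LowerBound.

(** * Sharpness *)

Section C1Data.
Variables (R : realType) (k : nat).
Local Notation N := k.+3.
Local Notation V := 'rV[R]_N.
Implicit Types u : V -> R.

Lemma near_cont (u v : V -> R) x : (\forall y \near x, u y = v y) ->
  {for x, continuous u} -> {for x, continuous v}.
Proof.
move=> uv cu; have E : u x = v x := nbhs_singleton uv.
rewrite /prop_for /continuous_at -E; have FF : Filter (nbhs x) := nbhs_filter x.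
apply: cvg_trans cu; apply: (@near_eq_cvg _ _ (nbhs x)).
by apply: filterS uv => y ->.
Qed.

Lemma C1_on_of_derive u (u1 : 'I_N -> V -> R) :
  (forall x, eball R N x -> {for x, continuous u}) ->
  (forall i x, eball R N x -> is_derive x (delta_mx 0 i) u (u1 i x)) ->
  (forall i x, eball R N x -> {for x, continuous (u1 i)}) ->
  C1_on (eball R N) u.
Proof.
move=> cu du cu1 x x1; split; first exact: cu.
move=> i; have := du i x x1 => -[dx _]; split => //.
apply: near_cont (cu1 i x x1); apply: filterS (near_eball x1) => y y1.
by have /@derive_val := du i y y1; rewrite /partial => ->.
Qed.

End C1Data.

Section Sharpness.
Variables (R : realType) (k m : nat).
Local Notation N := k.+3.
Local Notation V := 'rV[R]_N.
Local Notation W := 'rV[R]_m.+1.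

Let zeta : V := delta_mx 0 ord0.
Let xi : W := delta_mx 0 ord0.

Section Witness.
Variables (L : (V -> R) -> R) (phi : V -> R).
Hypotheses (LP : spherical_mean L) (LD : divergence_free L) (cphi : csphere phi).
Local Notation h := (poisson_ext L phi).

(** A scalar harmonic function in a fixed direction of the target space. *)
Definition witness (x : V) : W := h x *: xi.

Let comp j : component witness j = fun x => xi 0 j * h x.
Proof. by apply/funext => x; rewrite /component /witness mxE mulrC. Qed.

Let d1 i := poisson_d L phi i.
Let d2 j i := poisson_dd L phi j i.

Let ch x : eball R N x -> {for x, continuous h}.
Proof.
move=> x1; apply: near_cont (continuous_mean_with LP cphi (fun x e => @cont_poisson R k x e) x1).
by apply: filterS (near_eball x1) => y y1; rewrite poisson_ext_ball.
Qed.

Let cd1 i x : eball R N x -> {for x, continuous (d1 i)}.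
Proof. by apply: (continuous_mean_with LP cphi) => y e y1 e1; exact: cont_poisson1. Qed.

Let cd2 j i x : eball R N x -> {for x, continuous (d2 j i)}.
Proof. by apply: (continuous_mean_with LP cphi) => y e y1 e1; exact: cont_poisson2. Qed.

Let cZ (c : R) (F : V -> R) x : {for x, continuous F} -> {for x, continuous (fun x => c * F x)}.
Proof. by move=> cF; cont. Qed.

Let dcomp j i x : eball R N x ->
  is_derive x (delta_mx 0 i) (component witness j) (xi 0 j * d1 i x).
Proof.
move=> x1; rewrite comp; have h1 : has_der x (delta_mx 0 i) h (d1 i x) by exact: der_poisson_ext.
by der; rewrite mulr0 addr0.
Qed.

Let pcomp j i x : eball R N x -> partial i (component witness j) x = xi 0 j * d1 i x.
Proof. by move=> x1; have /@derive_val := dcomp j i x1. Qed.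

Let ddcomp j i l x : eball R N x ->
  is_derive x (delta_mx 0 l) (partial i (component witness j)) (xi 0 j * d2 l i x).
Proof.
move=> x1; apply: (@der_near _ _ (fun x => xi 0 j * d1 i x)).
  by apply: filterS (near_eball x1) => y y1; rewrite pcomp.
have h1 : has_der x (delta_mx 0 l) (d1 i) (d2 l i x) by exact: der_poisson_integral1.
by der; rewrite mulr0 addr0.
Qed.

Lemma witness_C2 : C2_on (eball R N) witness.
Proof.
move=> j; split.
  apply: (C1_on_of_derive (u1 := fun i x => xi 0 j * d1 i x)) => [x x1|i x x1|i x x1].
  - by rewrite comp; apply: cZ; exact: ch.
  - exact: dcomp.
  - by apply: cZ; exact: cd1.
move=> i; apply: (C1_on_of_derive (u1 := fun l x => xi 0 j * d2 l i x)) => [x x1|l x x1|l x x1].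
- apply: (@near_cont _ _ (fun x => xi 0 j * d1 i x)); last by apply: cZ; exact: cd1.
  by apply: filterS (near_eball x1) => y y1; rewrite pcomp.
- exact: ddcomp.
- by apply: cZ; exact: cd2.
Qed.

Lemma witness_harmonic x : eball R N x -> laplacian witness x = 0.
Proof.
move=> x1; apply/rowP => j; rewrite !mxE.
under eq_bigr => i _ do [have /@derive_val := ddcomp j i i x1; rewrite /partial => ->].
rewrite -mulr_sumr; have -> : \sum_i d2 i i x = 0 by exact: poisson_integral_harmonic.
by rewrite mulr0.
Qed.

Lemma witness_continuous : {within eclosed_ball R N, continuous witness}.
Proof.
have /subspace_continuousP c := continuous_poisson_ext LP LD cphi.
apply/subspace_continuousP => x x1; have FF : Filter (within (eclosed_ball R N) (nbhs x)).
  exact: within_filter.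
apply: cvg_row => j; rewrite /= /witness !mxE; under eq_fun do rewrite !mxE.
by apply: cvgM; [exact: c|exact: cvg_cst].
Qed.

Lemma enorm_witness x : enorm (witness x) = `|h x|.
Proof. by rewrite enormZ (esphere_delta R ord0) mulr1. Qed.

End Witness.

(** At [r = 1] the upper bound for the slope is [A_n + 2 D d], and [D] is
    continuous and vanishes at [d = 0]. *)
Lemma sharp_constant (C : R) : A_ R N < C ->
  exists (f : V -> W) (zeta : V), [/\ {within eclosed_ball R N, continuous f},
    C2_on (eball R N) f, f @` eball R N `<=` eball R m.+1,
    (forall x, eball R N x -> laplacian f x = 0) & f 0 = 0] /\
    [/\ esphere R N zeta, enorm (f (r *: zeta)) @[r --> (1 : R)^'-] --> (1 : R)
     & ~ (C%:E <= lower_radial_slope f zeta)%E].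
Proof.
move=> AC; have zeta1 : esphere R N zeta := esphere_delta R ord0.
have [L [LP LD zonal]] := exists_axial_mean zeta1.
pose K := kap R k.+1; pose Q t : R := (2 - 2 * t) `^ (- half_dim R k).
pose D d : R := 2 * (K - Q (- d)) + (Q d - K).
have Q0 : Q 0 = K by rewrite /Q /K /kap /half_dim mulr0 subr0.
have [d [d01 Dd]] : exists d, 0 < d < 1 /\ A_ R N + 2 * D d < (A_ R N + C) / 2.
  have c1 : {for (0 : R), continuous Q}.
    by apply: (@cont_powR _ _ _ (fun t : R => 2 - 2 * t)); [rewrite mulr0 subr0|cont].
  have c2 : {for (0 : R), continuous (fun d : R => Q (- d))}.
    by apply: (@cont_comp _ _ _ Q (fun d : R => - d)); [rewrite oppr0|cont].
  have c3 : {for (0 : R), continuous (fun d => A_ R N + 2 * D d)} by rewrite /D; cont.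
  have c0 : A_ R N + 2 * D 0 < (A_ R N + C) / 2 by rewrite /D oppr0 Q0; lra.
  have [e /= e0 he] := cvgr_lt _ c3 _ c0.
  exists (Num.min (1 / 2) (e / 2)).
  have m0 : 0 < Num.min (1 / 2) (e / 2) by rewrite lt_min !divr_gt0.
  have m1 : Num.min (1 / 2) (e / 2) <= 1 / 2 by rewrite ge_min lexx.
  have m2 : Num.min (1 / 2) (e / 2) <= e / 2 by rewrite ge_min lexx orbT.
  split; first by rewrite m0/=; lra.
  by apply: he; rewrite /ball_/= sub0r normrN gtr0_norm//; lra.
have dI : 0 < d <= 1 by case/andP: d01 => -> /ltW.
pose phi := clamped_height zeta d; have cphi : csphere phi := @csphere_clamped_height R k zeta d.
have phi0 : L phi = 0 := mean_clamped_height zonal dI.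
pose f := witness L phi; exists f, zeta.
have cf : {within eclosed_ball R N, continuous f} := witness_continuous LP LD cphi.
(* Radial limit 1: the clamp is 1 at height 1, as [d <= 1]. *)
have hz : poisson_ext L phi zeta = 1.
  rewrite poisson_ext_sphere// /phi /clamped_height -enorm_sqr zeta1 expr1n.
  by have [[_ ->]|[h _]|[h _]] := clamp_cases 1 (proj1 (andP dI)) => //; move/andP: d01; lra.
have fz : f zeta = xi by rewrite /f /witness hz scale1r.
split; split => //.
- exact: witness_C2.
- by move=> _ [x x1 <-]; rewrite /eball/= enorm_witness; exact: poisson_ext_clamped_lt1.
- exact: witness_harmonic.
- by rewrite /f /witness poisson_ext0// phi0 scale0r.
- have := radial_cvg (within_cont_enorm cf) zeta1.
  by rewrite fz (esphere_delta R ord0).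
apply/negP; rewrite -ltNge; apply: (@le_lt_trans _ _ ((A_ R N + C) / 2)%:E); last by rewrite lte_fin; lra.
pose B r : R := (1 + r) * (r `^ (- N%:R) * ((A_ R N + 2 * kap R k.+1) / 2) - radial k r 0
    + (2 * (radial k r 0 - radial k r (- d)) + (radial k r d - radial k r 0))).
have B1 : B 1 = A_ R N + 2 * D d.
  have E t : radial k 1 t = Q t.
    by rewrite /radial /Q /sqdist; congr (_ `^ _); ring.
  by rewrite /B !E Q0 powR1 -/K /D; field.
have cB : {for (1 : R), continuous B}.
  have cr t : `|t| < 1 -> {for (1 : R), continuous (fun r : R => radial k r t)}.
    move=> t1; apply: (@cont_powR _ _ _ (fun r : R => sqdist r t)); last by rewrite /sqdist; cont.
    by move: t1; rewrite /sqdist ltr_norml => /andP[]; lra.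
  have cp : {for (1 : R), continuous (fun r : R => r `^ (- N%:R))}.
    by apply: (@cont_powR _ _ _ (fun r : R => r)) => //; cont.
  have d1 : `|d| < 1 by case/andP: d01 => d0 d1; rewrite gtr0_norm.
  have n0 : `|0 : R| < 1 by rewrite normr0.
  have c1 := cr 0 n0; have c2 := cr d d1; have c3 := cr (- d).
  rewrite normrN in c3; have {}c3 := c3 d1.
  by rewrite /B; cont.
apply: limf_einf_le.
have nB : \forall r \near (1 : R)^'-, B r < (A_ R N + C) / 2.
  apply: (@cvgr_lt _ _ _ _ B (B 1)); last by rewrite B1.
  exact: cvg_at_left_filter.
apply: filterS2 nB (radial_in_ball zeta1) => r Br [rI rb].
have /andP[r0 r1] := rI; have r1' : 0 < 1 - r by rewrite subr_gt0.
apply: le_trans (ltW Br); rewrite ler_pdivrMr// fz /f /witness -[X in enorm (X - _)]scale1r -scalerBl.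
rewrite enormZ (esphere_delta R ord0) mulr1 ger0_norm; last first.
  rewrite subr_ge0; have := poisson_ext_clamped_lt1 LP LD zonal dI rb.
  by rewrite ltr_norml => /andP[_ /ltW].
have := gap_upper LP LD zonal zeta1 dI rI.
rewrite /B; set X := (X in (1 - r ^+ 2) * X); move=> h.
have -> : (1 + r) * X * (1 - r) = (1 - r ^+ 2) * X by ring.
exact: h.
Qed.

End Sharpness.

Unset Implicit Arguments.
Set Strict Implicit.
Set Printing Implicit Defensive.

Theorem theorem2 (R : realType) (n m : nat) (hn : (3 <= n)%N) (hm : (1 <= m)%N) :
  (forall (g f : 'rV[R]_n -> 'rV[R]_m) (zeta : 'rV[R]_n),
      {within eclosed_ball R n, continuous g} ->
      supnorm g < n%:R * A_ R n / (1 + 2 `^ (- (n%:R / 2))) ->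
      {within eclosed_ball R n, continuous f} ->
      C2_on (eball R n) f ->
      f @` eball R n `<=` eball R m ->
      (forall x, eball R n x -> laplacian f x = g x) ->
      f 0 = 0 ->
      esphere R n zeta ->
      enorm (f (r *: zeta)) @[r --> (1 : R)^'-] --> (1 : R) ->
      ((A_ R n - supnorm g / n%:R * (1 + 1 / 2 `^ (n%:R / 2)))%:E
         <= lower_radial_slope f zeta)%E)
  /\
  (forall C : R, A_ R n < C ->
    ~ (forall (f : 'rV[R]_n -> 'rV[R]_m) (zeta : 'rV[R]_n),
        {within eclosed_ball R n, continuous f} ->
        C2_on (eball R n) f ->
        f @` eball R n `<=` eball R m ->
        (forall x, eball R n x -> laplacian f x = 0) ->
        f 0 = 0 ->
        esphere R n zeta ->
        enorm (f (r *: zeta)) @[r --> (1 : R)^'-] --> (1 : R) ->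
        (C%:E <= lower_radial_slope f zeta)%E)).
Proof.
case: n hn => [|[|[|k]]]// _; case: m hm => [|m']// _; split.
  move=> g f zeta cg _ cf f2 fb fg f0 z1 fz.
  have := slope_lower_bound cg cf f2 fb fg f0 z1 fz.
  by rewrite /kap powRN div1r.
move=> C AC H; have [f [zeta [[cf f2 fb fl f0] [z1 fz]]]] := sharp_constant m' AC.
by apply; exact: H.
Qed.
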